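(* Let $V^6(g_{ij})$ be a 6-dimensional pseudo-Riemannian space of signature $[++----]$. Suppose that a symmetric tensor $h_{ij}$ of characteristic $[33]$ and a function $\varphi$ satisfy in $V^6(g_{ij})$ the Eisenhart equation $$h_{ij,k}=2g_{ij}\varphi_{,k}+g_{ik}\varphi_{,j}+g_{jk}\varphi_{,i}.$$ Then there exists a holonomic coordinate system $(x^1,\dots,x^6)$ in which $\varphi$, $g_{ij}$ and $h_{ij}$ are given by the formulas $$\begin{aligned} g_{ij}dx^idx^j={}& e_3 (f_6-f_3)^3 \Big\{ (dx^2)^2 +4A\,dx^1dx^3+2(\epsilon x^1-2 A \Sigma_1)dx^2 dx^3\\ &\quad+\big((\epsilon x^1)^2-4\epsilon x^1 A \Sigma_1+4A^2 \Sigma_2\big) (dx^3)^2 \Big\}\\ &+e_6 (f_3-f_6)^3\Big\{ (dx^5)^2+4 \tilde{A}\,dx^4dx^6+2(\tilde{\epsilon} x^4+2 \tilde{A} \Sigma_1)dx^5dx^6\\ &\quad+\big((\tilde{\epsilon} x^4)^2+4\tilde{\epsilon} x^4 \tilde{A} \Sigma_1+4\tilde{A}^2\Sigma_2\big) (dx^6)^2 \Big\},\end{aligned}$$ $$\varphi=\tfrac{3}{2}(f_3+f_6)+c,\qquad h_{ij}=a_{ij}+3(f_3+f_6+c)g_{ij},$$ where $$\begin{aligned} a_{ij} dx^i dx^j={}&\epsilon x^3 g_{i_1 j_1}dx^{i_1}dx^{j_1}+2 g_{13}\, dx^2 dx^3+4A g_{22}(\epsilon x^1- A \Sigma_1)(dx^3)^2\\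 &+(\tilde {\epsilon} x^6 +a)g_{i_2 j_2}dx^{i_2}dx^{j_2}+2 g_{46}\, dx^5 dx^6+4\tilde{A}g_{55}(\tilde{\epsilon} x^4+\tilde{A}\Sigma_1)(dx^6)^2.\end{aligned}$$ Here the indices $i_1,j_1$ run over $1,2,3$ and $i_2,j_2$ run over $4,5,6$; $e_3,e_6=\pm1$; $\epsilon,\tilde\epsilon\in\{0,1\}$; $c$ and $a$ are constants, with $a\neq0$ when $\tilde\epsilon=0$; and $$f_3=\epsilon x^3,\quad f_6=\tilde\epsilon x^6+a,\quad A=\epsilon x^2+\theta(x^3),\quad \tilde A=\tilde\epsilon x^5+\omega(x^6),$$ $$\Sigma_1=3(f_6-f_3)^{-1},\quad \Sigma_2=3(f_6-f_3)^{-2},$$ where $\theta(x^3)$ and $\omega(x^6)$ are arbitrary functions, with $\theta(x^3)\neq0$ when $\epsilon=0$ and $\omega(x^6)\neq0$ when $\tilde\epsilon=0$.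
   Context: A comma denotes the covariant derivative with respect to the Levi-Civita connection of $g_{ij}$; summation over repeated indices is understood. All objects are smooth and all statements are local. The function $\varphi$ enters the Eisenhart equation only through its gradient, so it is considered up to an additive constant. A symmetric tensor $h_{ij}$ has characteristic $[33]$ (Segre symbol) if the characteristic equation $\det(h_{ij}-\lambda g_{ij})=0$ has exactly two distinct (real) roots $\lambda_3\neq\lambda_6$, each of multiplicity 3 and each corresponding to a single $3\times3$ Jordan block of the operator $g^{ik}h_{kj}$. Equivalently, at each point there is a coframe $\theta^1,\dots,\theta^6$ in which $$g=e_3(2\theta^1\theta^3+(\theta^2)^2)+e_6(2\theta^4\theta^6+(\theta^5)^2),$$ $$h=e_3\lambda_3(2\theta^1\theta^3+(\theta^2)^2)+2e_3\theta^2\theta^3+e_6\lambda_6(2\theta^4\theta^6+(\theta^5)^2)+2e_6\theta^5\theta^6,\qquad e_3,e_6=\pm1.$$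
   Formalization: The coordinates are shown to exist around each point near which each root of h−2φg is constant or has nonzero differential; such points are proved dense, and at other points the claim fails (e.g. root u² at u=0). φ is given up to an additive constant. *)

(* Defs.v *)
From HB Require Import structures.
From mathcomp Require Import all_boot all_order all_algebra.
From mathcomp Require Import all_classical all_reals all_analysis.

Set Implicit Arguments.
Unset Strict Implicit.
Unset Printing Implicit Defensive.

Import Order.TTheory GRing.Theory Num.Theory.
Import numFieldNormedType.Exports.

Local Open Scope classical_set_scope.
Local Open Scope ring_scope.

(* All statements being local, the space V^6 is an open set U of R^6: points
   are row vectors and a covariant 2-tensor field is a 6 x 6 matrix valued
   function. *)

Section Calculus.
Context {R : realType}.
Implicit Types (f : 'rV[R]_6 -> R) (U : set 'rV[R]_6).

Definition partial (k : 'I_6) f (x : 'rV[R]_6) : R :=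
  'D_(delta_mx 0 k) f x.

Definition partials (s : seq 'I_6) f : 'rV[R]_6 -> R := foldr partial f s.

(* C^oo on an open set: every iterated partial derivative is (Frechet)
   differentiable, hence continuous. *)
Definition smooth_on U f : Prop :=
  forall (s : seq 'I_6) x, U x -> differentiable (partials s f) x.

Definition smooth_map_on U (X : 'rV[R]_6 -> 'rV[R]_6) : Prop :=
  forall a, smooth_on U (fun x => X x 0 a).

Definition smooth_tensor_on U (g : 'rV[R]_6 -> 'M[R]_6) : Prop :=
  forall i j, smooth_on U (fun x => g x i j).

Definition smooth1_at (t : R) (f : R -> R) : Prop :=
  forall n, derivable (derive1n n f) t 1.

(* X : W -> W' is a local coordinate system on W, with inverse Y. *)
Definition coordinates (W W' : set 'rV[R]_6) (X Y : 'rV[R]_6 -> 'rV[R]_6) :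
    Prop :=
  [/\ open W /\ open W',
      forall u, W u -> W' (X u) /\ Y (X u) = u,
      forall x, W' x -> W (Y x) /\ X (Y x) = x,
      smooth_map_on W X & smooth_map_on W' Y].

(* With the library's convention for row vectors, ('J X u) i a is the
   derivative of the a-th component of X in the i-th direction, so this is
   sum_(a, b) T_ab(X u) d_i X^a d_j X^b. *)
Definition pullback (X : 'rV[R]_6 -> 'rV[R]_6) (T : 'rV[R]_6 -> 'M[R]_6)
    (u : 'rV[R]_6) : 'M[R]_6 :=
  'J X u *m T (X u) *m ('J X u)^T.

End Calculus.

Section Geometry.
Context {R : realType}.
Implicit Types (U : set 'rV[R]_6) (g h : 'rV[R]_6 -> 'M[R]_6)
  (phi : 'rV[R]_6 -> R).

Definition signature_ppmmmm (G : 'M[R]_6) : Prop :=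
  exists2 P : 'M[R]_6, P \in unitmx &
    P^T *m G *m P = diag_mx (\row_(i < 6) (if (i < 2)%N then 1 else - 1)).

Definition symmetric_tensor U h : Prop :=
  smooth_tensor_on U h /\ forall x, U x -> (h x)^T = h x.

Definition metric U g : Prop :=
  symmetric_tensor U g /\ forall x, U x -> signature_ppmmmm (g x).

(* christoffel g l i j x is Gamma^l_ij. *)
Definition christoffel g (l i j : 'I_6) (x : 'rV[R]_6) : R :=
  2^-1 * \sum_(m < 6) (invmx (g x)) l m *
    (partial i (fun y => g y m j) x + partial j (fun y => g y m i) x
     - partial m (fun y => g y i j) x).

(* covariant g h i j k x is h_{ij,k}. *)
Definition covariant g h (i j k : 'I_6) (x : 'rV[R]_6) : R :=
  partial k (fun y => h y i j) x
  - \sum_(l < 6) christoffel g l i k x * h x l j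
  - \sum_(l < 6) christoffel g l j k x * h x i l.

Definition eisenhart U g h phi : Prop :=
  forall x, U x -> forall i j k : 'I_6,
    covariant g h i j k x =
      2 * g x i j * partial k phi x + g x i k * partial j phi x
      + g x j k * partial i phi x.

Definition jordan_block (n : nat) (l : R) : 'M[R]_n :=
  \matrix_(i < n, j < n)
    (if i == j then l else if j == i.+1 :> nat then 1 else 0).

(* The operator g^{ik} h_{kj} has exactly the two distinct eigenvalues l3 and
   l6, each carried by a single 3 x 3 Jordan block. *)
Definition char33 (G H : 'M[R]_6) (l3 l6 : R) : Prop :=
  l3 != l6 /\
  exists2 P : 'M[R]_(3 + 3), P \in unitmx &
    (invmx G *m H) *m P =
      P *m block_mx (jordan_block 3 l3) 0 0 (jordan_block 3 l6).

Definition char33_on U g h : Prop :=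
  forall x, U x -> exists l3 l6, char33 (g x) (h x) l3 l6.

Definition constant_or_submersive (W : set 'rV[R]_6) (l : 'rV[R]_6 -> R) :
    Prop :=
  (forall x y, W x -> W y -> l x = l y) \/
  (forall x, W x -> exists k, partial k l x != 0).

(* h - 2 phi g is, by the Eisenhart equation, a tensor a_ij with
   a_{ij,k} = g_ik phi_,j + g_jk phi_,i; its roots are l3 - 2 phi and
   l6 - 2 phi.  Around a regular point each of them is either constant or has
   a nowhere vanishing differential.  In the canonical coordinates below they
   are, up to constants, eps * x^3 and epst * x^6 with eps, epst in {0, 1}, so
   such coordinates can only exist around regular points. *)
Definition regular_point U g h phi (p : 'rV[R]_6) : Prop :=
  exists (W : set 'rV[R]_6) (l3 l6 : 'rV[R]_6 -> R),
    [/\ open W /\ W p, W `<=` U,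
        smooth_on W l3 /\ smooth_on W l6,
        forall x, W x -> char33 (g x) (h x) (l3 x) (l6 x) &
        constant_or_submersive W (fun x => l3 x - 2 * phi x) /\
        constant_or_submersive W (fun x => l6 x - 2 * phi x)].

End Geometry.

Section CanonicalForm.
Context {R : realType}.

(* Coordinates are numbered 1, ..., 6 as is usual in tensor notation, whereas
   'I_6 is 0, ..., 5. *)
Definition ix (k : nat) : 'I_6 := inord k.-1.
Definition crd (k : nat) (x : 'rV[R]_6) : R := x 0 (ix k).

(* The symmetric product dx^i dx^j, as the matrix of a quadratic form; thus
   2 c dx^i dx^j (i <> j) has coefficient c in positions (i, j) and (j, i). *)
Definition dd (i j : nat) : 'M[R]_6 :=
  2^-1 *: (delta_mx (ix i) (ix j) + delta_mx (ix j) (ix i)).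

(* epst, omega and csta are the tilde epsilon, omega and a of the formulas;
   cstc is c. *)
Record canonical_data := CanonicalData {
  e3 : R; e6 : R;
  eps : R; epst : R;
  csta : R; cstc : R;
  theta : R -> R; omega : R -> R }.

Variable d : canonical_data.
Implicit Type x : 'rV[R]_6.

Definition admissible (W : set 'rV[R]_6) : Prop :=
  [/\ (e3 d = 1 \/ e3 d = -1) /\ (e6 d = 1 \/ e6 d = -1),
      (eps d = 0 \/ eps d = 1) /\ (epst d = 0 \/ epst d = 1),
      epst d = 0 -> csta d != 0,
      forall x, W x ->
        smooth1_at (crd 3 x) (theta d) /\ smooth1_at (crd 6 x) (omega d) &
      forall x, W x ->
        (eps d = 0 -> theta d (crd 3 x) != 0) /\
        (epst d = 0 -> omega d (crd 6 x) != 0)].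

Definition f3 x : R := eps d * crd 3 x.
Definition f6 x : R := epst d * crd 6 x + csta d.
Definition fA x : R := eps d * crd 2 x + theta d (crd 3 x).
Definition fAt x : R := epst d * crd 5 x + omega d (crd 6 x).
Definition Sigma1 x : R := 3 * (f6 x - f3 x)^-1.
Definition Sigma2 x : R := 3 * (f6 x - f3 x) ^- 2.

Definition canonical_g x : 'M[R]_6 :=
  let A := fA x in let At := fAt x in
  let S1 := Sigma1 x in let S2 := Sigma2 x in
  let u := eps d * crd 1 x in let ut := epst d * crd 4 x in
  (e3 d * (f6 x - f3 x) ^+ 3) *:
    (dd 2 2 + (4 * A) *: dd 1 3 + (2 * (u - 2 * A * S1)) *: dd 2 3
     + (u ^+ 2 - 4 * u * A * S1 + 4 * A ^+ 2 * S2) *: dd 3 3)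
  + (e6 d * (f3 x - f6 x) ^+ 3) *:
    (dd 5 5 + (4 * At) *: dd 4 6 + (2 * (ut + 2 * At * S1)) *: dd 5 6
     + (ut ^+ 2 + 4 * ut * At * S1 + 4 * At ^+ 2 * S2) *: dd 6 6).

Definition canonical_a x : 'M[R]_6 :=
  let A := fA x in let At := fAt x in let S1 := Sigma1 x in
  let g i j := canonical_g x (ix i) (ix j) in
  (eps d * crd 3 x) *: (\sum_(1 <= i < 4) \sum_(1 <= j < 4) g i j *: dd i j)
  + (2 * g 1%N 3%N) *: dd 2 3
  + (4 * A * g 2%N 2%N * (eps d * crd 1 x - A * S1)) *: dd 3 3
  + (epst d * crd 6 x + csta d) *:
      (\sum_(4 <= i < 7) \sum_(4 <= j < 7) g i j *: dd i j)
  + (2 * g 4%N 6%N) *: dd 5 6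
  + (4 * At * g 5%N 5%N * (epst d * crd 4 x + At * S1)) *: dd 6 6.

Definition canonical_h x : 'M[R]_6 :=
  canonical_a x + (3 * (f3 x + f6 x + cstc d)) *: canonical_g x.

Definition canonical_phi x : R := 3 / 2 * (f3 x + f6 x) + cstc d.

End CanonicalForm.

(* phi is only considered up to an additive constant, whence k0. *)
Definition canonical_coordinates_at (R : realType) (U : set 'rV[R]_6)
    (g h : 'rV[R]_6 -> 'M[R]_6) (phi : 'rV[R]_6 -> R) (p : 'rV[R]_6) : Prop :=
  exists (W W' : set 'rV[R]_6) (X Y : 'rV[R]_6 -> 'rV[R]_6) (d : canonical_data) (k0 : R),
    [/\ W p /\ W `<=` U, coordinates W W' X Y, admissible d W' &
        forall u, W u ->
          [/\ phi u = canonical_phi d (X u) + k0,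
              g u = pullback X (canonical_g d) u &
              h u = pullback X (canonical_h d) u]].

(* Main.v *)
From HB Require Import structures.
Require Import Defs.
From mathcomp Require Import all_boot all_order all_algebra.
From mathcomp Require Import all_classical all_reals all_analysis.
From mathcomp Require Import ring lra.
Import Order.TTheory GRing.Theory Num.Theory.
Import numFieldNormedType.Exports.
Local Open Scope classical_set_scope.
Local Open Scope ring_scope.

Set Implicit Arguments.
Unset Strict Implicit.
Unset Printing Implicit Defensive.

(* Put a = h - 2 phi g and L = g^-1 a, with eigenvalues l, m and d = m - l.
   A cyclic covector, made into a Jordan chain of L and then normalized by a
   polynomial in the nilpotent part, gives a smooth coframe th1, ..., th6 in
   which L is in Jordan form and the Gram matrix of g on the first block is that
   of e d^3 (1 - N/d)^3, i.e. of the warped metric of the canonical form.  An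
   operator that commutes with L and is skew for g vanishes, so the Eisenhart
   equation determines the connection in this coframe; the result is
     dl = B th3,  dth1 = 0,  dth2 = B th1 /\ th3,  dth3 = 2 B th2 /\ th3
   and the same for the second block.  Hence only the Poincare lemma is needed:
   if B <> 0, take x3 = l, x1 with dx1 = th1, x2 with dx2 = th2 - x1 dx3 and
   A = 1/(2 B); then th3 = 2 A dx3 and d(A - x2) is proportional to dx3, so that
   A - x2 is a function theta of x3.  If B = 0 the three forms are closed, and
   A = 1/2.  Regular points are dense because l and m are smooth, being given by
   the traces of L and L^2. *)

(** * Smooth functions *)

(** On the first block e d^3 (1 - N/d)^3 is e (m - L)^3, the characteristic polynomial of the other
    block evaluated at L; on the second block it is e' (l - L)^3. This gauge decouples the blocks:
    the gradient of one eigenvalue drops out of the structure equations of the other block, so each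
    triple of forms can be integrated on its own. In the canonical form f3 = eps x3 has no additive
    constant, whereas l may have one. Both eigenvalues are therefore shifted by a common constant s,
    which is then absorbed by c and by the constant up to which phi is considered. The functions
    theta and omega have to be functions of one real variable, while integration only yields
    functions with differential proportional to dx3 or dx6. The image of the chart is taken to be a
    ball for this reason: there such a function is constant along segments with fixed third or sixth
    coordinate, and its restriction to an axis line defines theta or omega. *)

Section Smooth.
Context {R : realType}.
Notation V := 'rV[R]_6.
Implicit Types (f g : V -> R) (U : set V) (k : 'I_6) (x y : V).

Lemma row_delta (v : V) : v = \sum_(k < 6) v 0 k *: delta_mx 0 k.
Proof. by rewrite {1}(row_sum_delta v). Qed.

Lemma partial_diff f x k : differentiable f x -> partial k f x = 'd f x (delta_mx 0 k).
Proof. by move=> df; rewrite /partial deriveE. Qed.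

Lemma diff_partial f x v : differentiable f x ->
  'd f x v = \sum_(k < 6) v 0 k * partial k f x.
Proof.
move=> df; rewrite {1}(row_delta v) linear_sum; apply: eq_bigr => k _.
by rewrite linearZ partial_diff.
Qed.

Lemma differentiable_eps f x : differentiable f x -> forall e, 0 < e ->
  \forall h \near (0 : V), `|f (h + x) - f x - 'd f x h| <= e * `|h|.
Proof.
move=> df e e0; have /eqaddoP /(_ e e0) := diff_locally df.
by apply: filterS => h; rewrite /= opprD addrA.
Qed.

Lemma eps_differentiable (V' W' : normedModType R) (f : V' -> W') (x : V')
    (df : {linear V' -> W'}) : continuous df ->
  (forall e : R, 0 < e ->
    \forall h \near (0 : V'), `|f (h + x) - f x - df h| <= e * `|h|) ->
  differentiable f x /\ 'd f x = df :> (V' -> W').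
Proof.
move=> dfc H.
have E : f \o shift x = cst (f x) + df +o_ 0 id.
  by apply/eqaddoP => e /H; apply: filterS => h; rewrite /= opprD addrA.
by have D := diff_unique dfc E; split=> //; apply/diff_locallyP; rewrite D.
Qed.

Definition lform (c : V) (h : V) : R := (h *m c^T) 0 0.
Lemma lformE c h : lform c h = \sum_(k < 6) h 0 k * c 0 k.
Proof. by rewrite /lform mxE; apply: eq_bigr => k _; rewrite mxE. Qed.
Lemma lform_linear c : linear (lform c).
Proof. by move=> a u v; rewrite /lform mulmxDl -scalemxAl !mxE. Qed.
HB.instance Definition _ c := GRing.isLinear.Build R V R _ (lform c) (lform_linear c).

Lemma coord_norm (v : V) k : `|v 0 k| <= `|v|.
Proof. by rewrite /Num.Def.normr /= mx_normrE; exact: (le_bigmax _ (fun ij => `|v ij.1 ij.2|) (0, k)). Qed.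

Lemma norm_le (v : V) (e : R) : 0 <= e -> (forall k, `|v 0 k| <= e) -> `|v| <= e.
Proof.
move=> e0 H; rewrite /Num.Def.normr /= mx_normrE; apply: bigmax_le => // -[i j] _.
by rewrite (ord1 i) H.
Qed.

Lemma lform_continuous c : continuous (lform c).
Proof.
have -> : lform c = \sum_(k < 6) (fun h : V => h 0 k * c 0 k).
  by apply/funext => h; rewrite lformE fct_sumE.
apply: (big_ind (fun f : V -> R => continuous f)) => [|f g cf cg|k _] x.
- exact: cst_continuous.
- by apply: continuousD; [exact: cf|exact: cg].
- by apply: continuousM; [exact: coord_continuous|exact: cst_continuous].
Qed.

(** The form in which primitives and local inverses are shown to be differentiable: the mean value
    estimates produce a quadratic remainder. *)
Lemma quadratic_approx (V' W' : normedModType R) (f : V' -> W') (x : V')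
    (df : {linear V' -> W'}) (C r : R) : continuous df -> 0 < r ->
  (forall h : V', `|h| < r -> `|f (h + x) - f x - df h| <= C * `|h| ^+ 2) ->
  differentiable f x /\ 'd f x = df :> (V' -> W').
Proof.
move=> cdf r0 H; apply: eps_differentiable => // e e0.
(* [C] may be zero or negative, hence e / (|C| + 1) as the radius within which C |h|^2 is at most e
   |h|. *)
have C0 : 0 < `|C| + 1 by rewrite ltr_wpDl.
near=> h.
have hr : `|h| < r by near: h; exact: nbhs0_lt.
have he : `|h| < e / (`|C| + 1) by near: h; apply: nbhs0_lt; rewrite divr_gt0.
apply: le_trans (H h hr) _; rewrite expr2 mulrA ler_wpM2r //.
apply: (@le_trans _ _ ((`|C| + 1) * `|h|)).
  by rewrite ler_wpM2r // (le_trans (ler_norm C)) // lerDl.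
by rewrite mulrC -ler_pdivlMr // ltW.
Unshelve. all: by end_near. Qed.

Lemma quadratic_differentiable f x (c : V) (C r : R) : 0 < r ->
  (forall h : V, `|h| < r -> `|f (x + h) - f x - \sum_(k < 6) h 0 k * c 0 k| <= C * `|h| ^+ 2) ->
  differentiable f x /\ forall k, partial k f x = c 0 k.
Proof.
move=> r0 H.
have [h hr|df D] := @quadratic_approx V R f x (lform c) C r (@lform_continuous c) r0.
  by have := H h hr; rewrite [x + h]addrC -lformE => /le_trans; apply.
split=> // k; transitivity (lform c (delta_mx 0 k)); first by rewrite partial_diff // D.
rewrite lformE (bigD1 k) //= mxE !eqxx mul1r big1 ?addr0 // => j jk.
by rewrite mxE eqxx /= (negbTE jk) mul0r.
Qed.

Lemma open_near U x (P : V -> Prop) : open U -> U x ->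
  (forall y, U y -> P y) -> \forall y \near x, P y.
Proof. by move=> oU Ux PU; near=> y; apply: PU; near: y; exact: open_nbhs_nbhs. Unshelve. all: by end_near. Qed.

Lemma eq_partial U f g x k : open U -> U x -> (forall y, U y -> f y = g y) ->
  partial k f x = partial k g x.
Proof. by move=> oU Ux fg; apply: near_eq_derive; apply: (@open_near U). Qed.

Lemma eq_differentiable U f g x : open U -> U x -> (forall y, U y -> f y = g y) ->
  differentiable f x -> differentiable g x.
Proof.
move=> oU Ux fg df.
suff [] : differentiable g x /\ 'd g x = 'd f x :> (V -> R) by [].
apply: eps_differentiable; first exact: diff_continuous.
move=> e e0; have := differentiable_eps df e0.
have nfg : \forall h \near (0 : V), f (h + x) = g (h + x).
  have : {near x, f =1 g} by apply: (@open_near U).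
  by rewrite (near_shift 0) subr0; apply: filterS => h.
by apply: filterS2 nfg => h; rewrite (fg x Ux) => ->.
Qed.

Lemma partials_rcons s k f : partials (rcons s k) f = partials s (partial k f).
Proof. by rewrite /partials foldr_rcons. Qed.

Lemma smooth_differentiable U f x : smooth_on U f -> U x -> differentiable f x.
Proof. by move=> sf; exact: (sf [::]). Qed.

Lemma smooth_partial U f k : smooth_on U f -> smooth_on U (partial k f).
Proof. by move=> sf s x Ux; rewrite -partials_rcons; exact: sf. Qed.

Lemma smooth_on_sub U U' f : U' `<=` U -> smooth_on U f -> smooth_on U' f.
Proof. by move=> UU sf s x Ux; apply: sf; exact: UU. Qed.

Lemma eq_partials U s f g x : open U -> U x -> (forall y, U y -> f y = g y) ->
  partials s f x = partials s g x.
Proof.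
move=> oU + fg; elim: s x => [|k s IH] x Ux /=; first exact: fg.
exact: (@eq_partial U _ _ _ _ oU Ux IH).
Qed.

Lemma eq_smooth_on U f g : open U -> (forall y, U y -> f y = g y) ->
  smooth_on U f -> smooth_on U g.
Proof.
move=> oU fg sf s x Ux; apply: (eq_differentiable oU Ux _ (sf s x Ux)) => y Uy.
exact: (eq_partials _ oU Uy fg).
Qed.

(** Smoothness as a greatest fixed point. In [partials] the last index of the list acts first, so
    peeling it off replaces [f] by another member of [C]. *)
Lemma smooth_coind U (C : (V -> R) -> Prop) : open U ->
  (forall f, C f -> (forall x, U x -> differentiable f x) /\
     forall k, exists2 g, C g & forall x, U x -> partial k f x = g x) ->
  forall f, C f -> smooth_on U f.
Proof.
move=> oU CP f Cf s; elim/last_ind: s f Cf => [|s k IH] f Cf x Ux.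
  by have [df _] := CP f Cf; exact: df.
have [_ /(_ k) [g Cg fg]] := CP f Cf.
rewrite partials_rcons; apply: (eq_differentiable oU Ux _ (IH g Cg x Ux)) => y Uy.
by apply: (eq_partials _ oU Uy) => z Uz; rewrite fg.
Qed.

Lemma partialD f g k x : differentiable f x -> differentiable g x ->
  partial k (fun y => f y + g y) x = partial k f x + partial k g x.
Proof. by move=> df dg; rewrite /partial deriveD //; exact: diff_derivable. Qed.

Lemma partialM f g k x : differentiable f x -> differentiable g x ->
  partial k (fun y => f y * g y) x = partial k f x * g x + f x * partial k g x.
Proof.
move=> df dg; rewrite /partial deriveM; [|exact: diff_derivable..].
by rewrite /GRing.scale /= addrC [X in X + _]mulrC.
Qed.

Lemma partialV f k x : differentiable f x -> f x != 0 ->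
  partial k (fun y => (f y)^-1) x = (- partial k f x) * ((f x)^-1 * (f x)^-1).
Proof.
move=> df f0; rewrite /partial deriveV //; last exact: diff_derivable.
by rewrite /GRing.scale /= -exprVn expr2; ring.
Qed.

Lemma differentiable_sqrt f x : differentiable f x -> 0 < f x ->
  differentiable (fun y => Num.sqrt (f y)) x.
Proof.
move=> df f0; apply: (@differentiable_comp _ _ _ _ f (@Num.sqrt R)) => //.
by apply/derivable1_diffP; have [] := is_derive1_sqrt f0.
Qed.

Lemma partial_sqrt f k x : differentiable f x -> 0 < f x ->
  partial k (fun y => Num.sqrt (f y)) x = 2^-1 * (partial k f x * (Num.sqrt (f x))^-1).
Proof.
move=> df f0; have ds : differentiable (@Num.sqrt R) (f x).
  by apply/derivable1_diffP; have [] := is_derive1_sqrt f0.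
rewrite partial_diff; last exact: differentiable_sqrt.
rewrite (@diff_comp _ _ _ _ f (@Num.sqrt R)) //= -partial_diff //.
rewrite -[partial k f x]mulr1 linearZ /= -deriveE // derive_sqrt //.
by rewrite /GRing.scale /= invfM; ring.
Qed.

(* Closing the smooth functions under all operations at once lets a single
   coinduction prove every closure property. *)
Inductive smooth_expr U : (V -> R) -> Prop :=
| smooth_expr_atom f : smooth_on U f -> smooth_expr U f
| smooth_exprD f g : smooth_expr U f -> smooth_expr U g ->
    smooth_expr U (fun x => f x + g x)
| smooth_exprM f g : smooth_expr U f -> smooth_expr U g ->
    smooth_expr U (fun x => f x * g x)
| smooth_exprV f : smooth_expr U f -> (forall x, U x -> f x != 0) ->
    smooth_expr U (fun x => (f x)^-1)
| smooth_expr_sqrt f : smooth_expr U f -> (forall x, U x -> 0 < f x) ->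
    smooth_expr U (fun x => Num.sqrt (f x)).

Lemma smooth_cst U (c : R) : smooth_on U (fun=> c).
Proof.
move=> s x _; suff [d ->] : exists d : R, partials s (fun=> c) = cst d by exact: differentiable_cst.
elim: s => [|k s [d IH]]; first by exists c.
by exists 0; apply/funext => y; rewrite /= IH /partial derive_cst.
Qed.

Lemma smooth_expr_smooth U f : open U -> smooth_expr U f -> smooth_on U f.
Proof.
move=> oU; apply: (smooth_coind oU) => {}f.
elim=> {f} [f sf|f g _ [df pf] _ [dg pg]|f g ef [df pf] eg [dg pg]|f ef [df pf] f0|f ef [df pf] f0];
  split=> [x Ux|k].
- exact: (smooth_differentiable sf).
- by exists (partial k f) => //; apply: smooth_expr_atom; exact: smooth_partial.
- exact: differentiableD (df x Ux) (dg x Ux).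
- have [f' ef' Ef] := pf k; have [g' eg' Eg] := pg k.
  exists (fun x => f' x + g' x); first exact: smooth_exprD.
  by move=> x Ux; rewrite partialD ?Ef ?Eg //; [exact: df|exact: dg].
- exact: differentiableM (df x Ux) (dg x Ux).
- have [f' ef' Ef] := pf k; have [g' eg' Eg] := pg k.
  exists (fun x => f' x * g x + f x * g' x).
    by apply: smooth_exprD; exact: smooth_exprM.
  by move=> x Ux; rewrite partialM ?Ef ?Eg //; [exact: df|exact: dg].
- exact: differentiableV (df x Ux) (f0 x Ux).
- have [f' ef' Ef] := pf k.
  exists (fun x => (-1) * f' x * ((f x)^-1 * (f x)^-1)).
    do 2?[apply: smooth_exprM => //]; try exact: smooth_exprV.
    exact/smooth_expr_atom/smooth_cst.
  by move=> x Ux; rewrite partialV ?Ef ?mulN1r //; [exact: df|exact: f0].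
- exact: differentiable_sqrt (df x Ux) (f0 x Ux).
- have [f' ef' Ef] := pf k.
  exists (fun x => 2^-1 * (f' x * (Num.sqrt (f x))^-1)).
    apply: smooth_exprM; first exact/smooth_expr_atom/smooth_cst.
    apply: smooth_exprM => //; apply: smooth_exprV; first exact: smooth_expr_sqrt.
    by move=> x Ux; rewrite gt_eqF // sqrtr_gt0 f0.
  by move=> x Ux; rewrite partial_sqrt ?Ef //; [exact: df|exact: f0].
Qed.

Lemma partial_coord k a x : partial k (fun u : V => u 0 a) x = (delta_mx 0 a : V) 0 k.
Proof.
have [//|h _|_ ->//] := @quadratic_differentiable (fun u => u 0 a) x (delta_mx 0 a) 0 1.
rewrite mul0r (bigD1 a) //= big1 => [|k0 k0a]; first by rewrite !mxE !eqxx mulr1 addr0 [x 0 a + _]addrC addrK subrr normr0.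
by rewrite mxE (negbTE k0a) andbF mulr0.
Qed.

Lemma smooth_coord U a : open U -> smooth_on U (fun x => x 0 a).
Proof.
move=> oU; apply: (@smooth_coind U (fun f => f = (fun x => x 0 a) \/ exists c, f = fun=> c)) => //; last by left.
move=> _ [->|[c ->]]; split=> [x _|k].
- exact: differentiable_coord.
- by exists (fun=> (delta_mx 0 a : V) 0 k) => [|x _]; [right; eexists|exact: partial_coord].
- exact: differentiable_cst.
- by exists (fun=> 0) => [|x _]; [right; exists 0|exact: derive_cst].
Qed.

Section Closure.
Variable U : set V.
Hypothesis oU : open U.

Lemma smoothD f g : smooth_on U f -> smooth_on U g -> smooth_on U (fun x => f x + g x).
Proof. by move=> sf sg; apply: smooth_expr_smooth => //; apply: smooth_exprD; exact: smooth_expr_atom. Qed.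

Lemma smoothM f g : smooth_on U f -> smooth_on U g -> smooth_on U (fun x => f x * g x).
Proof. by move=> sf sg; apply: smooth_expr_smooth => //; apply: smooth_exprM; exact: smooth_expr_atom. Qed.

Lemma smoothV f : smooth_on U f -> (forall x, U x -> f x != 0) -> smooth_on U (fun x => (f x)^-1).
Proof. by move=> sf f0; apply: smooth_expr_smooth => //; apply: smooth_exprV => //; exact: smooth_expr_atom. Qed.

Lemma smooth_sqrt f : smooth_on U f -> (forall x, U x -> 0 < f x) -> smooth_on U (fun x => Num.sqrt (f x)).
Proof. by move=> sf f0; apply: smooth_expr_smooth => //; apply: smooth_expr_sqrt => //; exact: smooth_expr_atom. Qed.

Lemma smoothN f : smooth_on U f -> smooth_on U (fun x => - f x).
Proof.
move=> sf; have := smoothM (@smooth_cst U (-1)) sf.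
by apply: eq_smooth_on => // y _; rewrite mulN1r.
Qed.

Lemma smoothB f g : smooth_on U f -> smooth_on U g -> smooth_on U (fun x => f x - g x).
Proof. by move=> sf sg; apply: smoothD => //; exact: smoothN. Qed.

Lemma smoothX f n : smooth_on U f -> smooth_on U (fun x => f x ^+ n).
Proof.
move=> sf; elim: n => [|n IH]; first exact: smooth_cst.
by apply: eq_smooth_on (smoothM sf IH) => // y _; rewrite exprS.
Qed.

Lemma smooth_sum (I : Type) (s : seq I) (P : pred I) (F : I -> V -> R) :
  (forall i, smooth_on U (F i)) -> smooth_on U (fun x => \sum_(i <- s | P i) F i x).
Proof.
move=> sF; elim: s => [|i s IH].
  by apply: eq_smooth_on (@smooth_cst U 0) => // y _; rewrite big_nil.
have [Pi|Pi] := boolP (P i).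
  by apply: eq_smooth_on (smoothD (sF i) IH) => // y _; rewrite big_cons Pi.
by apply: eq_smooth_on IH => // y _; rewrite big_cons (negbTE Pi).
Qed.

Lemma smooth_prod (I : Type) (s : seq I) (F : I -> V -> R) :
  (forall i, smooth_on U (F i)) -> smooth_on U (fun x => \prod_(i <- s) F i x).
Proof.
move=> sF; elim: s => [|i s IH].
  by apply: eq_smooth_on (@smooth_cst U 1) => // y _; rewrite big_nil.
by apply: eq_smooth_on (smoothM (sF i) IH) => // y _; rewrite big_cons.
Qed.

End Closure.
End Smooth.

Section SmoothMatrix.
Context {R : realType}.
Notation V := 'rV[R]_6.
Variable U : set V.
Hypothesis oU : open U.

Lemma smooth_det n (M : V -> 'M[R]_n) : (forall i j, smooth_on U (fun x => M x i j)) ->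
  smooth_on U (fun x => \det (M x)).
Proof.
move=> sM; apply: smooth_sum => // s; apply: smoothM => //; first exact: smooth_cst.
exact: smooth_prod.
Qed.

(** Cramer's rule: an entry of the inverse is a cofactor divided by the determinant. *)
Lemma smooth_invmx n (M : V -> 'M[R]_n) : (forall i j, smooth_on U (fun x => M x i j)) ->
  (forall x, U x -> M x \in unitmx) ->
  forall i j, smooth_on U (fun x => invmx (M x) i j).
Proof.
move=> sM uM i j.
have : smooth_on U (fun x => (\det (M x))^-1 * ((-1) ^+ (j + i) * \det (row' j (col' i (M x))))).
  apply: smoothM => //.
    by apply: smoothV => //; [exact: smooth_det|move=> x /uM; rewrite unitmxE unitfE].
  apply: smoothM => //; first exact: smooth_cst.
  apply: smooth_det => a b; apply: eq_smooth_on (sM (lift j a) (lift i b)) => // x _.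
  by rewrite !mxE.
by apply: eq_smooth_on => // x Ux; rewrite /invmx uM // !mxE.
Qed.

Lemma smooth_mulmx m n q (A : V -> 'M[R]_(m, n)) (B : V -> 'M[R]_(n, q)) :
  (forall i j, smooth_on U (fun x => A x i j)) ->
  (forall i j, smooth_on U (fun x => B x i j)) ->
  forall i j, smooth_on U (fun x => (A x *m B x) i j).
Proof.
move=> sA sB i j; have : smooth_on U (fun x => \sum_k A x i k * B x k j).
  by apply: smooth_sum => // k; exact: smoothM.
by apply: eq_smooth_on => // x _; rewrite mxE.
Qed.

End SmoothMatrix.

(** * Mean value and Taylor estimates on balls *)

Section MeanValue.
Context {R : realType}.
Notation V := 'rV[R]_6.
Implicit Types (f g : V -> R) (U : set V) (k : 'I_6) (x y p : V).

Lemma is_derive_line f x (h : V) (t : R) : differentiable f (x + t *: h) ->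
  is_derive t 1 (fun s : R => f (x + s *: h)) (\sum_(k < 6) h 0 k * partial k f (x + t *: h)).
Proof.
move=> df.
have dl : is_diff t (fun s : R => x + s *: h) (fun s : R => s *: h).
  by apply: is_diff_eq; rewrite add0r.
have dl1 : differentiable (fun s : R => x + s *: h) t by case: dl.
have dc : differentiable (fun s : R => f (x + s *: h)) t.
  exact: (@differentiable_comp _ _ _ _ (fun s : R => x + s *: h) f).
apply: DeriveDef; first exact/derivable1_diffP.
rewrite deriveE // (@diff_comp _ _ _ _ (fun s : R => x + s *: h) f) //=.
by rewrite (@diff_val _ _ _ _ _ _ _ dl) scale1r diff_partial.
Qed.

Lemma mvt f x (h : V) : (forall t : R, 0 <= t <= 1 -> differentiable f (x + t *: h)) ->
  exists2 t : R, 0 <= t <= 1 &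
    f (x + h) - f x = \sum_(k < 6) h 0 k * partial k f (x + t *: h).
Proof.
move=> df.
have [t| |t t01 E] := @MVT_segment R (fun s : R => f (x + s *: h))
  (fun s => \sum_(k < 6) h 0 k * partial k f (x + s *: h)) 0 1 ler01.
- by rewrite in_itv /= => /andP[t0 t1]; apply/is_derive_line/df; rewrite !ltW.
- apply: derivable_within_continuous => t; rewrite in_itv /= => t01.
  by have [] := is_derive_line (df t t01).
by exists t; [move: t01; rewrite in_itv|move: E; rewrite scale1r scale0r addr0 subr0 mulr1].
Qed.

Lemma ballP p (r : R) x : ball p r x <-> `|x - p| < r.
Proof. by rewrite -ball_normE /ball_ /= distrC. Qed.

Lemma ball_segment p (r : R) x h (t : R) : ball p r x -> ball p r (x + h) -> 0 <= t <= 1 ->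
  ball p r (x + t *: h).
Proof.
move=> /ballP xr /ballP yr /andP[t0 t1]; apply/ballP.
have -> : x + t *: h - p = (1 - t) *: (x - p) + t *: (x + h - p).
  by rewrite scalerBl scale1r !scalerBr !scalerDr; apply/rowP => i; rewrite !mxE; ring.
apply: le_lt_trans (ler_normD _ _) _; rewrite !normrZ [`|t|]ger0_norm // ger0_norm ?subr_ge0 //.
have [->|tn0] := eqVneq t 0; first by rewrite subr0 mul1r mul0r addr0.
have tp : 0 < t by rewrite lt_neqAle eq_sym tn0.
have : t * `|x + h - p| < t * r by rewrite ltr_pM2l.
have : (1 - t) * `|x - p| <= (1 - t) * r by rewrite ler_wpM2l ?subr_ge0 // ltW.
by move=> a b; have := ler_ltD a b; rewrite -mulrDl subrK mul1r.
Qed.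

(** The norm is the sup norm, so every sum over coordinates costs a factor 6; this is the source of
    the constants 6, 36 and 216 below. *)
Lemma sum_coord_bound (v : V) (c : 'I_6 -> R) (C : R) : (forall k, `|c k| <= C) ->
  `|\sum_(k < 6) v 0 k * c k| <= 6 * C * `|v|.
Proof.
move=> cC; apply: le_trans (ler_norm_sum _ _ _) _.
apply: (@le_trans _ _ (\sum_(k < 6) C * `|v|)).
  by apply: ler_sum => k _; rewrite normrM mulrC ler_pM // coord_norm.
by rewrite sumr_const card_ord mulrnAl -mulr_natl; lra.
Qed.

Lemma lipschitz_ball f p (r C : R) : 
  (forall x, ball p r x -> differentiable f x) ->
  (forall x, ball p r x -> forall k, `|partial k f x| <= C) ->
  forall x h, ball p r x -> ball p r (x + h) -> `|f (x + h) - f x| <= 6 * C * `|h|.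
Proof.
move=> df bf x h xr yr; have [t t01 ->] := mvt (fun t t01 => df _ (ball_segment xr yr t01)).
by apply: sum_coord_bound => k; apply: bf; exact: ball_segment.
Qed.

(** The mean value theorem yields the partials at an intermediate point and one factor |h|;
    replacing them by the partials at [x] costs a second factor |h|, by [lipschitz_ball]. *)
Lemma taylor_ball f p (r C : R) :
  (forall x, ball p r x -> differentiable f x) ->
  (forall x k, ball p r x -> differentiable (partial k f) x) ->
  (forall x, ball p r x -> forall j k, `|partial j (partial k f) x| <= C) ->
  forall x h, ball p r x -> ball p r (x + h) ->
  `|f (x + h) - f x - \sum_(k < 6) h 0 k * partial k f x| <= 36 * C * `|h| ^+ 2.
Proof.
move=> df ddf bf x h xr yr.
have [t t01 ->] := mvt (fun t t01 => df _ (ball_segment xr yr t01)).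
rewrite -sumrB.
under eq_bigr do rewrite -mulrBr.
apply: le_trans (sum_coord_bound (C := 6 * C * `|h|) _ _) _ => [k|]; last by rewrite expr2; lra.
apply: le_trans (lipschitz_ball (r := r) (C := C) _ _ xr _) _.
- by move=> y yr'; exact: ddf.
- by move=> y yr' j; exact: bf.
- exact: ball_segment.
case/andP: (t01) => t0 t1.
rewrite normrZ (ger0_norm t0) ler_wpM2l //.
  by rewrite mulr_ge0 // (le_trans _ (bf x xr k k)).
by rewrite ler_piMl.
Qed.

Lemma near_bound (I : finType) (F : I -> V -> R) U p : open U -> U p ->
  (forall i, smooth_on U (F i)) ->
  exists2 C : R, 0 <= C & \forall x \near p, forall i, `|F i x| <= C.
Proof.
move=> oU Up sF; exists (\sum_i `|F i p| + 1); first by rewrite addr_ge0 // sumr_ge0.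
apply: (@filter_forall _ I (fun i x => `|F i x| <= \sum_i `|F i p| + 1) _ (nbhs_filter p)) => i.
have c : {for p, continuous (F i)}.
  exact/differentiable_continuous/smooth_differentiable/Up.
have : \forall x \near p, `|F i p - F i x| < 1 by move/cvgrPdist_lt: c; apply.
apply: filterS => x Fx.
have -> : F i x = F i p - (F i p - F i x) by rewrite opprB addrC subrK.
apply: le_trans (ler_normB _ _) _; rewrite lerD ?(ltW Fx) //.
by rewrite (bigD1 i) //= lerDl sumr_ge0.
Qed.

Lemma near_ball (P : V -> Prop) p : (\forall x \near p, P x) ->
  exists2 r : R, 0 < r & forall x, ball p r x -> P x.
Proof. by move=> /nbhs_ballP [r /= r0 H]; exists r. Qed.

Lemma bounded_partials (I : finType) (F : I -> V -> R) U p : open U -> U p ->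
  (forall i, smooth_on U (F i)) ->
  exists r C : R, [/\ 0 < r, 0 <= C, ball p r `<=` U &
    forall x, ball p r x -> forall i j k,
      `|partial j (F i) x| <= C /\ `|partial j (partial k (F i)) x| <= C].
Proof.
move=> oU Up sF.
have [C C0 H] := @near_bound _ (fun ij : I * 'I_6 => partial ij.2 (F ij.1)) U p oU Up
  (fun ij => smooth_partial _ (sF _)).
have [D D0 K] := @near_bound _ (fun ij : I * ('I_6 * 'I_6) => partial ij.2.1 (partial ij.2.2 (F ij.1))) U p oU Up
  (fun ij => smooth_partial _ (smooth_partial _ (sF _))).
have UU : \forall x \near p, U x by apply: (open_near oU Up).
have [r r0 B] := near_ball (filterI (filterI H K) UU).
have CM : C <= C + D by rewrite lerDl.
have DM : D <= C + D by rewrite lerDr.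
exists r, (C + D); split; [exact: r0|exact: addr_ge0|by move=> x /B []|].
move=> x /B [[b1 b2] _] i j k; have := b1 (i, j); have := b2 (i, (j, k)) => /= c1 c2.
by split; [exact: le_trans CM|exact: le_trans DM].
Qed.

End MeanValue.

(** * Symmetry of second partials, and antiderivatives *)

Section Schwarz.
Context {R : realType}.
Notation V := 'rV[R]_6.
Implicit Types (f g : V -> R) (U : set V) (k i j : 'I_6) (x y p : V).

Lemma sum_delta (F : 'I_6 -> R) i : \sum_(k < 6) (delta_mx 0 i : V) 0 k * F k = F i.
Proof.
rewrite (bigD1 i) //= mxE !eqxx mul1r big1 ?addr0 // => k ki.
by rewrite mxE eqxx /= (negbTE ki) mul0r.
Qed.

Lemma norm_delta i : `|(delta_mx 0 i : V)| <= 1.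
Proof. by apply: norm_le => // k; rewrite mxE eqxx /=; case: (k == i); rewrite ?normr1 ?normr0. Qed.

Lemma is_derive_coord f x i (t : R) : differentiable f (x + t *: delta_mx 0 i) ->
  is_derive t 1 (fun s : R => f (x + s *: delta_mx 0 i)) (partial i f (x + t *: delta_mx 0 i)).
Proof. by move=> df; have := is_derive_line df; rewrite sum_delta. Qed.

Lemma ball_two p i j (r s t u : R) : 0 <= t <= s -> 0 <= u <= s -> 2 * s < r ->
  ball p r (p + u *: delta_mx 0 j + t *: delta_mx 0 i).
Proof.
move=> /andP[t0 ts] /andP[u0 us] sr; apply/ballP.
have -> : p + u *: delta_mx 0 j + t *: delta_mx 0 i - p = u *: delta_mx 0 j + t *: delta_mx 0 i.
  by apply/rowP => k; rewrite !mxE; ring.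
apply: le_lt_trans (ler_normD _ _) _.
rewrite !normrZ !ger0_norm //.
have := ler_wpM2l u0 (norm_delta j); have := ler_wpM2l t0 (norm_delta i); rewrite !mulr1; lra.
Qed.

(** Two mean value theorems: in direction [i] for the increment of [f] along [j], then in direction
    [j] for the [i]-th partial. The left side is symmetric in [i] and [j], which is what [schwarz]
    exploits. *)
Lemma second_difference f p i j (r s : R) : smooth_on (ball p r) f -> 0 < s -> 2 * s < r ->
  exists2 y, ball p r y &
    f (p + s *: delta_mx 0 j + s *: delta_mx 0 i) - f (p + s *: delta_mx 0 i)
    - f (p + s *: delta_mx 0 j) + f p = s * s * partial j (partial i f) y.
Proof.
move=> sf s0 sr.
have s00 : 0 <= (0 : R) <= s by rewrite lexx ltW.
have sss : 0 <= s <= s by rewrite lexx ltW.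
have B1 t : 0 <= t <= s -> ball p r (p + s *: delta_mx 0 j + t *: delta_mx 0 i).
  by move=> t0; apply: ball_two t0 sss sr.
have B0 t : 0 <= t <= s -> ball p r (p + t *: delta_mx 0 i).
  by move=> t0; have := ball_two p i j t0 s00 sr; rewrite scale0r addr0.
pose F t := f (p + s *: delta_mx 0 j + t *: delta_mx 0 i) - f (p + t *: delta_mx 0 i).
have dF t : 0 <= t <= s -> is_derive t 1 F
    (partial i f (p + s *: delta_mx 0 j + t *: delta_mx 0 i) - partial i f (p + t *: delta_mx 0 i)).
  move=> ts; apply: is_deriveB; apply: is_derive_coord.
    exact: smooth_differentiable sf (B1 t ts).
  exact: smooth_differentiable sf (B0 t ts).
have dF' t : t \in `]0, s[ -> 0 <= t <= s by rewrite in_itv /= => /andP[a b]; rewrite !ltW.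
have [|t] := @MVT_segment R F _ 0 s (ltW s0) (fun t ts => dF t (dF' t ts)).
  apply: derivable_within_continuous => t; rewrite in_itv /= => ts.
  by have [] := dF t ts.
rewrite in_itv /= => ts E.
pose G u := partial i f (p + t *: delta_mx 0 i + u *: delta_mx 0 j).
have B2 u : 0 <= u <= s -> ball p r (p + t *: delta_mx 0 i + u *: delta_mx 0 j).
  by move=> us; apply: ball_two us ts sr.
have dG u : 0 <= u <= s -> is_derive u 1 G (partial j (partial i f) (p + t *: delta_mx 0 i + u *: delta_mx 0 j)).
  move=> us; apply: is_derive_coord; apply: (smooth_differentiable (smooth_partial i sf)).
  exact: B2.
have [|u] := @MVT_segment R G _ 0 s (ltW s0) (fun u us => dG u (dF' u us)).
  apply: derivable_within_continuous => u; rewrite in_itv /= => us.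
  by have [] := dG u us.
rewrite in_itv /= => us E'.
exists (p + t *: delta_mx 0 i + u *: delta_mx 0 j); first exact: B2.
move: E E'; rewrite /F /G !scale0r !addr0 !subr0 [_ + t *: _ + s *: _]addrAC => E E'.
rewrite E' in E; rewrite -[LHS]/(_ - _ - _ + _); lra.
Qed.

Lemma eq_of_common_approx (a b : R) :
  (forall e : R, 0 < e -> exists c, `|a - c| < e /\ `|b - c| < e) -> a = b.
Proof.
move=> H; apply/eqP/contraT => ne.
have e0 : 0 < `|a - b| / 2 by rewrite divr_gt0 // normr_gt0 subr_eq0.
have [c [ac bc]] := H _ e0.
by have := le_lt_trans (ler_distD c a b) (ltrD ac (eq_ind _ (fun z => z < _) bc _ (distrC b c))); lra.
Qed.

(** The two orders of [second_difference] compute the same number, so the two mixed partials share a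
    value at points [y] and [z] arbitrarily close to [x]; continuity carries the equality to [x]. *)
Lemma schwarz U f x i j : open U -> smooth_on U f -> U x ->
  partial i (partial j f) x = partial j (partial i f) x.
Proof.
move=> oU sf Ux; apply: eq_of_common_approx => e e0.
have C (g : V -> R) : smooth_on U g -> \forall y \near x, `|g x - g y| < e.
  move=> sg; have : {for x, continuous g}.
    exact/differentiable_continuous/(smooth_differentiable sg).
  by move/cvgrPdist_lt; apply.
have UU : \forall y \near x, U y by apply: (open_near oU Ux).
have [r r0 B] := near_ball (filterI (filterI
   (C _ (smooth_partial i (smooth_partial j sf))) (C _ (smooth_partial j (smooth_partial i sf)))) UU).
have sB : smooth_on (ball x r) f by apply: smooth_on_sub sf => y /B [].
have s0 : 0 < r / 3 by rewrite divr_gt0.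
have sr : 2 * (r / 3) < r by move: r0; clear; lra.
move: (r / 3) s0 sr => s s0 sr.
have [y yr Ey] := second_difference i j sB s0 sr.
have [z zr Ez] := second_difference j i sB s0 sr.
exists (partial i (partial j f) z); split; first by have [[+ _] _] := B z zr.
have <- : partial j (partial i f) y = partial i (partial j f) z; last by have [[_ +] _] := B y yr.
apply: (mulfI (_ : s * s != 0)); first by rewrite mulf_neq0 // gt_eqF.
rewrite -[LHS]Ey -[RHS]Ez.
rewrite [x + s *: delta_mx 0 j + s *: delta_mx 0 i]addrAC.
by congr (_ + f x); exact: addrAC.
Qed.

Lemma smooth_of_partials U f : open U -> (forall x, U x -> differentiable f x) ->
  (forall k, exists2 g, smooth_on U g & forall x, U x -> partial k f x = g x) ->
  smooth_on U f.
Proof.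
move=> oU df pf s; case/lastP: s => [|s k] x Ux; first exact: df.
rewrite partials_rcons; have [g sg E] := pf k.
apply: (eq_differentiable oU Ux _ (sg s x Ux)) => y Uy.
by apply: (eq_partials _ oU Uy) => z Uz; rewrite E.
Qed.

Lemma antiderivative (f : R -> R) : (forall t : R, 0 <= t <= 1 -> {for t, continuous f}) ->
  exists F : R -> R, forall t : R, 0 <= t <= 1 -> is_derive t 1 F (f t).
Proof.
(* The derivatives at 0 and 1 are two-sided, so [f] is continued past the unit interval by clamping
   its argument, and the integral runs inside [-1, 2], where both endpoints are interior. *)
move=> cf; pose c (t : R) := Num.min 1 (Num.max 0 t).
have cP (t : R) : 0 <= c t <= 1 by rewrite /c le_min ler01 le_max lexx ge_min lexx.
have cE (t : R) : 0 <= t <= 1 -> c t = t.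
  by move=> /andP[t0 t1]; rewrite /c (max_idPr t0) (min_idPr t1).
have cc : continuous c.
  move=> t; apply: continuous_min; first exact: cst_continuous.
  by apply: continuous_max; [exact: cst_continuous|exact: cvg_id].
have cfc : continuous (f \o c).
  by move=> t; apply: continuous_comp; [exact: cc|exact: cf].
exists (fun b : R => (\int[lebesgue_measure]_(t in `[-1, b]) (f \o c) t)%R) => t /andP[t0 t1].
have [] // := @continuous_FTC1_closed R (f \o c) (-1) t 2 _ _ _ (cfc t).
- by rewrite (le_lt_trans t1) // ltr1n.
- by apply: continuous_compact_integrable; [exact: segment_compact|exact: continuous_subspaceT].
- by rewrite (lt_le_trans _ t0) // ltrN10.
by move=> dF; rewrite derive1E /= cE ?t0 // => E; apply: DeriveDef.
Qed.

End Schwarz.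

(** * The Poincare lemma and the inverse function theorem *)

Section Poincare.
Context {R : realType}.
Notation V := 'rV[R]_6.
Implicit Types (f g : V -> R) (U : set V) (k i j : 'I_6) (x y p : V).

Lemma sub_rearrange (a b c d s : R) : a - b - (c - d) - s = a - c - s - (b - d).
Proof. by ring. Qed.

(** The primitive is the integral of [w] along the segment from [p]. Nothing is differentiated under
    the integral sign: a quadratic remainder is enough, and it follows from one mean value theorem
    in the parameter of the segment. *)
Lemma poincare U p (w : 'I_6 -> V -> R) : open U -> U p ->
  (forall k, smooth_on U (w k)) ->
  (forall x, U x -> forall i j, partial i (w j) x = partial j (w i) x) ->
  exists2 r : R, 0 < r /\ ball p r `<=` U & exists2 f : V -> R, smooth_on (ball p r) f &
    forall x, ball p r x -> forall k, partial k f x = w k x.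
Proof.
move=> oU Up sw cw; have [r [C [r0 C0 BU bC]]] := bounded_partials oU Up sw.
exists r => //.
have dw i x : ball p r x -> differentiable (w i) x.
  by move=> /BU; exact: smooth_differentiable.
have ddw i k x : ball p r x -> differentiable (partial k (w i)) x.
  by move=> /BU; apply: smooth_differentiable; exact: smooth_partial.
have pr : ball p r p by exact: ballxx.
pose psi (v : V) (t : R) := \sum_i v 0 i * w i (p + t *: v).
(* [Phi v] is an antiderivative of the integrand along [v], known only up to a constant; hence [f]
   is the difference of its values at 1 and 0. Outside the ball 0 is a mere default. *)
have /choice [Phi HPhi] : forall v : V, exists F : R -> R, ball p r (p + v) ->
    forall t : R, 0 <= t <= 1 -> is_derive t 1 F (psi v t).
  move=> v; have [vr|vr] := pselect (ball p r (p + v)); last by exists 0 => /vr.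
  have [|F HF] := @antiderivative R (psi v); last by exists F.
  move=> t t01; apply: differentiable_continuous.
  have -> : psi v = \sum_i (fun t : R => v 0 i * w i (p + t *: v)).
    by apply/funext => s; rewrite fct_sumE.
  apply: differentiable_sum => i; apply: differentiableM => //.
  by apply/derivable1_diffP; have [] := is_derive_line (dw i _ (ball_segment pr vr t01)).
pose f (x : V) := Phi (x - p) 1 - Phi (x - p) 0.
have key x : ball p r x -> differentiable f x /\ forall k, partial k f x = w k x.
  move=> xr; have xr' : `|x - p| < r by apply/ballP.
  (* 216 r C = 6 * 36 C * r comes from the Taylor remainders weighted by [v], where |v| < r; 36 C =
     6 * 6 C comes from the increments weighted by [h]. *)
  have [|h hr|df pf] := @quadratic_differentiable R f x (\row_k w k x) (216 * r * C + 36 * C) (r - `|x - p|).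
  - by rewrite subr_gt0.
  - have xhr : ball p r (x + h).
      apply/ballP; rewrite addrAC; apply: le_lt_trans (ler_normD _ _) _.
      by rewrite -ltrBrDl.
    have [v Ev] : exists v, v = x - p by exists (x - p).
    have vE : p + v = x by rewrite Ev addrC subrK.
    have vhE : p + (v + h) = x + h by rewrite addrA vE.
    have -> : \sum_(k < 6) h 0 k * (\row_j w j x) 0 k = \sum_k h 0 k * w k (p + 1 *: v).
      by apply: eq_bigr => k _; rewrite mxE scale1r vE.
    have -> : f (x + h) - f x = (Phi (v + h) 1 - Phi (v + h) 0) - (Phi v 1 - Phi v 0).
      by rewrite /f (_ : x + h - p = v + h) -?Ev // Ev addrAC.
    (* D compares the integrals of w along the segments from p to x + h and to x;
       closedness of w makes its derivative O(|h|^2). *)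
    pose D (t : R) := Phi (v + h) t - Phi v t - t * (\sum_k h 0 k * w k (p + t *: v)).
    have Bt (t : R) : 0 <= t <= 1 -> ball p r (p + t *: v).
      by move=> t01; apply: ball_segment => //; rewrite vE.
    have Bht (t : R) : 0 <= t <= 1 -> ball p r (p + t *: v + t *: h).
      by move=> t01; rewrite -addrA -scalerDr; apply: ball_segment => //; rewrite vhE.
    have dD (t : R) : 0 <= t <= 1 -> is_derive t 1 D (psi (v + h) t - psi v t
        - (\sum_k h 0 k * w k (p + t *: v)
           + t * \sum_k h 0 k * \sum_i v 0 i * partial i (w k) (p + t *: v))).
      move=> t01; apply: is_deriveB; first apply: is_deriveB.
      + by apply: HPhi => //; rewrite vhE.
      + by apply: HPhi => //; rewrite vE.
      have dk k : is_derive t 1 (fun s : R => h 0 k * w k (p + s *: v))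
          (h 0 k * \sum_i v 0 i * partial i (w k) (p + t *: v)).
        have d1 := @is_derive_line R (w k) p v t (dw k _ (Bt t t01)).
        exact: is_deriveZ.
      have dS : is_derive t 1 (fun s : R => \sum_k h 0 k * w k (p + s *: v))
          (\sum_k h 0 k * \sum_i v 0 i * partial i (w k) (p + t *: v)).
        have -> : (fun s : R => \sum_k h 0 k * w k (p + s *: v)) = \sum_k (fun s : R => h 0 k * w k (p + s *: v)).
          by apply/funext => s; rewrite fct_sumE.
        exact: is_derive_sum.
      apply: is_derive_eq (is_deriveM (is_derive_id t 1) dS) _.
      by rewrite /GRing.scale /= mulr1 addrC.
    have dD' (t : R) : t \in `]0, 1[ -> 0 <= t <= 1.
      by rewrite in_itv /= => /andP[a b]; rewrite !ltW.
    have [|c] := @MVT_segment R D _ 0 1 ler01 (fun t ts => dD t (dD' t ts)).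
      apply: derivable_within_continuous => t; rewrite in_itv /= => ts.
      by have [] := dD t ts.
    rewrite in_itv /= subr0 mulr1 => c01 E.
    have -> : Phi (v + h) 1 - Phi (v + h) 0 - (Phi v 1 - Phi v 0)
        - \sum_k h 0 k * w k (p + 1 *: v) = D 1 - D 0.
      by rewrite /D mul1r mul0r subr0; exact: sub_rearrange.
    set q := p + c *: v in E *; have qr : ball p r q := Bt c c01.
    have qhr : ball p r (q + c *: h) := Bht c c01.
    (* Closedness turns the [i]-th partial of [w k] into the [k]-th partial of [w i]; the derivative
       of [D] then splits into Taylor remainders weighted by [v] and increments weighted by [h]. *)
    rewrite {}E (_ : _ - _ = \sum_i v 0 i * (w i (q + c *: h) - w i q
        - \sum_k (c *: h) 0 k * partial k (w i) q) + \sum_i h 0 i * (w i (q + c *: h) - w i q)); last first.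
      rewrite /psi -/q [in LHS]scalerDr [p + (_ + _)]addrA -/q mulr_sumr.
      under [X in _ - (_ + X)]eq_bigr do rewrite mulrA mulr_sumr.
      rewrite exchange_big /= -!sumrB -!big_split /= -sumrB.
      apply: eq_bigr => i _; rewrite mxE.
      have -> : \sum_k c * h 0 k * (v 0 i * partial i (w k) q)
          = v 0 i * \sum_k (c *: h) 0 k * partial k (w i) q.
        rewrite mulr_sumr; apply: eq_bigr => k _; rewrite mxE (cw q (BU q qr) i k).
        by ring.
      by ring.
    have hc : `|c *: h| <= `|h|.
      by case/andP: c01 => c0 c1; rewrite normrZ ger0_norm // ler_piMl.
    apply: le_trans (ler_normD _ _) _; rewrite mulrDl; apply: lerD.
      apply: le_trans (sum_coord_bound (C := 36 * C * `|h| ^+ 2) _ _) _ => [i|].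
        apply: le_trans (taylor_ball (C := C) (dw i) _ _ qr qhr) _.
        - by move=> x' k x'r; exact: ddw.
        - by move=> x' x'r j k; have [] := bC x' x'r i j k.
        by rewrite ler_wpM2l ?mulr_ge0 // ler_pXn2r ?nnegrE.
      have : C * `|h| ^+ 2 * `|v| <= C * `|h| ^+ 2 * r.
        by rewrite ler_wpM2l ?mulr_ge0 ?exprn_ge0 // ltW // Ev.
      by clear; lra.
    apply: le_trans (sum_coord_bound (C := 6 * C * `|h|) _ _) _ => [i|]; last by rewrite expr2; lra.
    apply: le_trans (lipschitz_ball (C := C) (dw i) _ qr qhr) _.
      by move=> x' x'r k; have [] := bC x' x'r i k k.
    by rewrite ler_wpM2l ?mulr_ge0.
  by split=> // k; rewrite pf mxE.
exists f => [|x xr k]; last by have [_ ->] := key x xr.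
apply: smooth_of_partials; first exact: ball_open.
  by move=> x /key [].
move=> k; exists (w k); first exact: smooth_on_sub BU _.
by move=> x /key [_ ->].
Qed.

End Poincare.

(* Makes the join of the complete and normed structures of 'rV available. *)
HB.instance Definition _ (R : realType) := Complete.copy 'rV[R]_6 'rV[R]_6.

Section InverseFunction.
Context {R : realType}.
Notation V := 'rV[R]_6.
Implicit Types (f g : V -> R) (U : set V) (X Y : V -> V) (k i j a : 'I_6) (x y p u v z : V).

Lemma coord_differentiable X x : (forall a, differentiable (fun u => X u 0 a) x) ->
  differentiable X x.
Proof.
move=> dX; have -> : X = \sum_a (fun u => X u 0 a *: delta_mx 0 a : V).
  by apply/funext => u; rewrite fct_sumE {1}(row_delta (X u)).
by apply: differentiable_sum => a; exact: differentiableZl.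
Qed.

Lemma jacobianE X x i a : (forall a, differentiable (fun u => X u 0 a) x) ->
  'J X x i a = partial i (fun u => X u 0 a) x.
Proof.
move=> dX; have dXx := coord_differentiable dX.
rewrite /jacobian /lin1_mx mxE -deriveE // derive_mx ?mxE //; exact: diff_derivable.
Qed.

Lemma mulmx_bound (M : 'M[R]_6) : exists2 K : R, 0 < K & forall v, `|v *m M| <= K * `|v|.
Proof.
exists (6 * (\sum_i \sum_j `|M i j| + 1)).
  by rewrite mulr_gt0 // ltr_wpDl // sumr_ge0 // => i _; exact: sumr_ge0.
move=> v; apply: norm_le => [|j].
  by rewrite !mulr_ge0 // addr_ge0 // sumr_ge0 // => i _; exact: sumr_ge0.
rewrite mxE; apply: sum_coord_bound => k; rewrite (bigD1 k) //= (bigD1 j) //= -!addrA lerDl.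
by rewrite !addr_ge0 // ?sumr_ge0 // => i _; exact: sumr_ge0.
Qed.

Lemma mulmx_continuous (M : 'M[R]_6) : continuous (mulmxr M : V -> V).
Proof.
move=> v; apply/differentiable_continuous/coord_differentiable => a.
have -> : (fun u : V => (mulmxr M u) 0 a) = \sum_k (fun u : V => u 0 k * M k a).
  by apply/funext => u; rewrite fct_sumE mxE.
apply: differentiable_sum => k; apply: differentiableM => //.
exact: differentiable_coord.
Qed.

(** A quantitative inverse function theorem. Besides surjectivity onto a ball it keeps a Lipschitz
    bound for the inverse and a quadratic remainder at every point, from which [inverse_coordinates]
    obtains the derivative of the inverse. *)
Lemma near_inverse U p X : open U -> U p -> smooth_map_on U X -> 'J X p \in unitmx ->
  exists r C K : R, [/\ 0 < r, 0 <= C, 0 < K & [/\ ball p r `<=` U,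
    (forall u v, ball p r u -> ball p r v -> `|v - u| <= K * `|X v - X u|),
    (forall u v, ball p r u -> ball p r v ->
       `|X v - X u - (v - u) *m 'J X u| <= C * `|v - u| ^+ 2) &
    exists2 rho : R, 0 < rho & forall z, ball (X p) rho z -> exists2 u, ball p r u & X u = z]].
Proof.
move=> oU Up sX uJ.
have [r [C [r0 C0 BU bC]]] := bounded_partials oU Up sX.
have dX x a : U x -> differentiable (fun u => X u 0 a) x.
  by move=> Ux; exact: smooth_differentiable (sX a) Ux.
have dX' x k a : ball p r x -> differentiable (partial k (fun u => X u 0 a)) x.
  by move=> /BU Ux; apply: smooth_differentiable Ux; exact: smooth_partial (sX a).
have pr : ball p r p by exact: ballxx.
set M := invmx ('J X p); have [K K0 HK] := mulmx_bound M.
(* r / 2 keeps the closed ball of radius [r1] inside the ball of radius r; the second bound makes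
   the contraction ratio 36 C K r1 at most 1/2. *)
pose r1 := Num.min (r / 2) (72 * (C + 1) * K)^-1.
have C1 : 0 < C + 1 by rewrite ltr_wpDl.
have q0 : 0 < 72 * (C + 1) * K by rewrite !mulr_gt0.
have r10 : 0 < r1 by rewrite lt_min divr_gt0 // invr_gt0.
have r1r : r1 < r by rewrite gt_min ltr_pdivrMr // mulr2n mulrDr mulr1 ltrDl r0.
have r1K : K * (36 * C * r1) <= 2^-1.
  have : r1 * (72 * (C + 1) * K) <= 1 by rewrite -ler_pdivlMr // mul1r ge_min lexx orbT.
  have : 0 <= K * r1 by rewrite mulr_ge0 // ltW.
  by clear; lra.
have sub s u : s <= r -> ball p s u -> ball p r u by move=> sr; exact: le_ball.
(* the map u |-> u - X(u) M is a contraction with ratio 1/2 near p *)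
have contr u v : `|u - p| <= r1 -> `|v - p| <= r1 ->
    `|(v - u) - (X v - X u) *m M| <= 2^-1 * `|v - u|.
  move=> ur vr; have ur' : ball p r u by apply/ballP/(le_lt_trans ur).
  have vr' : ball p r v by apply/ballP/(le_lt_trans vr).
  have -> : v - u - (X v - X u) *m M = - ((X v - X u - (v - u) *m 'J X p) *m M).
    by rewrite [in RHS]mulmxBl mulmxK // opprB.
  rewrite normrN; apply: le_trans (HK _) _.
  apply: (@le_trans _ _ (K * (36 * C * r1 * `|v - u|))); last first.
    by rewrite mulrA ler_wpM2r.
  rewrite ler_wpM2l ?(ltW K0) //; apply: norm_le => [|a].
    by rewrite !mulr_ge0 // ltW.
  rewrite !mxE.
  have uv : u + (v - u) = v by rewrite addrC subrK.
  have seg (t : R) : 0 <= t <= 1 -> ball p r (u + t *: (v - u)).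
    by move=> t01; apply: ball_segment; rewrite ?uv.
  have [t t01] := mvt (fun t t01 => dX _ a (BU _ (seg t t01))).
  rewrite uv => ->; rewrite -sumrB.
  under eq_bigr do rewrite -mulrBr.
  apply: le_trans (sum_coord_bound (C := 6 * C * r1) _ _) _ => [k|]; last by clear; lra.
  rewrite jacobianE; last by move=> b; exact: dX.
  have E : u + t *: (v - u) = p + (u + t *: (v - u) - p) by rewrite [RHS]addrC subrK.
  rewrite E; apply: le_trans (lipschitz_ball (C := C) (fun x => @dX' x k a) _ pr _) _.
  - by move=> x xr l; have [] := bC x xr a l k.
  - by rewrite -E; exact: seg.
  rewrite ler_wpM2l ?mulr_ge0 //.
  have -> : u + t *: (v - u) - p = (1 - t) *: (u - p) + t *: (v - p).
    by apply/rowP => l; rewrite !mxE; ring.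
  case/andP: t01 => t0 t1; apply: le_trans (ler_normD _ _) _.
  rewrite !normrZ [`|t|]ger0_norm // ger0_norm ?subr_ge0 //.
  have := ler_wpM2l t0 vr; have : (1 - t) * `|u - p| <= (1 - t) * r1 by rewrite ler_wpM2l ?subr_ge0.
  by clear; lra.
(* By the triangle inequality and [contr], |v - u| is at most K |X v - X u| plus half of itself. *)
have lower u v : `|u - p| <= r1 -> `|v - p| <= r1 -> `|v - u| <= 2 * K * `|X v - X u|.
  move=> ur vr; have := contr u v ur vr; have := HK (X v - X u).
  have := ler_distD ((X v - X u) *m M) (v - u) 0; rewrite !subr0.
  by move: `|v - u| => n1; clear; lra.
exists r1, (36 * C), (2 * K); split; rewrite ?mulr_ge0 ?mulr_gt0 //; split.
- by move=> x xr; apply: BU; exact: sub (ltW r1r) xr.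
- by move=> u v /ballP ur /ballP vr; apply: lower; exact: ltW.
- move=> u v ur vr; have ur' := sub _ _ (ltW r1r) ur; have vr' := sub _ _ (ltW r1r) vr.
  have uv : u + (v - u) = v by rewrite addrC subrK.
  apply: norm_le => [|a]; first by rewrite !mulr_ge0.
  have -> : (X v - X u - (v - u) *m 'J X u) 0 a = X v 0 a - X u 0 a
      - \sum_k (v - u) 0 k * partial k (fun u => X u 0 a) u.
    have JE k : 'J X u k a = partial k (fun u => X u 0 a) u.
      by apply: jacobianE => b; exact/dX/BU.
    by rewrite !mxE; congr (_ - _); apply: eq_bigr => k _; rewrite -JE !mxE.
  have := @taylor_ball R (fun u => X u 0 a) p r C _ _ _ u (v - u) ur'; rewrite uv; apply=> //.
  + by move=> x xr; exact/dX/BU.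
  + by move=> x k xr; exact: dX'.
  + by move=> x xr j k; have [] := bC x xr a j k.
(* This radius bounds the displacement (z - X p) M by r1 / 2; the contraction contributes another r1
   / 2, so [Phi] preserves the closed ball. *)
exists (r1 / 2 / K); first by rewrite !divr_gt0.
move=> z /ballP zr.
have zM : `|(z - X p) *m M| < r1 / 2.
  by apply: le_lt_trans (HK _) _; rewrite mulrC -ltr_pdivlMr.
pose B := [set u : V | `|u - p| <= r1].
(* A Newton step with derivative frozen at [p]: at a fixed point (z - X u) M = 0, and [M] is
   invertible. *)
pose Phi (u : V) := u + (z - X u) *m M.
have PhiE u v : Phi v - Phi u = (v - u) - (X v - X u) *m M.
  rewrite /Phi opprD addrACA -mulmxBl; congr (_ + _); rewrite -mulNmx; congr (_ *m _).
  by apply/rowP => l; rewrite !mxE; ring.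
have PhiB u : B u -> `|Phi u - p| < r1.
  move=> Bu; have := contr p u _ Bu; rewrite subrr normr0 -PhiE => /(_ (ltW r10)) H.
  have -> : Phi u - p = (Phi u - Phi p) + (z - X p) *m M.
    by rewrite {2}/Phi opprD -!addrA addNr addr0.
  apply: le_lt_trans (ler_normD _ _) _; move: H zM Bu; rewrite /B /=.
  by move: `|_| `|_| `|_| => n1 n2 n3; clear; lra.
have BB : {homo Phi : u / B u >-> B u} by move=> u /PhiB /ltW.
have ctr : is_contraction (mkfun_fun BB).
  exists (2^-1)%:nng; split => /=; first by rewrite invf_lt1 // ltr1n.
  by move=> [u v] /= [Bu Bv]; rewrite PhiE; exact: contr.
have [u Bu uE] : exists2 u, B u & u = Phi u.
  apply: (banach_fixed_point ctr); last by exists p; rewrite /B /= subrr normr0 ltW.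
  apply: (@closed_comp _ _ (fun u : V => `|u - p|) [set x | x <= r1]); last exact: closed_le.
  move=> u _; apply: (@continuous_comp _ _ _ (fun u : V => u - p) Num.norm); last exact: norm_continuous.
  by apply: continuousB; [exact: cvg_id|exact: cst_continuous].
exists u; first by apply/ballP; rewrite uE; exact: PhiB.
move: uE; rewrite /Phi -[LHS]addr0 => /addrI /esym E.
have : (z - X u) *m M *m 'J X p = 0 by rewrite E mul0mx.
by rewrite mulmxKV // => /eqP; rewrite subr_eq0 => /eqP.
Qed.
End InverseFunction.

Section InverseCoordinates.
Context {R : realType}.
Notation V := 'rV[R]_6.
Implicit Types (f g : V -> R) (U W : set V) (X Y : V -> V) (k i j a : 'I_6) (x y p u v z : V).

(** The image is made a ball and the source shrunk to its preimage, because functions of a single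
    coordinate are recognised later by moving along segments in the image. *)
Lemma inverse_coordinates U p X : open U -> U p -> smooth_map_on U X ->
  (forall x, U x -> 'J X x \in unitmx) ->
  exists W (rho : R) Y, [/\ 0 < rho, W p, W `<=` U, coordinates W (ball (X p) rho) X Y &
    forall f, smooth_on W f -> smooth_on (ball (X p) rho) (f \o Y) /\
      forall z j, ball (X p) rho z ->
        partial j (f \o Y) z = \sum_a invmx ('J X (Y z)) j a * partial a f (Y z)].
Proof.
move=> oU Up sX uJ.
have [r [C [K [r0 C0 K0 [BU lower quad [rho rho0 surj]]]]]] := near_inverse oU Up sX (uJ p Up).
pose W' := ball (X p) rho; pose W := [set u | ball p r u /\ W' (X u)].
have oW' : open W' by exact: ball_open.
have dX x : U x -> differentiable X x.
  by move=> Ux; apply: coord_differentiable => a; exact: smooth_differentiable (sX a) Ux.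
have oW : open W.
  rewrite openE => u [ur uW']; rewrite /interior.
  have c : {for u, continuous X} by exact/differentiable_continuous/dX/BU.
  have : nbhs u (ball p r) by apply: open_nbhs_nbhs; split=> //; exact: ball_open.
  have : nbhs u (X @^-1` W') by apply: c; exact: open_nbhs_nbhs.
  by move=> A B; apply: filterS (filterI B A).
have inj u v : ball p r u -> ball p r v -> X u = X v -> v = u.
  move=> ur vr E; apply/eqP; rewrite -subr_eq0 -normr_le0.
  by have := lower u v ur vr; rewrite E subrr normr0 mulr0.
have /choice [Y HY] : forall z, exists u, W' z -> ball p r u /\ X u = z.
  move=> z; have [W'z|nW'z] := pselect (W' z); last by exists 0.
  by have [u ur uE] := surj z W'z; exists u.
have YW z : W' z -> W (Y z) by move=> W'z; have [b e] := HY z W'z; split; rewrite ?e.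
have XY z : W' z -> X (Y z) = z by move=> /HY [].
have YX u : W u -> Y (X u) = u.
  by move=> [ur W'u]; have [b e] := HY _ W'u; apply: inj => //; rewrite e.
have WU u : W u -> U u by move=> [/BU].
have Wp : W p by split; exact: ballxx.
(* The quadratic remainder of [X] at [Y z], multiplied by the inverse Jacobian and combined with the
   Lipschitz bound, is a quadratic remainder for [Y]. *)
have dY z : W' z -> differentiable Y z /\ 'd Y z = mulmxr (invmx ('J X (Y z))) :> (V -> V).
  move=> W'z; set M := invmx _; have [b e] := HY z W'z.
  have [K1 K10 HK] := mulmx_bound M.
  have [r1 r10 Br1] : exists2 r1 : R, 0 < r1 & forall y, ball z r1 y -> W' y.
    by apply: near_ball; exact: open_near oW' W'z _.
  apply: (@quadratic_approx _ _ _ Y z (mulmxr M) (K1 * (C * K ^+ 2)) r1 _ r10) => [|h hr].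
    exact: mulmx_continuous.
  have W'h : W' (h + z) by apply: Br1; apply/ballP; rewrite addrK.
  have [bh eh] := HY _ W'h.
  have -> : Y (h + z) - Y z - mulmxr M h = - ((X (Y (h + z)) - X (Y z) - (Y (h + z) - Y z) *m 'J X (Y z)) *m M).
    by rewrite eh e addrK mulmxBl mulmxK ?opprB //; apply/uJ/BU.
  rewrite normrN; apply: le_trans (HK _) _; rewrite -mulrA ler_wpM2l ?(ltW K10) //.
  apply: le_trans (quad _ _ b bh) _; rewrite -mulrA ler_wpM2l // -exprMn.
  have := lower _ _ b bh; rewrite eh e addrK => H.
  by rewrite ler_pXn2r ?nnegrE // mulr_ge0 // ltW.
have chain f z : (forall u, W u -> differentiable f u) -> W' z ->
    differentiable (f \o Y) z /\ forall j, partial j (f \o Y) z = \sum_a invmx ('J X (Y z)) j a * partial a f (Y z).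
  move=> df W'z; have [dYz EY] := dY z W'z; have dfz := df _ (YW z W'z).
  have d := differentiable_comp dYz dfz; split=> // j.
  rewrite partial_diff // diff_comp //= EY /= diff_partial //.
  by apply: eq_bigr => a _; rewrite -rowE mxE.
have sJ : forall i a, smooth_on W (fun u => invmx ('J X u) i a).
  apply: smooth_invmx => // [i a|u Wu]; last exact/uJ/WU.
  apply: (@eq_smooth_on _ W (partial i (fun u => X u 0 a))) => //.
    move=> u Wu; rewrite jacobianE // => b; exact: smooth_differentiable (sX b) (WU u Wu).
  by apply: smooth_on_sub WU _; exact: smooth_partial.
have sY f : smooth_on W f -> smooth_on W' (f \o Y).
  (* The class of all g o Y with g smooth on [W] is stable under partials by the chain rule, since
     the inverse Jacobian at [Y z] is itself a smooth function composed with [Y]. *)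
  move=> sf; apply: (@smooth_coind _ W' (fun F => exists2 g, smooth_on W g & F = g \o Y)) => //; last by exists f.
  move=> _ [g sg ->]; have ch := chain g _ (fun u => smooth_differentiable sg).
  split=> [z /ch [] //|k].
  exists ((fun u => \sum_a invmx ('J X u) k a * partial a g u) \o Y).
    eexists; last by [].
    by apply: smooth_sum => // a; apply: smoothM => //; exact: smooth_partial.
  by move=> z /ch [_ ->].
exists W, rho, Y; split; [exact: rho0|exact: Wp|exact: WU| |].
  split; [by []| | | |].
  - by move=> u Wu; split; [case: Wu|exact: YX].
  - by move=> z W'z; split; [exact: YW|exact: XY].
  - by move=> a; exact: smooth_on_sub WU (sX a).
  by move=> a; apply: (sY (fun u => u 0 a)); exact: smooth_coord.
move=> f sf; split; first exact: sY.
by move=> z j W'z; have [_ ->] := chain f z (fun u => smooth_differentiable sf) W'z.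
Qed.
End InverseCoordinates.

(** * The connection in the normalized coframe *)

Section HalfSystem.
Context {R : realType}.
Implicit Types (e d p : R) (t s : nat -> R) (y z : nat -> nat -> R).

(* The first block of the Gram matrix in the normalized coframe: e d^3 (1 - N/d)^3
   on the Jordan chain of a nilpotent N; the second block has - d for d. *)
Definition gram_entry e d (i j : nat) : R :=
  match i, j with
  | 0%N, 2%N | 1%N, 1%N | 2%N, 0%N => e * d ^+ 3
  | 1%N, 2%N | 2%N, 1%N => - (3 * e * d ^+ 2)
  | 2%N, 2%N => 3 * e * d
  | _, _ => 0
  end.

Definition gram_row e d t (i : nat) : R :=
  gram_entry e d i 0%N * t 0%N + gram_entry e d i 1%N * t 1%N + gram_entry e d i 2%N * t 2%N.

(* The entries (0..2, 0..2) of y and (0..2, 3..5) of z are the components, in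
   direction t, of the connection matrix in the normalized coframe; p2 and p5
   are the only nonzero components of d phi. *)
Definition half_system e e' d p2 p5 t y z : Prop :=
  let l := 2 / 3 * p2 * t 2%N in let m := 2 / 3 * p5 * t 5%N in
  let q0 := p2 / (e * d ^+ 3) in
  let g := gram_row e d t in let g' := gram_row e' (- d) (fun i => t (3 + i)%N) in
  [/\ [/\ y 1%N 0%N + l = q0 * g 0%N, y 1%N 1%N - y 0%N 0%N = q0 * g 1%N &
          y 1%N 2%N - y 0%N 1%N = t 0%N * p2 + q0 * g 2%N] /\
      [/\ y 2%N 0%N = 0, y 2%N 2%N - y 1%N 1%N = t 1%N * p2 & - y 2%N 1%N + l = t 2%N * p2],
      [/\ 2 * (e * d ^+ 3 * y 1%N 1%N - 3 * e * d ^+ 2 * y 2%N 1%N) = - (3 * e * d ^+ 2 * (m - l)),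
          e * d ^+ 3 * (y 0%N 1%N + y 1%N 2%N) - 3 * e * d ^+ 2 * (y 1%N 1%N + y 2%N 2%N) + 3 * e * d * y 2%N 1%N
            = 6 * e * d * (m - l) &
          2 * (e * d ^+ 3 * y 0%N 2%N - 3 * e * d ^+ 2 * y 1%N 2%N + 3 * e * d * y 2%N 2%N) = - (3 * e * (m - l))],
      [/\ - d * z 2%N 0%N = 0, - d * z 2%N 1%N - z 2%N 0%N = 0 & - d * z 2%N 2%N - z 2%N 1%N = t 2%N * p5],
      [/\ - d * z 1%N 0%N + z 2%N 0%N = 0, - d * z 1%N 1%N + z 2%N 1%N - z 1%N 0%N = 0 &
          - d * z 1%N 2%N + z 2%N 2%N - z 1%N 1%N = t 1%N * p5] &
      [/\ - d * z 0%N 0%N + z 1%N 0%N = q0 * g' 0%N, - d * z 0%N 1%N + z 1%N 1%N - z 0%N 0%N = q0 * g' 1%N &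
          - d * z 0%N 2%N + z 1%N 2%N - z 0%N 1%N = t 0%N * p5 + q0 * g' 2%N]].

(** With [t] and [s] the values of the coframe on two coordinate vectors and [y], [z], [y'], [z']
    the connection in these directions, this is a component of the exterior derivative of the [a]-th
    form, the connection being torsion free. *)
Definition half_curl t s y z y' z' (a : nat) : R :=
  (y a 0%N * s 0%N + y a 1%N * s 1%N + y a 2%N * s 2%N + z a 0%N * s 3%N + z a 1%N * s 4%N + z a 2%N * s 5%N)
  - (y' a 0%N * t 0%N + y' a 1%N * t 1%N + y' a 2%N * t 2%N + z' a 0%N * t 3%N + z' a 1%N * t 4%N + z' a 2%N * t 5%N).

(** The commutator with a Jordan block controls differences of neighbours along each diagonal of
    [y], the Gram condition controls sums along the same diagonals; together they fix all nine
    entries. [S] and [D] are the sum and the difference of the entries (1,2) and (0,1). *)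
Lemma half_diag e e' d p2 p5 t y z : e != 0 -> d != 0 -> half_system e e' d p2 p5 t y z ->
  let l := 2 / 3 * p2 * t 2%N in let m := 2 / 3 * p5 * t 5%N in
  let S := 3 * (2 * (- (p5 * t 5%N / d)) + t 1%N * p2) / d + p2 * t 2%N / d ^+ 2 + 6 * (m - l) / d ^+ 2 in
  let D := p2 * (2 * t 0%N - 3 * t 1%N / d + 3 * t 2%N / d ^+ 2) in
  [/\ [/\ y 0%N 0%N = - (p5 * t 5%N / d) - p2 * (t 1%N - 3 * t 2%N / d), y 0%N 1%N = (S - D) / 2 &
          y 0%N 2%N = - (3 / 2 * (m - l) / d ^+ 3) + 3 * ((S + D) / 2) / d - 3 * (- (p5 * t 5%N / d) + t 1%N * p2) / d ^+ 2],
      [/\ y 1%N 0%N = p2 * t 2%N / 3, y 1%N 1%N = - (p5 * t 5%N / d) & y 1%N 2%N = (S + D) / 2] &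
      [/\ y 2%N 0%N = 0, y 2%N 1%N = - (p2 * t 2%N / 3) & y 2%N 2%N = - (p5 * t 5%N / d) + t 1%N * p2]].
Proof.
move=> e0 d0 [[[d00 d01 d02] [d10 d12 d22]] [s11 s12 s22] _ _ _] l m S D.
have c0 : e * d ^+ 3 != 0 by rewrite mulf_neq0 // expf_neq0.
have y10 : y 1%N 0%N = p2 * t 2%N / 3.
  by move: d00; rewrite /gram_row /= => H; rewrite -[LHS](addrK (2 / 3 * p2 * t 2%N)) H; field; rewrite e0 d0.
have y21 : y 2%N 1%N = - (p2 * t 2%N / 3) by lra.
have y11 : y 1%N 1%N = - (p5 * t 5%N / d).
  apply: (mulfI c0); have -> : e * d ^+ 3 * y 1%N 1%N = - (3 * e * d ^+ 2 * (m - l)) / 2 + 3 * e * d ^+ 2 * y 2%N 1%N by rewrite -s11; field.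
  by rewrite y21 /m /l; field.
have y22 : y 2%N 2%N = - (p5 * t 5%N / d) + t 1%N * p2 by rewrite -d12 y11; ring.
have y00 : y 0%N 0%N = - (p5 * t 5%N / d) - p2 * (t 1%N - 3 * t 2%N / d).
  rewrite -y11; have -> : y 0%N 0%N = y 1%N 1%N - (y 1%N 1%N - y 0%N 0%N) by ring.
  by rewrite d01 /gram_row /=; field; rewrite e0 d0.
have ED : y 1%N 2%N - y 0%N 1%N = D by rewrite d02 /D /gram_row /=; field; rewrite e0 d0.
have ES : y 0%N 1%N + y 1%N 2%N = S.
  apply: (mulfI c0); have -> : e * d ^+ 3 * (y 0%N 1%N + y 1%N 2%N) = 6 * e * d * (m - l) + 3 * e * d ^+ 2 * (y 1%N 1%N + y 2%N 2%N) - 3 * e * d * y 2%N 1%N by rewrite -s12; ring.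
  by rewrite y21 y11 y22 /S /m /l; field.
have y12 : y 1%N 2%N = (S + D) / 2 by rewrite -ED -ES; field.
have y01 : y 0%N 1%N = (S - D) / 2 by rewrite -ED -ES; field.
split; split=> //.
apply: (mulfI c0); have -> : e * d ^+ 3 * y 0%N 2%N = - (3 * e * (m - l)) / 2 + 3 * e * d ^+ 2 * y 1%N 2%N - 3 * e * d * y 2%N 2%N by rewrite -s22; field.
by rewrite y12 y22; field.
Qed.

(** A Sylvester equation between blocks with distinct eigenvalues: its operator is - d plus a
    nilpotent one, so back substitution from the entry (2,0) solves it. *)
Lemma half_offdiag e e' d p2 p5 t y z : e != 0 -> d != 0 -> half_system e e' d p2 p5 t y z ->
  let r := p2 * e' / e in
  [/\ [/\ z 0%N 0%N = r * t 5%N / d, z 0%N 1%N = r * (t 4%N / d + 2 * t 5%N / d ^+ 2) &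
          z 0%N 2%N = - (p5 * (t 0%N / d + t 1%N / d ^+ 2 + t 2%N / d ^+ 3)) + r * (t 3%N / d + 2 * t 4%N / d ^+ 2 + t 5%N / d ^+ 3)],
      [/\ z 1%N 0%N = 0, z 1%N 1%N = 0 & z 1%N 2%N = - (p5 * (t 1%N / d + t 2%N / d ^+ 2))] &
      [/\ z 2%N 0%N = 0, z 2%N 1%N = 0 & z 2%N 2%N = - (p5 * t 2%N / d)]].
Proof.
move=> e0 d0 [_ _ [h20 h21 h22] [h10 h11 h12] [h00 h01 h02]] r.
have nd0 : - d != 0 by rewrite oppr_eq0.
have sol (w x c : R) : - d * x + w = c -> x = (w - c) / d.
  by move=> <-; field.
have z20 : z 2%N 0%N = 0 by apply: (mulfI nd0); rewrite h20 mulr0.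
have z21 : z 2%N 1%N = 0 by rewrite (sol _ _ _ h21) z20; field.
have z22 : z 2%N 2%N = - (p5 * t 2%N / d) by rewrite (sol _ _ _ h22) z21; field.
have z10 : z 1%N 0%N = 0 by rewrite (sol _ _ _ h10) z20; field.
have z11 : z 1%N 1%N = 0 by rewrite (sol _ _ _ (etrans (addrA _ _ _) h11)) z21 z10; field.
have z12 : z 1%N 2%N = - (p5 * (t 1%N / d + t 2%N / d ^+ 2)).
  by rewrite (sol _ _ _ (etrans (addrA _ _ _) h12)) z22 z11; field.
have z00 : z 0%N 0%N = r * t 5%N / d by rewrite (sol _ _ _ h00) z10 /r /gram_row /=; field; rewrite e0 d0.
have z01 : z 0%N 1%N = r * (t 4%N / d + 2 * t 5%N / d ^+ 2).
  by rewrite (sol (z 1%N 1%N - z 0%N 0%N) _ _ (etrans (addrA _ _ _) h01)) z11 z00 /r /gram_row /=; field; rewrite e0 d0.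
have z02 : z 0%N 2%N = - (p5 * (t 0%N / d + t 1%N / d ^+ 2 + t 2%N / d ^+ 3)) + r * (t 3%N / d + 2 * t 4%N / d ^+ 2 + t 5%N / d ^+ 3).
  by rewrite (sol (z 1%N 2%N - z 0%N 1%N) _ _ (etrans (addrA _ _ _) h02)) z12 z01 /r /gram_row /=; field; rewrite e0 d0.
by [].
Qed.

(** In the antisymmetrized combination every term with [p5] or with components 3 to 5 of [t] and [s]
    cancels; this is the decoupling of the two blocks. *)
Lemma half_structure e e' d p2 p5 t s y z y' z' : e != 0 -> d != 0 ->
  half_system e e' d p2 p5 t y z -> half_system e e' d p2 p5 s y' z' ->
  let c := half_curl t s y z y' z' in
  [/\ c 0%N = 0, c 1%N = 2 / 3 * p2 * (t 0%N * s 2%N - t 2%N * s 0%N) &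
      c 2%N = 2 * (2 / 3 * p2) * (t 1%N * s 2%N - t 2%N * s 1%N)].
Proof.
move=> e0 d0 Hy Hs c.
have [[y00 y01 y02] [y10 y11 y12] [y20 y21 y22]] := half_diag e0 d0 Hy.
have [[z00 z01 z02] [z10 z11 z12] [z20 z21 z22]] := half_offdiag e0 d0 Hy.
have [[v00 v01 v02] [v10 v11 v12] [v20 v21 v22]] := half_diag e0 d0 Hs.
have [[w00 w01 w02] [w10 w11 w12] [w20 w21 w22]] := half_offdiag e0 d0 Hs.
split; rewrite /c /half_curl.
- by rewrite y00 y01 y02 z00 z01 z02 v00 v01 v02 w00 w01 w02; field; rewrite e0 d0.
- by rewrite y10 y11 y12 z10 z11 z12 v10 v11 v12 w10 w11 w12; field.
by rewrite y20 y21 y22 z20 z21 z22 v20 v21 v22 w20 w21 w22; field.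
Qed.
End HalfSystem.

(** * The Eisenhart equation at a point, in the coframe *)

Section StructureEquations.
Context {R : realType}.

(** Literal ordinals, so that case distinctions on indices compute; numbers above 5 go to 5. *)
Definition ord6 (n : nat) : 'I_6 :=
  match n with
  | 0 => @Ordinal 6 0 isT | 1 => @Ordinal 6 1 isT | 2 => @Ordinal 6 2 isT
  | 3 => @Ordinal 6 3 isT | 4 => @Ordinal 6 4 isT | _ => @Ordinal 6 5 isT
  end.

Lemma ord6_ind (P : 'I_6 -> Prop) :
  P (ord6 0) -> P (ord6 1) -> P (ord6 2) -> P (ord6 3) -> P (ord6 4) -> P (ord6 5) ->
  forall i, P i.
Proof.
move=> P0 P1 P2 P3 P4 P5 [[|[|[|[|[|[|//]]]]]] lti];
by rewrite (bool_irrelevance lti isT).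
Qed.

Lemma sum6 (W : nmodType) (F : 'I_6 -> W) : \sum_(i < 6) F i =
  F (ord6 0) + F (ord6 1) + F (ord6 2) + F (ord6 3) + F (ord6 4) + F (ord6 5).
Proof.
rewrite !big_ord_recl big_ord0 addr0 !addrA.
by do 5?[congr (_ + _)]; congr F; apply: val_inj.
Qed.

(** The blocks are functions on [nat], so that concrete entries reduce by computation; [i.-2.-1] is
    i - 3. *)
Definition block33 (A B : nat -> nat -> R) : 'M[R]_6 :=
  \matrix_(i < 6, j < 6)
    if (i < 3)%N then (if (j < 3)%N then A i j else 0)
    else if (j < 3)%N then 0 else B i.-2.-1 j.-2.-1.

Definition jordan_entry (l : R) (i j : nat) : R :=
  if i == j then l else if j == i.+1 then 1 else 0.
Definition scalar_entry (l : R) (i j : nat) : R := if i == j then l else 0.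
(** The derivative of [gram_entry e d] when d has derivative [d']. *)
Definition dgram_entry (e d d' : R) (i j : nat) : R :=
  match i, j with
  | 0%N, 2%N | 1%N, 1%N | 2%N, 0%N => 3 * e * d ^+ 2 * d'
  | 1%N, 2%N | 2%N, 1%N => - (6 * e * d * d')
  | 2%N, 2%N => 3 * e * d'
  | _, _ => 0
  end.

Definition gram (e e' d : R) := block33 (gram_entry e d) (gram_entry e' (- d)).
Definition dgram (e e' d d' : R) := block33 (dgram_entry e d d') (dgram_entry e' (- d) (- d')).
Definition jordan (l m : R) := block33 (jordan_entry l) (jordan_entry m).
Definition djordan (l m : R) := block33 (scalar_entry l) (scalar_entry m).

(** The rows of [E] are the coframe, [Y k] is its covariant derivative in direction k expressed in
    the coframe, [p] holds the components of d phi and [q] those of the gradient vector. [HJ] is the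
    Eisenhart equation for the operator L, and [HG] says that g is parallel. *)
Variables (e e' l m d : R) (E : 'M[R]_6) (Y : 'I_6 -> 'M[R]_6) (dl dm : 'I_6 -> R) (p q : 'cV[R]_6).
Hypotheses (e0 : e != 0) (e'0 : e' != 0) (d0 : d != 0) (lmd : m = l + d) (Eu : E \in unitmx).
Hypothesis gram_q : gram e e' d *m q = p.
Hypothesis HJ : forall k, jordan l m *m Y k - Y k *m jordan l m + djordan (dl k) (dm k)
  = col k E *m p^T + q *m (col k E)^T *m gram e e' d.
Hypothesis HG : forall k, (Y k)^T *m gram e e' d + gram e e' d *m Y k
  + dgram e e' d (dm k - dl k) = 0.

Local Notation o0 := (@Ordinal 6 0 isT).
Local Notation o1 := (@Ordinal 6 1 isT).
Local Notation o2 := (@Ordinal 6 2 isT).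
Local Notation o3 := (@Ordinal 6 3 isT).
Local Notation o4 := (@Ordinal 6 4 isT).
Local Notation o5 := (@Ordinal 6 5 isT).

Let pE i : p i 0 = \sum_j gram e e' d i j * q j 0.
Proof. by rewrite -gram_q mxE. Qed.

Let HJE k a b : (jordan l m *m Y k - Y k *m jordan l m + djordan (dl k) (dm k)) a b
  = E a k * p b 0 + q a 0 * \sum_j E j k * gram e e' d j b.
Proof.
rewrite HJ -mulmxA !mxE !big_ord1 !mxE; congr (_ + _ * _).
by apply: eq_bigr => j _; rewrite !mxE.
Qed.

Let HGE k a b : ((Y k)^T *m gram e e' d + gram e e' d *m Y k + dgram e e' d (dm k - dl k)) a b = 0.
Proof. by rewrite HG mxE. Qed.

Ltac entry H := move: H; rewrite ?mxE ?sum6 ?mxE /= /jordan_entry /scalar_entry /= ?lmd.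

Lemma unitmx_row_neq0 i : exists k, E i k != 0.
Proof.
apply: contrapT => nE; have : row i E = 0.
  by apply/rowP => k; rewrite !mxE; apply/eqP/negPn/negP => ?; apply: nE; exists k.
rewrite rowE => /(congr1 (mulmx^~ (invmx E))); rewrite mulmxK // mul0mx => /rowP/(_ i).
by rewrite !mxE !eqxx => /eqP; rewrite oner_eq0.
Qed.

(** In each diagonal block the commutator with the Jordan matrix sums to zero along the main
    diagonal and along every diagonal below it. The lower sums annihilate all components of d phi
    except the last one of each block; the trace yields the differential of the eigenvalue. *)
Lemma differential_components :
  [/\ p o0 0 = 0, p o1 0 = 0, p o3 0 = 0 & p o4 0 = 0] /\
  [/\ q o0 0 = p o2 0 / (e * d ^+ 3), q o1 0 = 0 & q o2 0 = 0] /\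
  [/\ q o3 0 = p o5 0 / (e' * (- d) ^+ 3), q o4 0 = 0 & q o5 0 = 0] /\
  forall k, dl k = 2 / 3 * p o2 0 * E o2 k /\ dm k = 2 / 3 * p o5 0 * E o5 k.
Proof.
have c0 : e * d ^+ 3 != 0 by rewrite mulf_neq0 // expf_neq0.
have c0' : e' * (- d) ^+ 3 != 0 by rewrite mulf_neq0 // expf_neq0 // oppr_eq0.
have cancel (c x y : R) : c != 0 -> x != 0 -> 2 * c * x * y = 0 -> y = 0.
  by move=> cn0 x0 /eqP; rewrite !mulf_eq0 pnatr_eq0 (negbTE cn0) (negbTE x0) /= => /eqP.
have P0 : p o0 0 = e * d ^+ 3 * q o2 0 by entry (pE o0); lra.
have P1 : p o1 0 = e * d ^+ 3 * q o1 0 - 3 * e * d ^+ 2 * q o2 0 by entry (pE o1); lra.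
have P2 : p o2 0 = e * d ^+ 3 * q o0 0 - 3 * e * d ^+ 2 * q o1 0 + 3 * e * d * q o2 0
  by entry (pE o2); lra.
have P3 : p o3 0 = e' * (- d) ^+ 3 * q o5 0 by entry (pE o3); lra.
have P4 : p o4 0 = e' * (- d) ^+ 3 * q o4 0 - 3 * e' * (- d) ^+ 2 * q o5 0 by entry (pE o4); lra.
have P5 : p o5 0 = e' * (- d) ^+ 3 * q o3 0 - 3 * e' * (- d) ^+ 2 * q o4 0 + 3 * e' * (- d) * q o5 0
  by entry (pE o5); lra.
have [k k0] := unitmx_row_neq0 o2; have [k' k'0] := unitmx_row_neq0 o5.
have q2 : q o2 0 = 0.
  have H : 2 * (e * d ^+ 3) * E o2 k * q o2 0 = 0 by entry (HJE k o2 o0); rewrite P0; lra.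
  exact: cancel c0 k0 H.
have q5 : q o5 0 = 0.
  have H : 2 * (e' * (- d) ^+ 3) * E o5 k' * q o5 0 = 0. entry (HJE k' o5 o3); rewrite P3. lra.
  exact: cancel c0' k'0 H.
have p0 : p o0 0 = 0 by rewrite P0 q2 mulr0.
have p3 : p o3 0 = 0 by rewrite P3 q5 mulr0.
have q1 : q o1 0 = 0.
  have H : 2 * (e * d ^+ 3) * E o2 k * q o1 0 = 0.
    entry (HJE k o1 o0); entry (HJE k o2 o1); rewrite p0 P1 q2; lra.
  exact: cancel c0 k0 H.
have q4 : q o4 0 = 0.
  have H : 2 * (e' * (- d) ^+ 3) * E o5 k' * q o4 0 = 0.
    entry (HJE k' o4 o3); entry (HJE k' o5 o4); rewrite p3 P4 q5; lra.
  exact: cancel c0' k'0 H.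
have p1 : p o1 0 = 0 by rewrite P1 q1 q2; ring.
have p4 : p o4 0 = 0 by rewrite P4 q4 q5; ring.
split=> //; split; first by split=> //; rewrite P2 q1 q2 !mulr0 addr0 subr0 mulrC mulKf.
split; first by split=> //; rewrite P5 q4 q5 !mulr0 addr0 subr0 mulrC mulKf.
(* Trace of each block: 3 dl on the left, 2 p2 th3 on the right, whence the factor 2/3. *)
move=> i; split.
  entry (HJE i o0 o0); entry (HJE i o1 o1); entry (HJE i o2 o2).
  by rewrite p0 p1 P2 q1 q2; lra.
entry (HJE i o3 o3); entry (HJE i o4 o4); entry (HJE i o5 o5).
by rewrite p3 p4 P5 q4 q5; lra.
Qed.

Tactic Notation "entry_lra" constr(H) constr(P) := entry H; rewrite ?P; lra.

Lemma first_half_system k : half_system e e' d (p o2 0) (p o5 0)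
  (fun a => E (ord6 a) k) (fun a b => Y k (ord6 a) (ord6 b))
  (fun a b => Y k (ord6 a) (ord6 (3 + b))).
Proof.
have [[p0 p1 p3 p4] [[q0 q1 q2] [_ D]]] := differential_components; have [Dl Dm] := D k.
have P := (p0, p1, p3, p4, q1, q2).
rewrite /half_system /= -q0 -Dl -Dm /gram_row /=.
split; [split|..]; split.
- by entry_lra (HJE k o0 o0) P.
- by entry_lra (HJE k o0 o1) P.
- by entry_lra (HJE k o0 o2) P.
- by entry_lra (HJE k o1 o0) P.
- by entry_lra (HJE k o1 o2) P.
- by entry_lra (HJE k o2 o2) P.
- by entry (HGE k o1 o1); lra.
- by entry (HGE k o1 o2); lra.
- by entry (HGE k o2 o2); lra.
- by entry_lra (HJE k o2 o3) P.
- by entry_lra (HJE k o2 o4) P.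
- by entry_lra (HJE k o2 o5) P.
- by entry_lra (HJE k o1 o3) P.
- by entry_lra (HJE k o1 o4) P.
- by entry_lra (HJE k o1 o5) P.
- by entry_lra (HJE k o0 o3) P.
- by entry_lra (HJE k o0 o4) P.
- by entry_lra (HJE k o0 o5) P.
Qed.

(** The equations are symmetric under exchange of the blocks, which turns d into - d; the index
    function swaps 0..2 with 3..5. *)
Lemma second_half_system k : half_system e' e (- d) (p o5 0) (p o2 0)
  (fun a => E (ord6 (if (a < 3)%N then (3 + a)%N else a.-2.-1)) k)
  (fun a b => Y k (ord6 (3 + a)) (ord6 (3 + b)))
  (fun a b => Y k (ord6 (3 + a)) (ord6 b)).
Proof.
have [[p0 p1 p3 p4] [_ [[q0 q1 q2] D]]] := differential_components; have [Dl Dm] := D k.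
have P := (p0, p1, p3, p4, q1, q2).
rewrite /half_system /= -q0 -Dl -Dm /gram_row /=.
split; [split|..]; split.
- by entry_lra (HJE k o3 o3) P.
- by entry_lra (HJE k o3 o4) P.
- by entry_lra (HJE k o3 o5) P.
- by entry_lra (HJE k o4 o3) P.
- by entry_lra (HJE k o4 o5) P.
- by entry_lra (HJE k o5 o5) P.
- by entry (HGE k o4 o4); lra.
- by entry (HGE k o4 o5); lra.
- by entry (HGE k o5 o5); lra.
- by entry_lra (HJE k o5 o0) P.
- by entry_lra (HJE k o5 o1) P.
- by entry_lra (HJE k o5 o2) P.
- by entry_lra (HJE k o4 o0) P.
- by entry_lra (HJE k o4 o1) P.
- by entry_lra (HJE k o4 o2) P.
- by entry_lra (HJE k o3 o0) P.
- by entry_lra (HJE k o3 o1) P.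
- by entry_lra (HJE k o3 o2) P.
Qed.

Lemma structure_equations i k :
  let C a := (Y k *m E) a i - (Y i *m E) a k in
  let w a b := E a k * E b i - E b k * E a i in
  [/\ C o0 = 0, C o1 = 2 / 3 * p o2 0 * w o0 o2 & C o2 = 2 * (2 / 3 * p o2 0) * w o1 o2] /\
  [/\ C o3 = 0, C o4 = 2 / 3 * p o5 0 * w o3 o5 & C o5 = 2 * (2 / 3 * p o5 0) * w o4 o5].
Proof.
move=> C w; split.
  have [c0 c1 c2] := half_structure e0 d0 (first_half_system k) (first_half_system i).
  move: c0 c1 c2; rewrite /half_curl /= => c0 c1 c2.
  by split; rewrite /C !mxE !sum6 /=; [rewrite c0|rewrite c1|rewrite c2].
have nd0 : - d != 0 by rewrite oppr_eq0.
have [c0 c1 c2] := half_structure e'0 nd0 (second_half_system k) (second_half_system i).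
move: c0 c1 c2; rewrite /half_curl /= => c0 c1 c2.
by split; rewrite /C !mxE !sum6 /=; [move: c0|move: c1|move: c2]; rewrite /w; lra.
Qed.

End StructureEquations.

(** * Covariant derivatives in a moving coframe *)

Section Covariant.
Context {R : realType}.
Notation V := 'rV[R]_6.
Implicit Types (U W : set V) (g h E : V -> 'M[R]_6) (phi l m : V -> R) (k : 'I_6) (x y : V).

Definition dmx k n q (M : V -> 'M[R]_(n, q)) x : 'M[R]_(n, q) :=
  \matrix_(i, j) partial k (fun y => M y i j) x.

Definition differentiable_mx n q (M : V -> 'M[R]_(n, q)) x :=
  forall i j, differentiable (fun y => M y i j) x.

Lemma partial_sum (I : finType) (F : I -> V -> R) k x :
  (forall i, differentiable (F i) x) ->
  partial k (fun y => \sum_i F i y) x = \sum_i partial k (F i) x.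
Proof.
move=> dF; suff [] : differentiable (fun y => \sum_i F i y) x /\
  partial k (fun y => \sum_i F i y) x = \sum_i partial k (F i) x by [].
elim: (index_enum I) => [|i s [IHd IHe]].
  under eq_fun do rewrite big_nil; rewrite big_nil; split; last exact: derive_cst.
  exact: differentiable_cst.
under eq_fun do rewrite big_cons; rewrite big_cons; split; first exact: differentiableD.
by rewrite partialD // IHe.
Qed.

Lemma dmx_mul n q r (A : V -> 'M[R]_(n, q)) (B : V -> 'M[R]_(q, r)) k x :
  differentiable_mx A x -> differentiable_mx B x ->
  differentiable_mx (fun y => A y *m B y) x /\
  dmx k (fun y => A y *m B y) x = dmx k A x *m B x + A x *m dmx k B x.
Proof.
move=> dA dB; split=> [i j|].
  under eq_fun do rewrite mxE.
  have -> : (fun y => \sum_j0 A y i j0 * B y j0 j) = \sum_j0 (fun y => A y i j0 * B y j0 j).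
    by apply/funext => y; rewrite fct_sumE.
  by apply: differentiable_sum => l; exact: differentiableM.
apply/matrixP => i j; rewrite !mxE -big_split /=.
under eq_fun do rewrite mxE.
rewrite partial_sum => [|l]; last exact: differentiableM.
by apply: eq_bigr => l _; rewrite partialM // !mxE.
Qed.

Lemma dmx_tr n q (A : V -> 'M[R]_(n, q)) k x : dmx k (fun y => (A y)^T) x = (dmx k A x)^T.
Proof. by apply/matrixP => i j; rewrite !mxE; congr partial; apply/funext => y; rewrite mxE. Qed.

Lemma eq_dmx U n q (A B : V -> 'M[R]_(n, q)) k x : open U -> U x ->
  (forall y, U y -> A y = B y) -> dmx k A x = dmx k B x.
Proof.
by move=> oU Ux AB; apply/matrixP => i j; rewrite !mxE; apply: (eq_partial _ oU Ux) => y Uy; rewrite AB.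
Qed.

Definition connection g k x : 'M[R]_6 := \matrix_(i, j) christoffel g j i k x.

Lemma connection_sym U g i j k x : open U -> U x -> (forall y, U y -> (g y)^T = g y) ->
  connection g k x i j = connection g i x k j.
Proof.
move=> oU Ux sg; rewrite !mxE /christoffel; congr (_ * _); apply: eq_bigr => n _.
congr (_ * _); rewrite [partial i _ _ + _]addrC; congr (_ - _).
by apply: (eq_partial _ oU Ux) => y Uy; rewrite -[g y in LHS]sg // mxE.
Qed.

(** [S] is twice the matrix of Christoffel symbols of the first kind; in its sum with the transpose
    only the derivative of [g] in direction [k] survives. *)
Lemma connection_metric U g k x : open U -> U x -> (forall y, U y -> (g y)^T = g y) ->
  g x \in unitmx -> dmx k g x = connection g k x *m g x + g x *m (connection g k x)^T.
Proof.
move=> oU Ux sg ug.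
have sP i j n : partial n (fun y => g y i j) x = partial n (fun y => g y j i) x.
  by apply: (eq_partial _ oU Ux) => y Uy; rewrite -[g y in LHS]sg // mxE.
pose S := \matrix_(i, j) (partial i (fun y => g y j k) x + partial k (fun y => g y j i) x
                         - partial j (fun y => g y i k) x).
have CS : connection g k x *m g x = 2^-1 *: S.
  have -> : connection g k x = 2^-1 *: (S *m invmx (g x)).
    apply/matrixP => i j; rewrite !mxE /christoffel; congr (_ * _).
    apply: eq_bigr => n _; rewrite mulrC; congr (_ * _); first by rewrite !mxE.
    by rewrite -[in RHS](sg x Ux) -trmx_inv mxE.
  by rewrite -scalemxAl mulmxKV.
have -> : g x *m (connection g k x)^T = 2^-1 *: S^T.
  by rewrite -[g x]trmxK -trmx_mul sg // CS linearZ.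
rewrite CS -scalerDr; apply/matrixP => i j; rewrite !mxE.
by rewrite (sP j i k); field.
Qed.

Lemma covariant_mx g h k x :
  \matrix_(i, j) covariant g h i j k x =
  dmx k h x - connection g k x *m h x - h x *m (connection g k x)^T.
Proof.
apply/matrixP => i j; rewrite !mxE /covariant; congr (_ - _ - _).
  by apply: eq_bigr => l _; rewrite mxE.
by apply: eq_bigr => l _; rewrite !mxE mulrC.
Qed.

(** Substituting dE = Y E + E C^T in the product rule makes all terms with [C] cancel, which leaves
    the covariant derivative in frame components. *)
Lemma frame_derivative E (K : V -> 'M[R]_6) k x (C : 'M[R]_6) : E x \in unitmx ->
  differentiable_mx E x -> differentiable_mx K x ->
  let Y := (dmx k E x - E x *m C^T) *m invmx (E x) in
  let A y := (E y)^T *m K y *m E y in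
  dmx k A x - C *m A x - A x *m C^T = (E x)^T *m (Y^T *m K x + dmx k K x + K x *m Y) *m E x.
Proof.
move=> uE dE dK Y A.
have dEE : dmx k E x = Y *m E x + E x *m C^T by rewrite /Y mulmxKV // subrK.
have dEt : differentiable_mx (fun y => (E y)^T) x.
  by move=> i j; under eq_fun do rewrite mxE; exact: dE.
have [d1 e1] := dmx_mul k dEt dK; have [d2 ->] := dmx_mul k d1 dE.
rewrite e1 dmx_tr dEE linearD /= !trmx_mul trmxK /A.
rewrite !(mulmxDl, mulmxDr) !mulmxA.
by apply/matrixP => i j; rewrite !mxE; ring.
Qed.

Lemma partial_gram_entry (e : R) (f : V -> R) k x (i j : nat) : differentiable f x ->
  differentiable (fun y => gram_entry e (f y) i j) x /\
  partial k (fun y => gram_entry e (f y) i j) x = dgram_entry e (f x) (partial k f x) i j.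
Proof.
move=> df.
have dX n : differentiable (fun y => f y ^+ n) x.
  elim: n => [|n IH]; first exact: differentiable_cst.
  by under eq_fun do rewrite exprS; exact: differentiableM.
have pX n : partial k (fun y => f y ^+ n.+1) x = n.+1%:R * f x ^+ n * partial k f x.
  elim: n => [|n IH]; first by rewrite expr0 !mul1r; congr partial; apply/funext => y; rewrite expr1.
  under eq_fun do rewrite exprS; rewrite partialM // IH -[n.+2%:R]natr1 exprS; ring.
have dc (c : R) : differentiable (fun _ : V => c) x by exact: differentiable_cst.
have pc (c : R) : partial k (fun _ : V => c) x = 0 by exact: derive_cst.
have c3 : differentiable (fun y => e * f y ^+ 3) x /\
    partial k (fun y => e * f y ^+ 3) x = 3 * e * f x ^+ 2 * partial k f x.
  by split; [exact: differentiableM|rewrite partialM // pc pX; ring].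
have c2 : differentiable (fun y => - (3 * e * f y ^+ 2)) x /\
    partial k (fun y => - (3 * e * f y ^+ 2)) x = - (6 * e * f x * partial k f x).
  have -> : (fun y => - (3 * e * f y ^+ 2)) = (fun y => - (3 * e) * f y ^+ 2).
    by apply/funext => y; ring.
  by split; [exact: differentiableM|rewrite partialM // pc pX; ring].
have c1 : differentiable (fun y => 3 * e * f y) x /\
    partial k (fun y => 3 * e * f y) x = 3 * e * partial k f x.
  by split; [exact: differentiableM|rewrite partialM // pc; ring].
by case: i j => [|[|[|i]]] [|[|[|j]]] //=; split.
Qed.

Lemma partial_jordan_entry (f : V -> R) k x (i j : nat) : differentiable f x ->
  differentiable (fun y => jordan_entry (f y) i j) x /\
  partial k (fun y => jordan_entry (f y) i j) x = scalar_entry (partial k f x) i j.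
Proof.
move=> df; rewrite /jordan_entry /scalar_entry; case: (i == j) => //.
by case: (j == i.+1); split; try exact: differentiable_cst; exact: derive_cst.
Qed.

Lemma dmx_block33 (A B : V -> nat -> nat -> R) (A' B' : nat -> nat -> R) k x :
  (forall i j, differentiable (fun y => A y i j) x /\ partial k (fun y => A y i j) x = A' i j) ->
  (forall i j, differentiable (fun y => B y i j) x /\ partial k (fun y => B y i j) x = B' i j) ->
  differentiable_mx (fun y => block33 (A y) (B y)) x /\
  dmx k (fun y => block33 (A y) (B y)) x = block33 A' B'.
Proof.
move=> HA HB; split=> [i j|]; last (apply/matrixP => i j; rewrite 2!mxE).
  under eq_fun do rewrite mxE.
  case: (i < 3)%N; case: (j < 3)%N; try exact: differentiable_cst.
    by have [] := HA i j.
  by have [] := HB i.-2.-1 j.-2.-1.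
under eq_fun do rewrite mxE.
case: (i < 3)%N; case: (j < 3)%N; try exact: derive_cst.
  by have [] := HA i j.
by have [] := HB i.-2.-1 j.-2.-1.
Qed.

Variables (W : set V) (g h E : V -> 'M[R]_6) (phi l m : V -> R) (e e' : R).
Hypotheses (oW : open W) (sg : smooth_tensor_on W g) (sh : smooth_tensor_on W h)
  (symg : forall y, W y -> (g y)^T = g y) (ug : forall y, W y -> g y \in unitmx)
  (sphi : smooth_on W phi) (eis : eisenhart W g h phi).
Hypotheses (sE : smooth_tensor_on W E) (sl : smooth_on W l) (sm : smooth_on W m)
  (e0 : e != 0) (e'0 : e' != 0) (lm : forall y, W y -> m y != l y).
Hypothesis gE : forall y, W y -> g y = (E y)^T *m gram e e' (m y - l y) *m E y.
Hypothesis aE : forall y, W y -> h y - (2 * phi y) *: g y =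
  (E y)^T *m (gram e e' (m y - l y) *m jordan (l y) (m y)) *m E y.

Definition gradient y : 'cV[R]_6 := \col_k partial k phi y.
(** The coefficients of d phi with respect to the coframe, whose forms are the rows of [E]. *)
Definition frame_gradient y : 'cV[R]_6 := invmx (E y)^T *m gradient y.

Lemma frame_unit y : W y -> E y \in unitmx.
Proof. by move=> Wy; have := ug Wy; rewrite gE // unitmx_mul => /andP[]. Qed.

Theorem frame_structure x : W x ->
  let p := frame_gradient x in
  let B := 2 / 3 * p (ord6 2) 0 in let B' := 2 / 3 * p (ord6 5) 0 in
  [/\ forall k, partial k l x = B * E x (ord6 2) k,
      forall k, partial k m x = B' * E x (ord6 5) k,
      forall k, partial k phi x = 3 / 2 * (partial k l x + partial k m x) &
      forall i k,
        let C a := partial k (fun y => E y a i) x - partial i (fun y => E y a k) x in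
        let w a b := E x a k * E x b i - E x b k * E x a i in
        [/\ C (ord6 0) = 0, C (ord6 1) = B * w (ord6 0) (ord6 2) & C (ord6 2) = 2 * B * w (ord6 1) (ord6 2)] /\
        [/\ C (ord6 3) = 0, C (ord6 4) = B' * w (ord6 3) (ord6 5) & C (ord6 5) = 2 * B' * w (ord6 4) (ord6 5)]].
Proof.
move=> Wx p.
have uE := frame_unit Wx.
have dl : differentiable l x := smooth_differentiable sl Wx.
have dm : differentiable m x := smooth_differentiable sm Wx.
have dd : differentiable (fun y => m y - l y) x by exact: differentiableB.
have dE : differentiable_mx E x by move=> i j; exact: smooth_differentiable (sE i j) Wx.
have dg : differentiable_mx g x by move=> i j; exact: smooth_differentiable (sg i j) Wx.
have dh : differentiable_mx h x by move=> i j; exact: smooth_differentiable (sh i j) Wx.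
pose d := m x - l x; have d0 : d != 0 by rewrite subr_eq0 lm.
pose dl_ k := partial k l x; pose dm_ k := partial k m x.
have pd k : partial k (fun y => m y - l y) x = dm_ k - dl_ k.
  by rewrite /partial deriveB //; exact: diff_derivable.
have pnd k : partial k (fun y => - (m y - l y)) x = - (dm_ k - dl_ k).
  by rewrite -pd /partial deriveN //; exact: diff_derivable.
have dG k : differentiable_mx (fun y => gram e e' (m y - l y)) x /\
    dmx k (fun y => gram e e' (m y - l y)) x = dgram e e' d (dm_ k - dl_ k).
  apply: dmx_block33 => i j; first by rewrite -pd; exact: partial_gram_entry.
  by rewrite -pnd; apply: partial_gram_entry; exact: differentiableN.
have dJ k : differentiable_mx (fun y => jordan (l y) (m y)) x /\
    dmx k (fun y => jordan (l y) (m y)) x = djordan (dl_ k) (dm_ k).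
  by apply: dmx_block33 => i j; exact: partial_jordan_entry.
set G := gram e e' d.
have uG : G \in unitmx by have := ug Wx; rewrite gE // !unitmx_mul => /andP[/andP[]].
have symG : G^T = G.
  apply: (can_inj (mulKmx (_ : (E x)^T \in unitmx))); first by rewrite unitmx_tr.
  apply: (can_inj (mulmxK uE)); rewrite -[in RHS]gE // -symg // gE //.
  by rewrite !trmx_mul trmxK mulmxA.
pose Y k := (dmx k E x - E x *m (connection g k x)^T) *m invmx (E x).
have uEt : (E x)^T \in unitmx by rewrite unitmx_tr.
have cancelE (M N : 'M[R]_6) : (E x)^T *m M *m E x = (E x)^T *m N *m E x -> M = N.
  by move=> /(can_inj (mulmxK uE)) /(can_inj (mulKmx uEt)).
have HG k : (Y k)^T *m G + G *m Y k + dgram e e' d (dm_ k - dl_ k) = 0.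
  have [dGm eG] := dG k; apply: cancelE; rewrite mulmx0 mul0mx addrAC -eG.
  rewrite -(@frame_derivative E (fun y => gram e e' (m y - l y))) //.
  rewrite -(eq_dmx k oW Wx gE) -gE // (connection_metric k oW Wx) ?ug //.
  by rewrite [X in X - _]addrAC subrr add0r subrr.
pose q := invmx G *m p.
have HJ k : jordan (l x) (m x) *m Y k - Y k *m jordan (l x) (m x) + djordan (dl_ k) (dm_ k)
    = col k (E x) *m p^T + q *m (col k (E x))^T *m G.
  have [dGm eG] := dG k; have [dJm eJ] := dJ k.
  have [dK eK] := dmx_mul k dGm dJm.
  have Ep : gradient x = (E x)^T *m p by rewrite /p /frame_gradient mulKVmx // unitmx_tr.
  (* The covariant derivative of a = h - 2 phi g: the term 2 g d phi of the Eisenhart equation is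
     cancelled by that of 2 phi g, and only the two mixed products remain. *)
  have H1 : dmx k (fun y => h y - (2 * phi y) *: g y) x
      - connection g k x *m (h x - (2 * phi x) *: g x) - (h x - (2 * phi x) *: g x) *m (connection g k x)^T
      = (E x)^T *m (G *m col k (E x) *m p^T + p *m (col k (E x))^T *m G) *m E x.
    have dphi := smooth_differentiable sphi Wx.
    have Da : dmx k (fun y => h y - (2 * phi y) *: g y) x
        = dmx k h x - (2 * phi x) *: dmx k g x - (2 * partial k phi x) *: g x.
      apply/matrixP => i j; rewrite !mxE.
      have -> : (fun y => (h y - (2 * phi y) *: g y) i j) = (fun y => h y i j + (- 2) * (phi y * g y i j)).
        by apply/funext => y; rewrite !mxE; ring.
      have d2 : differentiable (fun=> -2 : R) x by exact: differentiable_cst.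
      have pc : partial k (fun=> -2 : R) x = 0 by exact: derive_cst.
      have dpg : differentiable (fun y => phi y * g y i j) x by exact: differentiableM.
      rewrite partialD //; last exact: differentiableM.
      by rewrite !partialM // pc; ring.
    have Dh : dmx k h x - connection g k x *m h x - h x *m (connection g k x)^T
        = (2 * partial k phi x) *: g x + (col k (g x) *m (gradient x)^T + gradient x *m (col k (g x))^T).
      rewrite -covariant_mx; apply/matrixP => i j; rewrite !mxE !big_ord1 eis // !mxE; ring.
    have Eg : col k (g x) = (E x)^T *m (G *m col k (E x)) by rewrite gE // !colE !mulmxA.
    have -> : (E x)^T *m (G *m col k (E x) *m p^T + p *m (col k (E x))^T *m G) *m E x
        = col k (g x) *m (gradient x)^T + gradient x *m (col k (g x))^T.
      by rewrite Eg Ep !trmx_mul !trmxK symG mulmxDr mulmxDl !mulmxA.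
    have Dg := connection_metric k oW Wx symg (ug Wx).
    rewrite -[RHS](addKr ((2 * partial k phi x) *: g x)) -Dh Da Dg.
    rewrite mulmxBr mulmxBl -scalemxAr -scalemxAl scalerDr.
    move: (_ *m g x) (g x *m _) (_ *m h x) (h x *m _) => n1 n2 n3 n4.
    by apply/matrixP => i j; rewrite !mxE; ring.
  rewrite (eq_dmx k oW Wx aE) aE // in H1.
  rewrite (@frame_derivative E (fun y => gram e e' (m y - l y) *m jordan (l y) (m y))) // in H1.
  have := cancelE _ _ H1; rewrite -/(Y k) eK eG eJ /= -/d -/G => H2.
  apply: (can_inj (mulKmx uG)).
  rewrite !mulmxDr mulmxN [G *m (q *m _ *m _)]mulmxA [G *m (q *m _)]mulmxA mulKVmx // [G *m (col _ _ *m _)]mulmxA -H2.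
  (* Parallelism of g eliminates Y^T G together with dG; what is left is G times the commutator of
     the Jordan matrix with [Y k], plus G times its derivative. *)
  have -> : dgram e e' d (dm_ k - dl_ k) = - ((Y k)^T *m G + G *m Y k).
    by apply/eqP; rewrite -addr_eq0 addrC HG.
  rewrite mulNmx mulmxDl !mulmxA.
  by apply/matrixP => i j; rewrite !mxE; ring.
have lmd : m x = l x + d by rewrite /d addrC subrK.
have Gq : G *m q = p by rewrite /q mulKVmx.
have [[p0 p1 p3 p4] [_ [_ D]]] := differential_components e0 e'0 d0 lmd uE Gq HJ.
have ST := structure_equations e0 e'0 d0 lmd uE Gq HJ HG.
split=> [k|k|k|i k].
- by have [] := D k.
- by have [] := D k.
- have [El Em] := D k; rewrite -/(dl_ k) -/(dm_ k) El Em.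
  have -> : partial k phi x = \sum_j E x j k * p j 0.
    transitivity (((E x)^T *m p) k 0); last by rewrite mxE; apply: eq_bigr => j _; rewrite mxE.
    by rewrite /p /frame_gradient mulKVmx ?unitmx_tr // mxE.
  by rewrite sum6 /= p0 p1 p3 p4; field.
(* Torsion freeness: the connection terms are symmetric in the two coordinate directions and drop
   out of the curl of a coframe form. *)
have CE a : partial k (fun y => E y a i) x - partial i (fun y => E y a k) x = (Y k *m E x) a i - (Y i *m E x) a k.
  have subE (A B : 'M[R]_6) b c : (A - B) b c = A b c - B b c by rewrite !mxE.
  have mulE (A B : 'M[R]_6) b c : (A *m B^T) b c = \sum_j A b j * B c j.
    by rewrite mxE; apply: eq_bigr => j _; rewrite mxE.
  have YE c b : (Y c *m E x) a b = partial c (fun y => E y a b) x - (E x *m (connection g c x)^T) a b.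
    by rewrite /Y mulmxKV // subE; congr (_ - _); rewrite mxE.
  have sC : (E x *m (connection g k x)^T) a i = (E x *m (connection g i x)^T) a k.
    apply: etrans (mulE _ _ _ _) (etrans _ (esym (mulE _ _ _ _))); apply: eq_bigr => j _.
    by rewrite (connection_sym i j k oW Wx symg).
  have comb (u v s t : R) : s = t -> u - s - (v - t) = u - v by move=> ->; rewrite opprB addrA subrK.
  exact: esym (etrans (congr2 (fun u v : R => u - v) (YE k i) (YE i k)) (comb _ _ _ _ sC)).
have [[c0 c1 c2] [c3 c4 c5]] := ST i k.
by split; split; apply: etrans (CE _) _.
Qed.

End Covariant.

(** * The normalized coframe *)

Section PointwiseFrame.
Context {R : realType}.
Implicit Types (l m c e d : R) (L Q C : 'M[R]_6) (v w r : 'rV[R]_6).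
Local Notation o0 := (@Ordinal 6 0 isT).
Local Notation o1 := (@Ordinal 6 1 isT).
Local Notation o2 := (@Ordinal 6 2 isT).
Local Notation o3 := (@Ordinal 6 3 isT).
Local Notation o4 := (@Ordinal 6 4 isT).
Local Notation o5 := (@Ordinal 6 5 isT).

Lemma block_jordan l m : block_mx (jordan_block 3 l) 0 0 (jordan_block 3 m) = jordan l m :> 'M[R]_6.
Proof.
apply/matrixP => i j; rewrite !mxE.
case: splitP => i' Ei; rewrite !mxE; case: splitP => j' Ej; rewrite !mxE /jordan_entry.
- by rewrite Ei Ej !ltn_ord.
- by rewrite Ei Ej ltn_ord ltnNge leq_addr.
- by rewrite Ei Ej ltn_ord ltnNge leq_addr.
- by rewrite Ei Ej !(ltnNge (3 + _)) !leq_addr.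
Qed.

Lemma jordan_rows l m Q (r := fun i => row i Q) :
  [/\ row o0 (jordan l m *m Q) = l *: r o0 + r o1, row o1 (jordan l m *m Q) = l *: r o1 + r o2 &
      row o2 (jordan l m *m Q) = l *: r o2] /\
  [/\ row o3 (jordan l m *m Q) = m *: r o3 + r o4, row o4 (jordan l m *m Q) = m *: r o4 + r o5 &
      row o5 (jordan l m *m Q) = m *: r o5].
Proof.
by split; split; apply/rowP => k; rewrite !mxE sum6 !mxE /= /jordan_entry /=; ring.
Qed.

Definition cube (A : 'M[R]_6) := A *m A *m A.

Definition chain3 (A : 'M[R]_6) (r0 r1 r2 : 'rV[R]_6) :=
  [/\ r0 *m A = r1, r1 *m A = r2 & r2 *m A = 0].

Lemma jordan_chain l m Q L : Q *m L = jordan l m *m Q ->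
  chain3 (L - l%:M) (row o0 Q) (row o1 Q) (row o2 Q) /\
  chain3 (L - m%:M) (row o3 Q) (row o4 Q) (row o5 Q).
Proof.
move=> QL; have [[e0 e1 e2] [e3 e4 e5]] := jordan_rows l m Q.
by split; split; rewrite mulmxBr -row_mul QL ?(e0, e1, e2, e3, e4, e5) mul_mx_scalar ?[_ + row _ _]addrC ?addrK ?subrr.
Qed.

Lemma chain3_cube A r0 r1 r2 : chain3 A r0 r1 r2 ->
  [/\ r0 *m cube A = 0, r1 *m cube A = 0 & r2 *m cube A = 0].
Proof.
by move=> [e0 e1 e2]; rewrite /cube !mulmxA e0 e1 e2 ?e1 ?e2 ?mul0mx.
Qed.

Lemma cubes_comm L l m : cube (L - l%:M) *m cube (L - m%:M) = cube (L - m%:M) *m cube (L - l%:M).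
Proof.
have c1 : (L - l%:M) *m (L - m%:M) = (L - m%:M) *m (L - l%:M).
  rewrite !mulmxBl !mulmxBr !mul_mx_scalar !mul_scalar_mx.
  by apply/matrixP => i j; rewrite !mxE; ring.
move: (L - l%:M) (L - m%:M) c1 => A B AB.
have comm (X Z : 'M[R]_6) : X *m Z = Z *m X -> X *m cube Z = cube Z *m X.
  move=> XZ; rewrite /cube !mulmxA XZ -[Z *m X *m Z]mulmxA XZ !mulmxA.
  by rewrite -[Z *m Z *m X *m Z]mulmxA XZ !mulmxA.
exact: esym (comm _ _ (esym (comm _ _ AB))).
Qed.

(** The Cayley-Hamilton identity, checked on the rows of [Q]: each is killed by one of the two
    commuting cubes. *)
Lemma jordan_nilpotent l m Q L : Q \in unitmx -> Q *m L = jordan l m *m Q ->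
  cube (L - m%:M) *m cube (L - l%:M) = 0.
Proof.
move=> uQ QL; apply: (can_inj (mulKmx uQ)); rewrite mulmx0; apply/row_matrixP => i.
rewrite row_mul row0; have [h1 h2] := jordan_chain QL.
have [a0 a1 a2] := chain3_cube h1; have [a3 a4 a5] := chain3_cube h2.
move: i; apply: ord6_ind => /=.
- by rewrite -cubes_comm mulmxA a0 mul0mx.
- by rewrite -cubes_comm mulmxA a1 mul0mx.
- by rewrite -cubes_comm mulmxA a2 mul0mx.
- by rewrite mulmxA a3 mul0mx.
- by rewrite mulmxA a4 mul0mx.
- by rewrite mulmxA a5 mul0mx.
Qed.

(** (L - m)^3 is invertible on the chain of [l]. Writing the head of a chain at one point as the
    image of some [w] allows it to be continued to nearby points with the same [w]. *)
Lemma chain3_projection l m L r0 r1 r2 : l != m -> chain3 (L - l%:M) r0 r1 r2 ->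
  exists w, w *m cube (L - m%:M) = r0.
Proof.
move=> lm [e0 e1 e2]; pose D := l - m; have D0 : D != 0 by rewrite subr_eq0.
have nE : L - m%:M = (L - l%:M) + D%:M.
  by rewrite /D; apply/matrixP => i j; rewrite !mxE mulrnBl; ring.
have step (a b c : R) : (a *: r0 + b *: r1 + c *: r2) *m (L - m%:M)
    = (a * D) *: r0 + (a + b * D) *: r1 + (b + c * D) *: r2.
  rewrite nE mulmxDr !mulmxDl -!scalemxAl e0 e1 e2 !mul_mx_scalar.
  by apply/rowP => i; rewrite !mxE; ring.
(* (n + D)^-3 = D^-3 - 3 D^-4 n + 6 D^-5 n^2 for n = L - l, since n^3 = 0 on the chain *)
exists (D ^- 3 *: r0 + (- 3 * D ^- 4) *: r1 + (6 * D ^- 5) *: r2).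
rewrite /cube !mulmxA !step; apply/rowP => i; rewrite !mxE.
by field.
Qed.

(** The cubes map arbitrary covectors into the two generalized eigenspaces, and powers of the
    nilpotent parts complete the chains. With [w] and [w'] constant the result is polynomial in [L],
    [l], [m], hence smooth where these are. *)
Definition krylov L l m w w' : 'M[R]_6 :=
  let v := w *m cube (L - m%:M) in let v' := w' *m cube (L - l%:M) in
  \matrix_(i, j) match nat_of_ord i with
    | 0 => v 0 j | 1 => (v *m (L - l%:M)) 0 j | 2 => (v *m (L - l%:M) *m (L - l%:M)) 0 j
    | 3 => v' 0 j | 4 => (v' *m (L - m%:M)) 0 j | _ => (v' *m (L - m%:M) *m (L - m%:M)) 0 j
  end.

Lemma krylov_jordan L l m w w' : cube (L - m%:M) *m cube (L - l%:M) = 0 ->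
  krylov L l m w w' *m L = jordan l m *m krylov L l m w w'.
Proof.
move=> nil; set K := krylov _ _ _ _ _.
have nil' : cube (L - l%:M) *m cube (L - m%:M) = 0 by rewrite cubes_comm.
pose v := w *m cube (L - m%:M); pose v' := w' *m cube (L - l%:M).
have LE (r : 'rV[R]_6) c : r *m L = c *: r + r *m (L - c%:M).
  by rewrite mulmxBr mul_mx_scalar addrC subrK.
have z2 : v *m (L - l%:M) *m (L - l%:M) *m (L - l%:M) = 0.
  have : v *m cube (L - l%:M) = 0 by rewrite /v -mulmxA nil mulmx0.
  by rewrite {1}/cube !mulmxA.
have z5 : v' *m (L - m%:M) *m (L - m%:M) *m (L - m%:M) = 0.
  have : v' *m cube (L - m%:M) = 0 by rewrite /v' -mulmxA nil' mulmx0.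
  by rewrite {1}/cube !mulmxA.
have [[e0 e1 e2] [e3 e4 e5]] := jordan_rows l m K.
have r0 : row o0 K = v by apply/rowP => j; rewrite !mxE.
have r1 : row o1 K = v *m (L - l%:M) by apply/rowP => j; rewrite !mxE.
have r2 : row o2 K = v *m (L - l%:M) *m (L - l%:M) by apply/rowP => j; rewrite !mxE.
have r3 : row o3 K = v' by apply/rowP => j; rewrite !mxE.
have r4 : row o4 K = v' *m (L - m%:M) by apply/rowP => j; rewrite !mxE.
have r5 : row o5 K = v' *m (L - m%:M) *m (L - m%:M) by apply/rowP => j; rewrite !mxE.
apply/row_matrixP; apply: ord6_ind => /=; rewrite row_mul ?(e0, e1, e2, e3, e4, e5).
- by rewrite r0 r1 (LE v l).
- by rewrite r1 r2 (LE _ l).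
- by rewrite r2 (LE _ l) z2 addr0.
- by rewrite r3 r4 (LE v' m).
- by rewrite r4 r5 (LE _ m).
- by rewrite r5 (LE _ m) z5 addr0.
Qed.

Lemma krylov_chain l m L Q w w' : Q *m L = jordan l m *m Q ->
  w *m cube (L - m%:M) = row o0 Q -> w' *m cube (L - l%:M) = row o3 Q ->
  krylov L l m w w' = Q.
Proof.
move=> QL ew ew'; have [[e0 e1 e2] [e3 e4 e5]] := jordan_chain QL.
apply/matrixP => i j; rewrite mxE ew ew' e0 e1 e3 e4.
by move: i; apply: ord6_ind; rewrite !mxE.
Qed.

Tactic Notation "expand" constr(H) := move: H; rewrite ?mxE ?sum6 ?mxE /= /jordan_entry /=.

(** The off-diagonal block intertwines operators with disjoint spectra and so vanishes; on a
    diagonal block the relation equates neighbours along antidiagonals and kills those below the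
    main one. *)
Lemma hankel_gram l m C : l != m -> jordan l m *m C = C *m (jordan l m)^T ->
  [/\ C o0 o3 = 0 /\ C o0 o4 = 0 /\ C o0 o5 = 0, C o1 o3 = 0 /\ C o1 o4 = 0 /\ C o1 o5 = 0 &
      C o2 o3 = 0 /\ C o2 o4 = 0 /\ C o2 o5 = 0] /\
  [/\ C o1 o1 = C o0 o2, C o1 o2 = 0 & C o2 o2 = 0] /\
  [/\ C o4 o4 = C o3 o5, C o4 o5 = 0 & C o5 o5 = 0].
Proof.
move=> lm JC; have D0 : l - m != 0 by rewrite subr_eq0.
have cancel (x : R) : (l - m) * x = 0 -> x = 0 by move/eqP; rewrite mulf_eq0 (negbTE D0) => /eqP.
have H i j : (jordan l m *m C) i j = (C *m (jordan l m)^T) i j by rewrite JC.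
have c25 : C o2 o5 = 0 by apply: cancel; expand (H o2 o5); lra.
have c24 : C o2 o4 = 0 by apply: cancel; expand (H o2 o4); rewrite c25; lra.
have c23 : C o2 o3 = 0 by apply: cancel; expand (H o2 o3); rewrite c24; lra.
have c15 : C o1 o5 = 0 by apply: cancel; expand (H o1 o5); rewrite c25; lra.
have c14 : C o1 o4 = 0 by apply: cancel; expand (H o1 o4); rewrite c24 c15; lra.
have c13 : C o1 o3 = 0 by apply: cancel; expand (H o1 o3); rewrite c23 c14; lra.
have c05 : C o0 o5 = 0 by apply: cancel; expand (H o0 o5); rewrite c15; lra.
have c04 : C o0 o4 = 0 by apply: cancel; expand (H o0 o4); rewrite c14 c05; lra.
have c03 : C o0 o3 = 0 by apply: cancel; expand (H o0 o3); rewrite c13 c04; lra.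
split=> //; split; split.
- by expand (H o0 o1); lra.
- by expand (H o0 o2); lra.
- by expand (H o1 o2); lra.
- by expand (H o3 o4); lra.
- by expand (H o3 o5); lra.
- by expand (H o4 o5); lra.
Qed.

(** The matrix of a0 + a1 N + a2 N^2, the general matrix commuting with a Jordan block. *)
Definition toeplitz_entry (a0 a1 a2 : R) (i j : nat) : R :=
  match i, j with
  | 0%N, 0%N | 1%N, 1%N | 2%N, 2%N => a0
  | 0%N, 1%N | 1%N, 2%N => a1
  | 0%N, 2%N => a2
  | _, _ => 0
  end.

(** The matrix (c2 + c1 N + c0 N^2) F with F the antidiagonal permutation. *)
Definition hankel_entry (c0 c1 c2 : R) (i j : nat) : R :=
  match i, j with
  | 0%N, 0%N => c0
  | 0%N, 1%N | 1%N, 0%N => c1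
  | 0%N, 2%N | 1%N, 1%N | 2%N, 0%N => c2
  | _, _ => 0
  end.

Lemma hankel_gramE l m C : l != m -> C^T = C -> jordan l m *m C = C *m (jordan l m)^T ->
  C = block33 (hankel_entry (C o0 o0) (C o0 o1) (C o0 o2)) (hankel_entry (C o3 o3) (C o3 o4) (C o3 o5)).
Proof.
move=> lm sC JC; have S i j : C i j = C j i by rewrite -[in LHS]sC mxE.
have [[[c03 [c04 c05]] [c13 [c14 c15]] [c23 [c24 c25]]] [[c11 c12 c22] [c44 c45 c55]]] := hankel_gram lm JC.
apply/matrixP; apply: ord6_ind; apply: ord6_ind; rewrite mxE //=.
all: by rewrite ?c03 ?c04 ?c05 // S.
Qed.

Lemma toeplitz_jordan l m (a0 a1 a2 b0 b1 b2 : R) (N := block33 (toeplitz_entry a0 a1 a2) (toeplitz_entry b0 b1 b2)) :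
  N *m jordan l m = jordan l m *m N.
Proof.
by apply/matrixP; apply: ord6_ind; apply: ord6_ind; rewrite !mxE !sum6 !mxE /= /jordan_entry /=; ring.
Qed.

Lemma block33_mul (A B A' B' : nat -> nat -> R) :
  block33 A B *m block33 A' B' =
  block33 (fun i j => A i 0%N * A' 0%N j + A i 1%N * A' 1%N j + A i 2%N * A' 2%N j)
          (fun i j => B i 0%N * B' 0%N j + B i 1%N * B' 1%N j + B i 2%N * B' 2%N j).
Proof.
apply/matrixP => i j; rewrite mxE sum6 !mxE /=.
by case: (i < 3)%N; case: (j < 3)%N; ring.
Qed.

Lemma block33_tr (A B : nat -> nat -> R) :
  (block33 A B)^T = block33 (fun i j => A j i) (fun i j => B j i).
Proof. by apply/matrixP => i j; rewrite !mxE; case: (i < 3)%N; case: (j < 3)%N. Qed.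

Lemma eq_block33 (A B A' B' : nat -> nat -> R) :
  (forall i j, (i < 3)%N -> (j < 3)%N -> A i j = A' i j) ->
  (forall i j, (i < 3)%N -> (j < 3)%N -> B i j = B' i j) -> block33 A B = block33 A' B'.
Proof.
move=> HA HB; apply/matrixP; apply: ord6_ind; apply: ord6_ind; rewrite !mxE //=.
all: by rewrite ?HA ?HB.
Qed.

Lemma nat3_ind (P : nat -> Prop) : P 0%N -> P 1%N -> P 2%N -> forall i, (i < 3)%N -> P i.
Proof. by move=> P0 P1 P2 [|[|[|]]]. Qed.

End PointwiseFrame.

(** * Smooth normalization of the coframe *)

Section SmoothFrame.
Context {R : realType}.
Notation V := 'rV[R]_6.
Implicit Types (U W : set V) (g h E : V -> 'M[R]_6) (phi l m : V -> R) (x y p : V).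
Local Notation o0 := (@Ordinal 6 0 isT).
Local Notation o1 := (@Ordinal 6 1 isT).
Local Notation o2 := (@Ordinal 6 2 isT).
Local Notation o3 := (@Ordinal 6 3 isT).
Local Notation o4 := (@Ordinal 6 4 isT).
Local Notation o5 := (@Ordinal 6 5 isT).

Lemma metric_unit (G : 'M[R]_6) : signature_ppmmmm G -> G \in unitmx.
Proof.
move=> [P uP E]; have : P^T *m G *m P \in unitmx.
  rewrite E unitmxE det_diag unitfE prodf_seq_neq0; apply/allP => i _ /=.
  by rewrite mxE; case: ifP; rewrite ?oner_eq0 // oppr_eq0 oner_eq0.
by rewrite !unitmx_mul => /andP[/andP[]].
Qed.

Ltac smooth_tac := repeat first [assumption | exact: smooth_cst | apply: smoothB
  | apply: smoothD | apply: smoothM | apply: smoothX | apply: smoothN].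

(* The equations say that
   (a0 + a1 N + a2 N^2)^2 (c2 + c1 N + c0 N^2) = (e d^3)^-1 (1 - N/d)^-3, N^3 = 0. *)
Lemma hankel_normalization U (e : R) (d c0 c1 c2 : V -> R) : open U -> e != 0 ->
  smooth_on U d -> smooth_on U c0 -> smooth_on U c1 -> smooth_on U c2 ->
  (forall y, U y -> 0 < e * d y * c2 y) ->
  exists a0 a1 a2 : V -> R, [/\ smooth_on U a0, smooth_on U a1, smooth_on U a2 &
    forall y, U y -> [/\ a0 y ^+ 2 * c2 y = (e * d y ^+ 3)^-1,
      a0 y ^+ 2 * c1 y + 2 * a0 y * a1 y * c2 y = 3 * (e * d y ^+ 4)^-1 &
      a0 y ^+ 2 * c0 y + 2 * a0 y * a1 y * c1 y + (2 * a0 y * a2 y + a1 y ^+ 2) * c2 y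
        = 6 * (e * d y ^+ 5)^-1]].
Proof.
move=> oU e0 sd s0 s1 s2 pos.
have d0 y : U y -> d y != 0.
  by move=> /pos; apply: contraTneq => ->; rewrite mulr0 mul0r ltxx.
have c20 y : U y -> c2 y != 0.
  by move=> /pos; apply: contraTneq => ->; rewrite mulr0 ltxx.
have sc c : smooth_on U (fun=> c) by exact: smooth_cst.
have sI n : smooth_on U (fun y => (e * d y ^+ n)^-1).
  apply: smoothV => //; first by apply: smoothM => //; exact: smoothX.
  by move=> y Uy; rewrite mulf_neq0 // expf_neq0 // d0.
have sc2V : smooth_on U (fun y => (c2 y)^-1) by exact: smoothV.
have posq y : U y -> 0 < (e * d y ^+ 3)^-1 * (c2 y)^-1.
  move=> Uy; rewrite -invfM invr_gt0.
  have -> : e * d y ^+ 3 * c2 y = (e * d y * c2 y) * d y ^+ 2 by ring.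
  by rewrite mulr_gt0 ?pos // lt_neqAle sqr_ge0 eq_sym sqrf_eq0 d0.
(* Solved by increasing powers of N: the leading equation is a square root, and the other two are
   linear in [a1] and [a2] with coefficient 2 a0 c2. *)
pose a0 y := Num.sqrt ((e * d y ^+ 3)^-1 * (c2 y)^-1).
have sa0 : smooth_on U a0 by apply: smooth_sqrt => //; exact: smoothM.
have a0n y : U y -> a0 y != 0 by move=> Uy; rewrite gt_eqF // sqrtr_gt0 posq.
have a0E y : U y -> a0 y ^+ 2 * c2 y = (e * d y ^+ 3)^-1.
  by move=> Uy; rewrite sqr_sqrtr ?(ltW (posq y Uy)) // mulfVK // c20.
have sD : smooth_on U (fun y => (2 * a0 y * c2 y)^-1).
  apply: smoothV => //; first by do 2?apply: smoothM.
  by move=> y Uy; rewrite !mulf_neq0 ?a0n ?c20.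
pose a1 y := (3 * (e * d y ^+ 4)^-1 - a0 y ^+ 2 * c1 y) * (2 * a0 y * c2 y)^-1.
have sa1 : smooth_on U a1 by rewrite /a1; smooth_tac.
pose a2 y := (6 * (e * d y ^+ 5)^-1 - a0 y ^+ 2 * c0 y - 2 * a0 y * a1 y * c1 y - a1 y ^+ 2 * c2 y)
  * (2 * a0 y * c2 y)^-1.
have sa2 : smooth_on U a2 by rewrite /a2; smooth_tac.
exists a0, a1, a2; split=> // y Uy; have n0 := a0n y Uy; have n2 := c20 y Uy; split; first exact: a0E.
- rewrite /a1; move: (3 * _) n0 => t n0; field; exact/andP.
- rewrite /a2; move: (6 * _) (a1 y) n0 => t b n0; field; exact/andP.
Qed.

(** Since F N^T F = N, conjugating a Hankel matrix by a Toeplitz one multiplies its polynomial by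
    the square of the Toeplitz polynomial. The target has the coefficients 1, 3, 6 of (1 - x)^-3. *)
Lemma hankel_toeplitz (e d c0 c1 c2 a0 a1 a2 : R) (i j : nat) : (i < 3)%N -> (j < 3)%N ->
  [/\ a0 ^+ 2 * c2 = (e * d ^+ 3)^-1, a0 ^+ 2 * c1 + 2 * a0 * a1 * c2 = 3 * (e * d ^+ 4)^-1 &
      a0 ^+ 2 * c0 + 2 * a0 * a1 * c1 + (2 * a0 * a2 + a1 ^+ 2) * c2 = 6 * (e * d ^+ 5)^-1] ->
  let N := toeplitz_entry a0 a1 a2 in let C := hankel_entry c0 c1 c2 in
  let NC i j := N i 0%N * C 0%N j + N i 1%N * C 1%N j + N i 2%N * C 2%N j in
  NC i 0%N * N j 0%N + NC i 1%N * N j 1%N + NC i 2%N * N j 2%N =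
  hankel_entry (6 * (e * d ^+ 5)^-1) (3 * (e * d ^+ 4)^-1) (e * d ^+ 3)^-1 i j.
Proof.
move=> i3 j3 [<- <- <-] N C NC; rewrite /NC /N /C; move: i i3 j j3.
by apply: nat3_ind; apply: nat3_ind => /=; ring.
Qed.

(** The product of (1 - N/d)^-3 F and F (1 - N/d)^3, the scalars e d^3 cancelling. *)
Lemma hankel_gram_inverse (e d : R) (i j : nat) : e != 0 -> d != 0 -> (i < 3)%N -> (j < 3)%N ->
  let H := hankel_entry (6 * (e * d ^+ 5)^-1) (3 * (e * d ^+ 4)^-1) (e * d ^+ 3)^-1 in
  H i 0%N * gram_entry e d 0 j + H i 1%N * gram_entry e d 1 j + H i 2%N * gram_entry e d 2 j
  = scalar_entry 1 i j.
Proof.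
move=> e0 d0 i3 j3 H; rewrite /H; move: i i3 j j3; apply: nat3_ind; apply: nat3_ind => /=;
by rewrite /scalar_entry /=; field; rewrite ?e0 ?d0.
Qed.

Lemma scalar_block33 (c : R) : c%:M = block33 (scalar_entry c) (scalar_entry c).
Proof. by apply/matrixP; apply: ord6_ind; apply: ord6_ind; rewrite !mxE. Qed.

Lemma jordan_shift (l m c : R) : jordan l m - c%:M = jordan (l - c) (m - c).
Proof.
by apply/matrixP; apply: ord6_ind; apply: ord6_ind; rewrite !mxE //= /jordan_entry /= ?subr0.
Qed.

Lemma char33_jordan (G H : 'M[R]_6) (l3 l6 c : R) : G \in unitmx -> char33 G H l3 l6 ->
  exists2 Q, Q \in unitmx & Q *m (invmx G *m (H - c *: G)) = jordan (l3 - c) (l6 - c) *m Q.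
Proof.
move=> uG [_ [P uP]]; rewrite block_jordan => E; exists (invmx P); first by rewrite unitmx_inv.
rewrite -jordan_shift mulmxBr -scalemxAr mulVmx // scalemx1.
apply: (can_inj (mulmxK uP)); rewrite -!mulmxA mulVmx // mulmx1 mulmxBl E.
by rewrite mul_scalar_mx -mul_mx_scalar -mulmxBr mulKmx.
Qed.

Lemma smooth_krylov U L l m w w' : open U -> smooth_tensor_on U L -> smooth_on U l -> smooth_on U m ->
  smooth_tensor_on U (fun y => krylov (L y) (l y) (m y) w w').
Proof.
move=> oU sL sl sm.
have sn (f : V -> R) : smooth_on U f -> smooth_tensor_on U (fun y => L y - (f y)%:M).
  move=> sf i j; apply: (@eq_smooth_on _ _ (fun y => L y i j - f y *+ (i == j))) => //.
    by move=> y _; rewrite !mxE.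
  by apply: smoothB => //; case: (i == j) => //; exact: smooth_cst.
have sM (q : nat) (A : V -> 'M[R]_(q, 6)) (B : V -> 'M[R]_6) :
    (forall i j, smooth_on U (fun y => A y i j)) -> smooth_tensor_on U B ->
    forall i j, smooth_on U (fun y => (A y *m B y) i j) by move=> sA sB; exact: smooth_mulmx.
have sc (f : V -> R) : smooth_on U f -> smooth_tensor_on U (fun y => cube (L y - (f y)%:M)).
  by move=> sf; apply: (sM); [apply: (sM)|]; exact: (sn _ sf).
have sw (v : V) : forall i j, smooth_on U (fun _ : V => v i j) by move=> i j; exact: smooth_cst.
move=> i j; apply: (eq_smooth_on oU (fun y _ => esym (mxE _ _ i j))).
move: i; apply: ord6_ind => /=.
- by apply: (sM) => //; exact: (sc _ sm).
- by apply: (sM); [apply: (sM) => //; exact: (sc _ sm)|exact: (sn _ sl)].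
- by apply: (sM); [apply: (sM); [apply: (sM) => //; exact: (sc _ sm)|exact: (sn _ sl)]|exact: (sn _ sl)].
- by apply: (sM) => //; exact: (sc _ sl).
- by apply: (sM); [apply: (sM) => //; exact: (sc _ sl)|exact: (sn _ sm)].
- by apply: (sM); [apply: (sM); [apply: (sM) => //; exact: (sc _ sl)|exact: (sn _ sm)]|exact: (sn _ sm)].
Qed.

Lemma near_pos U (f : V -> R) p : open U -> smooth_on U f -> U p -> 0 < f p ->
  \forall y \near p, 0 < f y.
Proof.
move=> oU sf Up f0; have c : {for p, continuous f}.
  exact/differentiable_continuous/(smooth_differentiable sf).
exact: (cvgr_gt _ c _ f0).
Qed.

Theorem smooth_frame U W g h phi l3 l6 p : open W -> W p -> W `<=` U -> metric U g ->
  symmetric_tensor U h -> smooth_on U phi -> smooth_on W l3 -> smooth_on W l6 ->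
  (forall x, W x -> char33 (g x) (h x) (l3 x) (l6 x)) ->
  let l x := l3 x - 2 * phi x in let m x := l6 x - 2 * phi x in
  exists (r e e' : R) E, [/\ 0 < r, ball p r `<=` W, (e = 1 \/ e = -1) /\ (e' = 1 \/ e' = -1),
    smooth_tensor_on (ball p r) E & forall y, ball p r y ->
      g y = (E y)^T *m gram e e' (m y - l y) *m E y /\
      h y - (2 * phi y) *: g y = (E y)^T *m (gram e e' (m y - l y) *m jordan (l y) (m y)) *m E y].
Proof.
move=> oW Wp WU [[sg symg] sigg] [sh symh] sphi sl3 sl6 ch l m.
have gW i j : smooth_on W (fun y => g y i j) by exact: smooth_on_sub WU (sg i j).
have hW i j : smooth_on W (fun y => h y i j) by exact: smooth_on_sub WU (sh i j).
have phiW : smooth_on W phi by exact: smooth_on_sub WU sphi.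
have s2phi : smooth_on W (fun y => 2 * phi y) by apply: smoothM => //; exact: smooth_cst.
have sl : smooth_on W l by exact: smoothB.
have sm : smooth_on W m by exact: smoothB.
have ug y : W y -> g y \in unitmx by move=> /WU /sigg; exact: metric_unit.
have lm y : W y -> l y != m y.
  by move=> /ch [H _]; apply: contra_neq H => /(congr1 (fun z => z + 2 * phi y)); rewrite /l /m !subrK.
pose a y := h y - (2 * phi y) *: g y.
have sa i j : smooth_on W (fun y => a y i j).
  apply: (@eq_smooth_on _ _ (fun y => h y i j - (2 * phi y) * g y i j)) => //.
    by move=> y _; rewrite !mxE.
  by apply: smoothB => //; exact: smoothM.
have syma y : W y -> (a y)^T = a y.
  by move=> /WU Uy; rewrite linearB linearZ /= symg // symh.
pose L y := invmx (g y) *m a y.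
have sgi i j : smooth_on W (fun y => invmx (g y) i j) by exact: smooth_invmx.
have sL i j : smooth_on W (fun y => L y i j) by exact: smooth_mulmx.
have jL y : W y -> exists2 Q, Q \in unitmx & Q *m L y = jordan (l y) (m y) *m Q.
  by move=> Wy; exact: char33_jordan (ug y Wy) (ch y Wy).
(* A Jordan basis is taken at [p] only; the constant covectors [w] and [w'] obtained from it extend
   it smoothly to the neighbouring points. *)
have [Q uQ QL] := jL p Wp.
have [w ew] := chain3_projection (lm p Wp) (jordan_chain QL).1.
have ml : m p != l p by rewrite eq_sym lm.
have [w' ew'] := chain3_projection ml (jordan_chain QL).2.
pose K y := krylov (L y) (l y) (m y) w w'.
have sK i j : smooth_on W (fun y => K y i j) by exact: smooth_krylov.
have KL y : W y -> K y *m L y = jordan (l y) (m y) *m K y.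
  by move=> /jL [Q' uQ' QL']; apply: krylov_jordan; exact: jordan_nilpotent uQ' QL'.
have Kp : K p = Q by exact: krylov_chain.
(* Gram matrix of the inverse metric on the rows of [K]; it is of Hankel form because L is
   self-adjoint. *)
pose C y := K y *m invmx (g y) *m (K y)^T.
have sC i j : smooth_on W (fun y => C y i j).
  apply: smooth_mulmx => //; first exact: smooth_mulmx.
  by move=> i' j'; apply: (eq_smooth_on oW _ (sK j' i')) => y _; rewrite [RHS]mxE.
have symgi y : W y -> (invmx (g y))^T = invmx (g y) by move=> /WU Uy; rewrite trmx_inv symg.
have symC y : W y -> (C y)^T = C y.
  by move=> Wy; rewrite /C !trmx_mul trmxK symgi // mulmxA.
have JC y : W y -> jordan (l y) (m y) *m C y = C y *m (jordan (l y) (m y))^T.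
  move=> Wy; rewrite /C !mulmxA -KL // -[_ *m (K y)^T *m _^T]mulmxA -trmx_mul -KL // trmx_mul.
  by rewrite /L trmx_mul symgi // syma // !mulmxA.
have CE y Wy := hankel_gramE (lm y Wy) (symC y Wy) (JC y Wy).
have uC : C p \in unitmx by rewrite /C Kp !unitmx_mul uQ unitmx_inv ug // unitmx_tr.
have c2p : C p o0 o2 != 0.
  apply: contraTneq uC => c2; have := CE p Wp; rewrite c2 => E.
  apply/negP => uC; have [k] := unitmx_row_neq0 uC o2; rewrite E mxE.
  by move: k; apply: ord6_ind => /=; rewrite eqxx.
have c5p : C p o3 o5 != 0.
  apply: contraTneq uC => c2; have := CE p Wp; rewrite c2 => E.
  apply/negP => uC; have [k] := unitmx_row_neq0 uC o5; rewrite E mxE.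
  by move: k; apply: ord6_ind => /=; rewrite eqxx.
pose d y := m y - l y.
have sd : smooth_on W d by exact: smoothB.
have snd : smooth_on W (fun y => - d y) by exact: smoothN.
have d0 y : W y -> d y != 0 by move=> Wy; rewrite subr_eq0 eq_sym lm.
have sgnP (x : R) : x != 0 -> (Num.sg x = 1 \/ Num.sg x = -1) /\ 0 < Num.sg x * x.
  move=> x0; rewrite -normrEsg normr_gt0 x0; split=> //.
  by move: x0; rewrite neq_lt => /orP[/ltr0_sg|/gtr0_sg]; [right|left].
(* The signs are read off at [p], so that the square roots in [hankel_normalization] exist there
   and, by continuity, nearby. *)
have [e1 pe] := sgnP (d p * C p o0 o2) (mulf_neq0 (d0 p Wp) c2p).
have nd0 : - d p != 0 by rewrite oppr_eq0 d0.
have [e1' pe'] := sgnP (- d p * C p o3 o5) (mulf_neq0 nd0 c5p).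
set e := Num.sg _ in e1 pe; set e' := Num.sg _ in e1' pe'.
have nz (x : R) : x = 1 \/ x = -1 -> x != 0 by case=> ->; rewrite ?oppr_eq0 oner_eq0.
have e0 := nz _ e1; have e0' := nz _ e1'.
have sconst c : smooth_on W (fun=> c) by exact: smooth_cst.
have near1 : \forall y \near p, 0 < e * d y * C y o0 o2.
  by apply: (near_pos oW) => //; [do 2?apply: smoothM|rewrite -mulrA].
have near2 : \forall y \near p, 0 < e' * (- d y) * C y o3 o5.
  by apply: (near_pos oW) => //; [do 2?apply: smoothM|rewrite -mulrA].
have near3 : \forall y \near p, W y by apply: (open_near oW Wp).
have [r r0 Br] := near_ball (filterI (filterI near1 near2) near3).
have BW : ball p r `<=` W by move=> y /Br [].
have oB : open (ball p r : set V) by exact: ball_open.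
have sB (f : V -> R) : smooth_on W f -> smooth_on (ball p r) f by exact: smooth_on_sub.
have [a0 [a1 [a2 [sa0 sa1 sa2 aP]]]] := hankel_normalization oB e0 (sB _ sd)
  (sB _ (sC o0 o0)) (sB _ (sC o0 o1)) (sB _ (sC o0 o2)) (fun y By => (Br y By).1.1).
have [b0 [b1 [b2 [sb0 sb1 sb2 bP]]]] := hankel_normalization oB e0' (sB _ snd)
  (sB _ (sC o3 o3)) (sB _ (sC o3 o4)) (sB _ (sC o3 o5)) (fun y By => (Br y By).1.2).
pose N y := block33 (toeplitz_entry (a0 y) (a1 y) (a2 y)) (toeplitz_entry (b0 y) (b1 y) (b2 y)).
have sN i j : smooth_on (ball p r) (fun y => N y i j).
  have s0 : smooth_on (ball p r) (fun _ : V => 0 : R) by exact: smooth_cst.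
  apply: (eq_smooth_on oB (fun y _ => esym (mxE _ _ i j))).
  by move: i j; apply: ord6_ind; apply: ord6_ind.
exists r, e, e', (fun y => N y *m K y); split=> //.
  by apply: smooth_mulmx => // i j; exact: sB.
move=> y By; have Wy := BW y By; move EE : (N y *m K y) => E.
have EL : E *m L y = jordan (l y) (m y) *m E.
  by rewrite -EE -mulmxA KL // mulmxA toeplitz_jordan mulmxA.
have HE : E *m invmx (g y) *m E^T *m gram e e' (d y) = 1%:M.
  have -> : E *m invmx (g y) *m E^T = N y *m C y *m (N y)^T by rewrite -EE /C trmx_mul !mulmxA.
  rewrite CE // block33_tr !block33_mul scalar_block33; apply: eq_block33 => i j i3 j3.
    rewrite !(hankel_toeplitz _ _ (aP y By)) //; exact: hankel_gram_inverse (d0 y Wy) _ _.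
  rewrite !(hankel_toeplitz _ _ (bP y By)) //; apply: hankel_gram_inverse => //.
  by rewrite oppr_eq0 d0.
have gE : g y = E^T *m gram e e' (d y) *m E.
  move: HE; rewrite -!mulmxA => /mulmx1C; rewrite -!mulmxA => /(congr1 (mulmx (g y))).
  by rewrite mulKVmx ?ug // mulmx1 => <-; rewrite mulmxA.
split=> //.
have -> : h y - (2 * phi y) *: g y = g y *m L y by rewrite /L mulKVmx // ug.
by rewrite [in LHS]gE -!mulmxA EL !mulmxA.
Qed.

End SmoothFrame.

(** * Canonical coordinates *)

Section BlockCoordinates.
Context {R : realType}.
Notation V := 'rV[R]_6.
Implicit Types (U : set V) (p x : V).

Lemma proportional (u v : 'I_6 -> R) : (exists k, v k != 0) ->
  (forall i k, u k * v i = u i * v k) -> exists c, forall k, u k = c * v k.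
Proof.
by move=> [i0 vi0] uv; exists (u i0 / v i0) => k; rewrite mulrAC -uv mulfK.
Qed.

(** The shift [s0] is free when [l] varies, since x3 = l - s0 will do, but has to be the value of
    [l] when [l] is constant, because then eps = 0. *)
Lemma block_coordinates U p (t1 t2 t3 : 'I_6 -> V -> R) (B l : V -> R) (s0 : R) :
  open U -> U p ->
  (forall k, smooth_on U (t1 k)) -> (forall k, smooth_on U (t2 k)) -> (forall k, smooth_on U (t3 k)) ->
  smooth_on U B -> smooth_on U l ->
  (forall x, U x -> forall k, partial k l x = B x * t3 k x) ->
  (forall x, U x -> exists k, t3 k x != 0) ->
  (forall x, U x -> forall i k, [/\ partial k (t1 i) x - partial i (t1 k) x = 0,
    partial k (t2 i) x - partial i (t2 k) x = B x * (t1 k x * t3 i x - t3 k x * t1 i x) &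
    partial k (t3 i) x - partial i (t3 k) x = 2 * B x * (t2 k x * t3 i x - t3 k x * t2 i x)]) ->
  (forall x, U x -> B x = 0 /\ l x = s0) \/ (forall x, U x -> B x != 0) ->
  exists (r eps : R) (x1 x2 x3 A : V -> R),
    [/\ 0 < r, ball p r `<=` U, eps = 0 \/ eps = 1,
        [/\ smooth_on (ball p r) x1, smooth_on (ball p r) x2, smooth_on (ball p r) x3 & smooth_on (ball p r) A] &
        forall x, ball p r x ->
         [/\ A x != 0, eps = 0 -> A x - eps * x2 x = 2^-1, eps * x3 x = l x - s0,
             forall k, [/\ partial k x1 x = t1 k x, partial k x2 x = t2 k x - eps * x1 x * (t3 k x / (2 * A x)) &
               partial k x3 x = t3 k x / (2 * A x)] &
             exists c, forall k, partial k (fun y => A y - eps * x2 y) x = c * partial k x3 x]].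
Proof.
move=> oU Up s1 s2 s3 sB sl dl nz curl alt.
have cl1 x : U x -> forall i j, partial i (t1 j) x = partial j (t1 i) x.
  by move=> Ux i j; have [/subr0_eq] := curl x Ux j i.
have [r1 [r10 BU1] [x1 sx1 dx1]] := poincare oU Up s1 cl1.
have oB1 : open (ball p r1 : set V) by exact: ball_open.
have Bp1 : ball p r1 p by exact: ballxx.
have sub1 (f : V -> R) : smooth_on U f -> smooth_on (ball p r1) f by exact: smooth_on_sub.
case: alt => [cst|nB].
  have B0 x : ball p r1 x -> B x = 0 by move=> /BU1 /cst [].
  have cl2 x : ball p r1 x -> forall i j, partial i (t2 j) x = partial j (t2 i) x.
    by move=> bx i j; have [_ + _] := curl x (BU1 x bx) j i; rewrite B0 // mul0r => /subr0_eq.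
  have [r2 [r20 BU2] [x2 sx2 dx2]] := poincare oB1 Bp1 (fun k => sub1 _ (s2 k)) cl2.
  have oB2 : open (ball p r2 : set V) by exact: ball_open.
  have Bp2 : ball p r2 p by exact: ballxx.
  have sub2 (f : V -> R) : smooth_on U f -> smooth_on (ball p r2) f.
    by move=> /sub1; exact: smooth_on_sub.
  have cl3 x : ball p r2 x -> forall i j, partial i (t3 j) x = partial j (t3 i) x.
    by move=> /BU2 bx i j; have [_ _] := curl x (BU1 x bx) j i; rewrite B0 // mulr0 mul0r => /subr0_eq.
  have [r3 [r30 BU3] [x3 sx3 dx3]] := poincare oB2 Bp2 (fun k => sub2 _ (s3 k)) cl3.
  have BU : ball p r3 `<=` U by move=> x /BU3 /BU2 /BU1.
  exists r3, 0, x1, x2, x3, (fun=> 2^-1); split; [by []|by []|by left| |].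
    split=> //; last exact: smooth_cst.
      by apply: smooth_on_sub sx1 => x /BU3 /BU2.
    by apply: smooth_on_sub sx2 => x /BU3.
  move=> x b3; have b2 := BU3 x b3; have b1 := BU2 x b2; have [_ ls] := cst x (BU1 x b1).
  split.
  - by rewrite invr_eq0 pnatr_eq0.
  - by move=> _; rewrite mul0r subr0.
  - by rewrite mul0r ls subrr.
  - by move=> k; rewrite dx1 // dx2 // dx3 // !mul0r subr0 mulfV ?pnatr_eq0 // divr1.
  exists 0 => k; rewrite mul0r (_ : (fun _ => _) = fun=> 2^-1); first exact: derive_cst.
  by apply/funext => y; rewrite mul0r subr0.
have sdl k : smooth_on (ball p r1) (partial k l) by exact/smooth_partial/sub1.
(* Closed because d th2 = B th1 /\ th3 = th1 /\ dl = dx1 /\ dl, which is the differential of x1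
   dl. *)
pose w k x := t2 k x - x1 x * partial k l x.
have sw k : smooth_on (ball p r1) (w k).
  by apply: smoothB => //; [exact: sub1|exact: smoothM].
have pw k i x : ball p r1 x -> partial k (w i) x =
    partial k (t2 i) x - (t1 k x * partial i l x + x1 x * partial k (partial i l) x).
  move=> bx; have dt := smooth_differentiable (sub1 _ (s2 i)) bx.
  have dx := smooth_differentiable sx1 bx; have dli := smooth_differentiable (sdl i) bx.
  rewrite /partial deriveB; [|exact: diff_derivable|exact/diff_derivable/differentiableM].
  by congr (_ - _); rewrite -/(partial k _ x) partialM // dx1.
have cw x : ball p r1 x -> forall i j, partial i (w j) x = partial j (w i) x.
  move=> bx i j; have Ux := BU1 x bx; apply/eqP; rewrite -subr_eq0 !pw // (schwarz i j oU sl Ux) !dl //.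
  by have [_ + _] := curl x Ux j i => E; apply/eqP; lra.
have [r2 [r20 BU2] [x2 sx2 dx2]] := poincare oB1 Bp1 sw cw.
have BU : ball p r2 `<=` U by move=> x /BU2 /BU1.
have oB2 : open (ball p r2 : set V) by exact: ball_open.
have sub2 (f : V -> R) : smooth_on U f -> smooth_on (ball p r2) f by exact: smooth_on_sub.
pose A x := (2 * B x)^-1.
have n2B x : U x -> 2 * B x != 0 by move=> Ux; rewrite mulf_neq0 ?nB ?pnatr_eq0.
have sA : smooth_on U A.
  by apply: smoothV => //; apply: smoothM => //; exact: smooth_cst.
exists r2, 1, x1, x2, (fun x => l x - s0), A; split; [by []|by []|by right| |].
  split; [exact: smooth_on_sub sx1|by []| |exact: sub2].
  by apply: smoothB => //; [exact: sub2|exact: smooth_cst].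
move=> x b2; have b1 := BU2 x b2; have Ux := BU1 x b1.
have p3 k : partial k (fun x => l x - s0) x = partial k l x.
  rewrite /partial deriveB ?derive_cst ?subr0 //.
  exact/diff_derivable/(smooth_differentiable sl).
have tA k : t3 k x / (2 * A x) = B x * t3 k x.
  have nBx := nB x Ux; have -> : 2 * A x = (B x)^-1 by rewrite /A; field.
  by rewrite invrK mulrC.
split.
- by rewrite invr_eq0 n2B.
- by move/eqP; rewrite oner_eq0.
- by rewrite mul1r.
- by move=> k; rewrite dx1 // dx2 // p3 mul1r tA -dl.
have dA := smooth_differentiable sA Ux.
have dlk i : differentiable (partial i l) x by exact: smooth_differentiable (sdl i) b1.
have pH k : partial k (fun y => A y - 1 * x2 y) x = partial k A x - w k x.
  rewrite (_ : (fun y => _) = fun y => A y - x2 y); last by apply/funext => y; rewrite mul1r.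
  have dx := smooth_differentiable sx2 b2.
  by rewrite /partial deriveB; [rewrite -/(partial k x2 x) dx2|exact: diff_derivable|exact: diff_derivable].
have [||c E] := @proportional (fun k => partial k A x - w k x) (fun k => partial k l x).
- by have [k k0] := nz x Ux; exists k; rewrite dl // mulf_neq0 //; exact: nB.
(* Inserting th3 = 2 A dl in d th3 = 2 B th2 /\ th3 gives (dA - th2) /\ dl = 0, where th2 may be
   replaced by dx2 = th2 - x1 dl. *)
- move=> i k.
  have t3E j : forall y, U y -> t3 j y = 2 * (A y * partial j l y).
    by move=> y Uy; rewrite dl // /A; have := nB y Uy => nBy; field.
  have pt3 j n : partial n (t3 j) x = 2 * (partial n A x * partial j l x + A x * partial n (partial j l) x).
    rewrite (eq_partial n oU Ux (t3E j)) partialM; [|exact: differentiable_cst|exact: differentiableM].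
    by rewrite partialM // (_ : partial n (fun=> 2) x = 0) ?mul0r ?add0r //; exact: derive_cst.
  have [_ _] := curl x Ux i k; rewrite !pt3 (schwarz i k oU sl Ux) /w !dl //.
  by move=> H; lra.
by exists c => k; rewrite pH E p3.
Qed.

End BlockCoordinates.

(** * The canonical form in the normalized coframe *)

Section CanonicalMatrices.
Context {R : realType}.
Notation V := 'rV[R]_6.
Variables (D : canonical_data (R := R)) (x : V).

(** Both blocks of [canonical_g] are instances: passing to the second one changes the signs of [d]
    and [S1] and keeps [S2]. *)
Definition canonical_gram_entry (e d S1 S2 A u : R) (i j : nat) : R :=
  match i, j with
  | 0%N, 2%N | 2%N, 0%N => e * d ^+ 3 * (2 * A)
  | 1%N, 1%N => e * d ^+ 3
  | 1%N, 2%N | 2%N, 1%N => e * d ^+ 3 * (u - 2 * A * S1)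
  | 2%N, 2%N => e * d ^+ 3 * (u ^+ 2 - 4 * u * A * S1 + 4 * A ^+ 2 * S2)
  | _, _ => 0
  end.

(** What remains of a block of [canonical_a] after its eigenvalue times the metric is removed. *)
Definition canonical_nilpotent_entry (e d S1 A u : R) (i j : nat) : R :=
  match i, j with
  | 1%N, 2%N | 2%N, 1%N => e * d ^+ 3 * (2 * A)
  | 2%N, 2%N => 4 * A * (e * d ^+ 3) * (u - A * S1)
  | _, _ => 0
  end.

(* The rows of the block are the coframe 1-forms, the columns the coordinate
   differentials: dx1 = th1, dx2 = th2 - eps x1 dx3, dx3 = th3 / (2 A). *)
Definition coordinate_entry (u A : R) (i j : nat) : R :=
  match i, j with
  | 0%N, 0%N | 1%N, 1%N => 1
  | 2%N, 1%N => - u / (2 * A)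
  | 2%N, 2%N => (2 * A)^-1
  | _, _ => 0
  end.

Lemma ixE k : (k < 6)%N -> ix k.+1 = ord6 k.
Proof. by move=> k6; apply/val_inj; rewrite /= inordK //; case: k k6 => [|[|[|[|[|[|]]]]]]. Qed.

Lemma block33D (A B A' B' : nat -> nat -> R) : block33 A B + block33 A' B' =
  block33 (fun i j => A i j + A' i j) (fun i j => B i j + B' i j).
Proof. by apply/matrixP => i j; rewrite !mxE; case: ifP => _; case: ifP => _ //; rewrite addr0. Qed.

Lemma block33Z (c : R) (A B : nat -> nat -> R) : c *: block33 A B =
  block33 (fun i j => c * A i j) (fun i j => c * B i j).
Proof. by apply/matrixP => i j; rewrite !mxE; case: ifP => _; case: ifP => _ //; rewrite mulr0. Qed.

Definition sym_entry (i j a b : nat) : R :=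
  2^-1 * (((a == i) && (b == j))%:R + ((a == j) && (b == i))%:R).

Lemma dd_upper i j : (i < 3)%N -> (j < 3)%N ->
  dd i.+1 j.+1 = block33 (sym_entry i j) (fun _ _ => 0) :> 'M[R]_6.
Proof.
move=> i3 j3; rewrite /dd !ixE ?(leq_trans i3) ?(leq_trans j3) //.
apply/matrixP => a b; rewrite !mxE -!val_eqE /=.
have lt3 k : (k < 3)%N -> nat_of_ord (ord6 k) = k by case: k => [|[|[|]]].
rewrite !lt3 //; case: ifP => a3; case: ifP => b3 //.
- by rewrite !(gtn_eqF (_ : _ < b)%N) ?andbF ?addr0 ?mulr0 // (leq_trans _ (_ : 3 <= b)%N) // leqNgt b3.
- by rewrite !(gtn_eqF (_ : _ < a)%N) ?addr0 ?mulr0 // (leq_trans _ (_ : 3 <= a)%N) // leqNgt a3.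
- by rewrite !(gtn_eqF (_ : _ < a)%N) ?addr0 ?mulr0 // (leq_trans _ (_ : 3 <= a)%N) // leqNgt a3.
Qed.

Lemma dd_lower i j : (i < 3)%N -> (j < 3)%N ->
  dd (4 + i) (4 + j) = block33 (fun _ _ => 0) (sym_entry i j) :> 'M[R]_6.
Proof.
move=> i3 j3; rewrite /dd !ixE //.
apply/matrixP; apply: ord6_ind; apply: ord6_ind; rewrite !mxE -!val_eqE /=.
all: move: i i3 j j3; apply: nat3_ind; apply: nat3_ind; rewrite /sym_entry /= ?addr0 ?mulr0 //.
Qed.

Let ddU := (@dd_upper 0 0 isT isT, @dd_upper 0 1 isT isT, @dd_upper 0 2 isT isT,
  @dd_upper 1 0 isT isT, @dd_upper 1 1 isT isT, @dd_upper 1 2 isT isT,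
  @dd_upper 2 0 isT isT, @dd_upper 2 1 isT isT, @dd_upper 2 2 isT isT).
Let ddL := (@dd_lower 0 0 isT isT, @dd_lower 0 1 isT isT, @dd_lower 0 2 isT isT,
  @dd_lower 1 0 isT isT, @dd_lower 1 1 isT isT, @dd_lower 1 2 isT isT,
  @dd_lower 2 0 isT isT, @dd_lower 2 1 isT isT, @dd_lower 2 2 isT isT).

Lemma canonical_g_block : canonical_g D x =
  block33 (canonical_gram_entry (e3 D) (f6 D x - f3 D x) (Sigma1 D x) (Sigma2 D x) (fA D x) (eps D * crd 1 x))
          (canonical_gram_entry (e6 D) (f3 D x - f6 D x) (- Sigma1 D x) (Sigma2 D x) (fAt D x) (epst D * crd 4 x)).
Proof.
rewrite /canonical_g !ddU !ddL !(block33D, block33Z).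
by apply: eq_block33 => i j i3 j3; move: i i3 j j3; apply: nat3_ind; apply: nat3_ind;
  rewrite /sym_entry /=; field.
Qed.

Lemma canonical_a_block : canonical_a D x =
  let d := f6 D x - f3 D x in let d' := f3 D x - f6 D x in
  let S1 := Sigma1 D x in let S2 := Sigma2 D x in
  let A := fA D x in let At := fAt D x in let u := eps D * crd 1 x in let ut := epst D * crd 4 x in
  block33 (fun i j => f3 D x * canonical_gram_entry (e3 D) d S1 S2 A u i j + canonical_nilpotent_entry (e3 D) d S1 A u i j)
    (fun i j => f6 D x * canonical_gram_entry (e6 D) d' (- S1) S2 At ut i j + canonical_nilpotent_entry (e6 D) d' (- S1) At ut i j).
Proof.
rewrite /canonical_a canonical_g_block !unlock /= !ddU !ddL !ixE //= ![block33 _ _ _ _]mxE /=.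
rewrite -/(f3 D x) -/(f6 D x) !addr0 !(block33D, block33Z).
move: (f6 D x - f3 D x) (f3 D x - f6 D x) (Sigma1 D x) (Sigma2 D x) (fA D x) (fAt D x) (eps D * _) (epst D * _) => d d' S1 S2 A At u ut.
by apply: eq_block33 => i j i3 j3; move: i i3 j j3; apply: nat3_ind; apply: nat3_ind;
  rewrite /sym_entry /=; field.
Qed.

(** This explains Sigma1 and Sigma2: the normalized Gram block is e d^3 (1 - S1 N + S2 N^2), so they
    are the coefficients 3/d and 3/d^2 of (1 - N/d)^3. *)
Lemma coordinate_gram (e d A u : R) (i j : nat) : d != 0 -> A != 0 -> (i < 3)%N -> (j < 3)%N ->
  let S1 := 3 * d^-1 in let K := coordinate_entry u A in
  let C := canonical_gram_entry e d S1 (3 * d ^- 2) A u in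
  let KC i j := K i 0%N * C 0%N j + K i 1%N * C 1%N j + K i 2%N * C 2%N j in
  KC i 0%N * K j 0%N + KC i 1%N * K j 1%N + KC i 2%N * K j 2%N = gram_entry e d i j.
Proof.
move=> d0 A0 i3 j3 S1 K C KC; rewrite /KC /C /K /S1; move: i i3 j j3.
by apply: nat3_ind; apply: nat3_ind => /=; field; rewrite ?d0 ?A0.
Qed.

Lemma coordinate_jordan (e d A u l : R) (i j : nat) : d != 0 -> A != 0 -> (i < 3)%N -> (j < 3)%N ->
  let S1 := 3 * d^-1 in let K := coordinate_entry u A in let J := jordan_entry l in
  let C i j := l * canonical_gram_entry e d S1 (3 * d ^- 2) A u i j + canonical_nilpotent_entry e d S1 A u i j in
  let KC i j := K i 0%N * C 0%N j + K i 1%N * C 1%N j + K i 2%N * C 2%N j in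
  KC i 0%N * K j 0%N + KC i 1%N * K j 1%N + KC i 2%N * K j 2%N =
  gram_entry e d i 0%N * J 0%N j + gram_entry e d i 1%N * J 1%N j + gram_entry e d i 2%N * J 2%N j.
Proof.
move=> d0 A0 i3 j3 S1 K J C KC; rewrite /KC /C /K /J /S1 /jordan_entry; move: i i3 j j3.
by apply: nat3_ind; apply: nat3_ind => /=; field; rewrite ?d0 ?A0.
Qed.

Definition coordinate_mx :=
  block33 (coordinate_entry (eps D * crd 1 x) (fA D x)) (coordinate_entry (epst D * crd 4 x) (fAt D x)).

Hypotheses (A0 : fA D x != 0) (At0 : fAt D x != 0) (d0 : f6 D x - f3 D x != 0).

Let nd0 : f3 D x - f6 D x != 0. Proof. by rewrite -opprB oppr_eq0. Qed.
Let SE : - Sigma1 D x = 3 * (f3 D x - f6 D x)^-1.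
Proof. by rewrite /Sigma1 -[f3 D x - _]opprB invrN mulrN. Qed.
Let S2E : Sigma2 D x = 3 * (f3 D x - f6 D x) ^- 2.
Proof. by rewrite /Sigma2 -[f3 D x - _]opprB sqrrN. Qed.

Lemma coordinate_canonical_g :
  coordinate_mx *m canonical_g D x *m coordinate_mx^T = gram (e3 D) (e6 D) (f6 D x - f3 D x).
Proof.
rewrite canonical_g_block block33_tr !block33_mul; apply: eq_block33 => i j i3 j3.
  exact: coordinate_gram.
by rewrite SE S2E opprB; exact: coordinate_gram.
Qed.

Lemma coordinate_canonical_a :
  coordinate_mx *m canonical_a D x *m coordinate_mx^T =
  gram (e3 D) (e6 D) (f6 D x - f3 D x) *m jordan (f3 D x) (f6 D x).
Proof.
rewrite canonical_a_block block33_tr !block33_mul; apply: eq_block33 => i j i3 j3.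
  exact: coordinate_jordan.
by rewrite SE S2E opprB; exact: coordinate_jordan.
Qed.

End CanonicalMatrices.

(** * Assembly of the six coordinate functions *)

Section CoordinateFunctions.
Context {R : realType}.
Notation V := 'rV[R]_6.
Implicit Types (U W : set V) (g h E : V -> 'M[R]_6) (phi l m : V -> R) (x y p : V) (X : V -> V).

Lemma constant_on_ball (f : V -> R) p (r : R) : smooth_on (ball p r) f ->
  (forall x, ball p r x -> forall k, partial k f x = 0) -> forall x, ball p r x -> f x = f p.
Proof.
move=> sf df x xr; have pr : ball p r p by apply: ballxx; apply: le_lt_trans (normr_ge0 _) ((ballP p r x).1 xr).
have xE : p + (x - p) = x by rewrite addrC subrK.
have seg (t : R) : 0 <= t <= 1 -> ball p r (p + t *: (x - p)).
  by move=> t01; apply: ball_segment; rewrite ?xE.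
have [t t01] := mvt (fun t t01 => smooth_differentiable sf (seg t t01)).
rewrite xE big1 => [/eqP|k _]; first by rewrite subr_eq0 => /eqP.
by rewrite df ?mulr0 //; exact: seg.
Qed.

Lemma partial_zero_cst U f x k : open U -> U x -> (forall y z, U y -> U z -> f y = f z) ->
  partial k f x = 0 :> R.
Proof.
move=> oU Ux cf; rewrite (eq_partial k oU Ux (fun y Uy => cf y x Uy Ux)).
exact: derive_cst.
Qed.

(** Everything except theta and omega. The last clause only makes the differentials of A - eps x2
    and At - epst x5 proportional to dx3 and dx6; they become functions of one variable once the
    coordinates are inverted. *)
Definition coordinate_system U g h phi p (r e e' eps epst s a k : R) E l m (A At : V -> R) X : Prop :=
  [/\ [/\ 0 < r, ball p r `<=` U, e = 1 \/ e = -1 & e' = 1 \/ e' = -1],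
      [/\ eps = 0 \/ eps = 1, epst = 0 \/ epst = 1 & epst = 0 -> a != 0],
      [/\ smooth_map_on (ball p r) X, smooth_on (ball p r) A & smooth_on (ball p r) At],
      forall u, ball p r u ->
        [/\ g u = (E u)^T *m gram e e' (m u - l u) *m E u,
            h u - (2 * phi u) *: g u =
              (E u)^T *m (gram e e' (m u - l u) *m jordan (l u) (m u)) *m E u,
            [/\ A u != 0, At u != 0 & m u != l u],
            [/\ eps * crd 3 (X u) = l u - s, epst * crd 6 (X u) = m u - s - a &
                phi u = 3 / 2 * (l u + m u) + k] &
            'J X u = (E u)^T *m block33 (coordinate_entry (eps * crd 1 (X u)) (A u))
                                        (coordinate_entry (epst * crd 4 (X u)) (At u))] &
      forall u, ball p r u ->
        [/\ eps = 0 -> A u - eps * crd 2 (X u) = 2^-1,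
            epst = 0 -> At u - epst * crd 5 (X u) = 2^-1,
            exists c, forall k, partial k (fun y => A y - eps * crd 2 (X y)) u = c * partial k (fun y => crd 3 (X y)) u &
            exists c, forall k, partial k (fun y => At y - epst * crd 5 (X y)) u = c * partial k (fun y => crd 6 (X y)) u]].

Theorem coordinate_system_exists U g h phi p : open U -> metric U g -> symmetric_tensor U h ->
  smooth_on U phi -> eisenhart U g h phi -> U p -> regular_point U g h phi p ->
  exists r e e' eps epst s a k E l m A At X,
    coordinate_system U g h phi p r e e' eps epst s a k E l m A At X.
Proof.
move=> oU mg sh sphi eis Up [W [l3 [l6 [[oW Wp] WU [sl3 sl6] ch [altl altm]]]]].
have [r0 [e [e' [E [r00 B0W [e1 e1'] sE gaE]]]]] := smooth_frame oW Wp WU mg sh sphi sl3 sl6 ch.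
pose l x := l3 x - 2 * phi x; pose m x := l6 x - 2 * phi x.
pose B0 : set V := ball p r0; have oB0 : open B0 by exact: ball_open.
have B0p : B0 p by exact: ballxx.
have B0U : B0 `<=` U by move=> x /B0W /WU.
have nz (x : R) : x = 1 \/ x = -1 -> x != 0 by case=> ->; rewrite ?oppr_eq0 oner_eq0.
have e0 := nz _ e1; have e0' := nz _ e1'.
have sub (f : V -> R) : smooth_on U f -> smooth_on B0 f by exact: smooth_on_sub.
have sg i j : smooth_on B0 (fun x => g x i j) by exact/sub/mg.1.1.
have sh' i j : smooth_on B0 (fun x => h x i j) by exact/sub/sh.1.
have symg x : B0 x -> (g x)^T = g x by move=> /B0U; exact: mg.1.2.
have ug x : B0 x -> g x \in unitmx by move=> /B0U /mg.2; exact: metric_unit.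
have sphi0 := sub _ sphi.
have eis0 : eisenhart B0 g h phi by move=> x /B0U; exact: eis.
have sl : smooth_on B0 l.
  apply: smoothB => //; first exact: smooth_on_sub B0W sl3.
  by apply: smoothM => //; exact: smooth_cst.
have sm : smooth_on B0 m.
  apply: smoothB => //; first exact: smooth_on_sub B0W sl6.
  by apply: smoothM => //; exact: smooth_cst.
have lm y : B0 y -> m y != l y.
  move=> /B0W /ch [H _]; rewrite eq_sym; apply: contra_neq H.
  by move=> /(congr1 (fun z => z + 2 * phi y)); rewrite /l /m !subrK.
have gE y : B0 y -> g y = (E y)^T *m gram e e' (m y - l y) *m E y by move=> /gaE [].
have aE y : B0 y -> h y - (2 * phi y) *: g y =
  (E y)^T *m (gram e e' (m y - l y) *m jordan (l y) (m y)) *m E y by move=> /gaE [].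
have ST x (B0x : B0 x) := frame_structure oB0 sg sh' symg ug sphi0 eis0 sE sl sm e0 e0' lm gE aE B0x.
have uE y : B0 y -> E y \in unitmx by move=> B0y; exact: (frame_unit ug gE B0y).
pose pr y := frame_gradient E phi y.
have spr i j : smooth_on B0 (fun y => pr y i j).
  apply: smooth_mulmx => // [i' j'|i' j'].
    apply: smooth_invmx => // [i2 j2|y B0y]; last by rewrite unitmx_tr uE.
    by apply: (eq_smooth_on oB0 _ (sE j2 i2)) => y _; rewrite mxE.
  by apply: (eq_smooth_on oB0 _ (smooth_partial i' sphi0)) => y _; rewrite mxE.
pose B y := 2 / 3 * pr y (ord6 2) 0; pose B' y := 2 / 3 * pr y (ord6 5) 0.
have sB : smooth_on B0 B by apply: smoothM => //; exact: smooth_cst.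
have sB' : smooth_on B0 B' by apply: smoothM => //; exact: smooth_cst.
(* With this shift s the constant a = s' - s is nonzero whenever epst = 0. *)
have [s Hs] : exists s : R, ((forall x y, W x -> W y -> l x = l y) -> s = l p) /\
    (s = l p \/ s = m p - 1).
  have [cl|ncl] := pselect (forall x y, W x -> W y -> l x = l y); first by exists (l p); split=> //; left.
  by exists (m p - 1); split; [move=> /ncl|right].
have [s' Hs'] : exists s' : R, (forall x y, W x -> W y -> m x = m y) -> s' = m p by exists (m p).
(* As dl = B th3 and th3 vanishes nowhere, the alternative for [l] at a regular point is an
   alternative for [B]. *)
have alt1 : (forall x, B0 x -> B x = 0 /\ l x = s) \/ (forall x, B0 x -> B x != 0).
  case: altl => [cl|nl]; [left|right] => x B0x; have [dl _ _ _] := ST x B0x.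
    split; last by rewrite (Hs.1 cl); apply: cl; [exact: B0W|exact: Wp].
    have [k k0] := unitmx_row_neq0 (uE x B0x) (ord6 2).
    have := dl k; rewrite (partial_zero_cst k oW (B0W _ B0x) cl) => /esym/eqP.
    by rewrite mulf_eq0 (negbTE k0) orbF => /eqP.
  have [k k0] := nl x (B0W _ B0x); apply: contraNneq k0 => Bx.
  by rewrite [X in X == 0](dl k) -/(B x) Bx mul0r.
have alt2 : (forall x, B0 x -> B' x = 0 /\ m x = s') \/ (forall x, B0 x -> B' x != 0).
  case: altm => [cl|nl]; [left|right] => x B0x; have [_ dm _ _] := ST x B0x.
    split; last by rewrite (Hs' cl); apply: cl; [exact: B0W|exact: Wp].
    have [k k0] := unitmx_row_neq0 (uE x B0x) (ord6 5).
    have := dm k; rewrite (partial_zero_cst k oW (B0W _ B0x) cl) => /esym/eqP.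
    by rewrite mulf_eq0 (negbTE k0) orbF => /eqP.
  have [k k0] := nl x (B0W _ B0x); apply: contraNneq k0 => Bx.
  by rewrite [X in X == 0](dm k) -/(B' x) Bx mul0r.
have [r1 [eps [x1 [x2 [x3 [A [r10 B1B0 eps01 [sx1 sx2 sx3 sA] P1]]]]]]] :=
  @block_coordinates R B0 p (fun k x => E x (ord6 0) k) (fun k x => E x (ord6 1) k)
    (fun k x => E x (ord6 2) k) B l s oB0 B0p (sE _) (sE _) (sE _) sB sl
    (fun x Bx k => let: And4 dl _ _ _ := ST x Bx in dl k)
    (fun x Bx => unitmx_row_neq0 (uE x Bx) _)
    (fun x Bx i k => let: And4 _ _ _ C := ST x Bx in (C i k).1) alt1.
pose B1 : set V := ball p r1; have oB1 : open B1 by exact: ball_open.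
have B1p : B1 p by exact: ballxx.
have sub1 (f : V -> R) : smooth_on B0 f -> smooth_on B1 f by exact: smooth_on_sub.
have alt3 : (forall x, B1 x -> B' x = 0 /\ m x = s') \/ (forall x, B1 x -> B' x != 0).
  by case: alt2 => H; [left|right] => x /B1B0; exact: H.
have [r2 [epst [x4 [x5 [x6 [At [r20 B2B1 epst01 [sx4 sx5 sx6 sAt] P2]]]]]]] :=
  @block_coordinates R B1 p (fun k x => E x (ord6 3) k) (fun k x => E x (ord6 4) k)
    (fun k x => E x (ord6 5) k) B' m s' oB1 B1p (fun k => sub1 _ (sE _ k)) (fun k => sub1 _ (sE _ k))
    (fun k => sub1 _ (sE _ k)) (sub1 _ sB') (sub1 _ sm)
    (fun x Bx k => let: And4 _ dm _ _ := ST x (B1B0 x Bx) in dm k)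
    (fun x Bx => unitmx_row_neq0 (uE x (B1B0 x Bx)) _)
    (fun x Bx i k => let: And4 _ _ _ C := ST x (B1B0 x Bx) in (C i k).2) alt3.
pose B2 : set V := ball p r2; have oB2 : open B2 by exact: ball_open.
have B2B0 : B2 `<=` B0 by move=> x /B2B1 /B1B0.
have B2p : B2 p by exact: ballxx.
pose X u : V := \row_i match nat_of_ord i with
  | 0 => x1 u | 1 => x2 u | 2 => x3 u | 3 => x4 u | 4 => x5 u | _ => x6 u end.
pose k0 := phi p - 3 / 2 * (l p + m p).
have ixs := (@ixE 0 isT, @ixE 1 isT, @ixE 2 isT, @ixE 3 isT, @ixE 4 isT, @ixE 5 isT).
have crdX u : [/\ crd 1 (X u) = x1 u, crd 2 (X u) = x2 u & crd 3 (X u) = x3 u] /\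
              [/\ crd 4 (X u) = x4 u, crd 5 (X u) = x5 u & crd 6 (X u) = x6 u].
  by rewrite /crd !ixs /X !mxE.
have crdF : [/\ (fun y => crd 2 (X y)) = x2, (fun y => crd 3 (X y)) = x3,
   (fun y => crd 5 (X y)) = x5 & (fun y => crd 6 (X y)) = x6].
  by split; apply/funext => u; have [[_ c2 c3] [_ c5 c6]] := crdX u.
have sub2 (f : V -> R) : smooth_on B0 f -> smooth_on B2 f by exact: smooth_on_sub.
have sub12 (f : V -> R) : smooth_on B1 f -> smooth_on B2 f by exact: smooth_on_sub.
have sX : smooth_map_on B2 X.
  move=> i; apply: (eq_smooth_on oB2 (fun y _ => esym (mxE _ _ 0 i))).
  by move: i; apply: ord6_ind => //=; exact: sub12.
have phiE u : B2 u -> phi u = 3 / 2 * (l u + m u) + k0.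
  move=> B2u; have sF : smooth_on B2 (fun u => phi u - 3 / 2 * (l u + m u)).
    apply: smoothB => //; first exact: sub2.
    by apply: smoothM => //; [exact: smooth_cst|apply: smoothD => //; exact: sub2].
  have H := constant_on_ball sF _ B2u; rewrite /k0 -H; first by rewrite addrC subrK.
  move=> y B2y k; have B0y := B2B0 y B2y; have [_ _ dphi _] := ST y B0y.
  have d1 := smooth_differentiable sphi0 B0y; have d2 := smooth_differentiable sl B0y.
  have d3 := smooth_differentiable sm B0y.
  have dlm : differentiable (fun u => l u + m u) y by exact: differentiableD.
  have dc : differentiable (fun=> 3 / 2 : R) y by exact: differentiable_cst.
  have pc : partial k (fun=> 3 / 2 : R) y = 0 by exact: derive_cst.
  rewrite /partial deriveB; [|exact: diff_derivable|exact/diff_derivable/differentiableM].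
  by rewrite -!/(partial k _ y) partialM // partialD // pc dphi mul0r add0r subrr.
exists r2, e, e', eps, epst, s, (s' - s), k0, E, l, m, A, At, X; split.
- by split=> // x /B2B0 /B0U.
- split=> // epst0; have [_ _ + _ _] := P2 p B2p; rewrite epst0 mul0r => /esym/eqP.
  rewrite subr_eq0 => /eqP <-; case: Hs.2 => ->; first by rewrite subr_eq0 lm.
  by rewrite opprB addrC subrK oner_eq0.
- by split=> //; exact: sub12.
- move=> u B2u; have B1u := B2B1 u B2u; have B0u := B1B0 u B1u.
  have [A0 _ q1 D1 _] := P1 u B1u; have [At0 _ q2 D2 _] := P2 u B2u.
  have [[c1 c2 c3] [c4 c5 c6]] := crdX u.
  split; [exact: gE|exact: aE|by split=> //; exact: lm| |].
    by split; [rewrite c3|rewrite c6 q2; ring|exact: phiE].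
  apply/matrixP => i j; rewrite jacobianE; last by move=> b; exact: smooth_differentiable (sX b) B2u.
  rewrite mxE sum6 !mxE c1 c4; have [d1 d2 d3] := D1 i; have [d4 d5 d6] := D2 i.
  have Xj : (fun u => X u 0 j) = match nat_of_ord j with
    | 0 => x1 | 1 => x2 | 2 => x3 | 3 => x4 | 4 => x5 | _ => x6 end.
    by apply/funext => v; rewrite mxE; move: j; apply: ord6_ind.
  rewrite Xj; move: j {Xj}; apply: ord6_ind => /=.
  - by rewrite d1; ring.
  - by rewrite d2; field.
  - by rewrite d3; field.
  - by rewrite d4; ring.
  - by rewrite d5; field.
  by rewrite d6; field.
move=> u B2u; have B1u := B2B1 u B2u; have [[c1 c2 c3] [c4 c5 c6]] := crdX u.
have [_ h1 _ _ [cc Hc]] := P1 u B1u; have [_ h2 _ _ [cc' Hc']] := P2 u B2u.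
have [f2 f3 f5 f6] := crdF; split.
- by rewrite c2.
- by rewrite c5.
- by exists cc => k; rewrite f3 -Hc; congr partial; apply/funext => y; have [[_ -> _] _] := crdX y.
by exists cc' => k; rewrite f6 -Hc'; congr partial; apply/funext => y; have [_ [_ -> _]] := crdX y.
Qed.

End CoordinateFunctions.

(** * Recovering theta and omega; the pulled back tensors *)

Section CanonicalCoordinates.
Context {R : realType}.
Notation V := 'rV[R]_6.
Implicit Types (U W : set V) (g h E : V -> 'M[R]_6) (phi l m : V -> R) (x y p z : V) (X : V -> V).

(** Parametrized by the value of the [i]-th coordinate rather than by the distance from [z], so that
    a restriction to it is a function of that coordinate. *)
Definition axis_line z (i : 'I_6) (t : R) : V := z - z 0 i *: delta_mx 0 i + t *: delta_mx 0 i.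

Lemma ball_axis_line z i (rho t : R) : `|t - z 0 i| < rho -> ball z rho (axis_line z i t).
Proof.
move=> tr; apply/ballP; have -> : axis_line z i t - z = (t - z 0 i) *: delta_mx 0 i.
  by rewrite /axis_line; apply/rowP => j; rewrite !mxE; ring.
by rewrite normrZ (le_lt_trans _ tr) // ler_piMr // norm_delta.
Qed.

Lemma smooth1_axis_line (F : V -> R) z i (rho t : R) : smooth_on (ball z rho) F ->
  `|t - z 0 i| < rho -> smooth1_at t (fun s => F (axis_line z i s)).
Proof.
move=> sF tr; have dG n s : `|s - z 0 i| < rho ->
    is_derive s 1 (fun s => partials (nseq n i) F (axis_line z i s)) (partials (nseq n.+1 i) F (axis_line z i s)).
  by move=> sr; apply: is_derive_coord; apply: sF; exact: ball_axis_line.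
have near_t (s : R) : `|s - z 0 i| < rho -> \forall s' \near s, `|s' - z 0 i| < rho.
  move=> sr; have : 0 < rho - `|s - z 0 i| by rewrite subr_gt0.
  move=> d0; apply/nbhs_ballP; exists (rho - `|s - z 0 i|) => //= s'; rewrite /ball /= => ss'.
  have := ler_distD s s' (z 0 i); rewrite distrC in ss'; move: ss'; lra.
have E n : forall s, `|s - z 0 i| < rho ->
    derive1n n (fun s => F (axis_line z i s)) s = partials (nseq n i) F (axis_line z i s).
  elim: n => [//|n IH] s sr; rewrite derive1nS derive1E.
  rewrite (@near_eq_derive _ _ _ _ (fun s => partials (nseq n i) F (axis_line z i s))).
    by have [_ ->] := dG n s sr.
  by apply: filterS (near_t s sr) => s' /IH.
move=> n; apply: (@near_eq_derivable _ _ _ (fun s => partials (nseq n i) F (axis_line z i s))).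
  by apply: filterS (near_t t tr) => s' s'r; rewrite E.
by have [] := dG n t tr.
Qed.

(** The segment from [y] to the point of the axis line with the same [i]-th coordinate stays in the
    ball and has no component along [i]. *)
Lemma depends_on_coordinate (F : V -> R) z i (rho : R) : smooth_on (ball z rho) F ->
  (forall y j, ball z rho y -> j != i -> partial j F y = 0) ->
  forall y, ball z rho y -> F y = F (axis_line z i (y 0 i)).
Proof.
move=> sF dF y yr; set y' := axis_line _ _ _.
have y'r : ball z rho y'.
  apply: ball_axis_line; apply: le_lt_trans ((ballP _ _ _).1 yr).
  by have := coord_norm (y - z) i; rewrite !mxE.
have yE : y + (y' - y) = y' by rewrite addrC subrK.
have seg (t : R) : 0 <= t <= 1 -> ball z rho (y + t *: (y' - y)).
  by move=> t01; apply: ball_segment; rewrite ?yE.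
have [t t01] := mvt (fun t t01 => smooth_differentiable sF (seg t t01)).
rewrite yE big1 => [/eqP|j _]; first by rewrite subr_eq0 => /eqP.
have [->|ji] := eqVneq j i; last by rewrite dF ?mulr0 //; exact: seg.
rewrite (_ : (y' - y) 0 i = 0) ?mul0r //.
by rewrite /y' /axis_line !mxE !eqxx /=; ring.
Qed.

Section Pullback.
Variables (U : set V) (g h : V -> 'M[R]_6) (phi : V -> R) (p : V) (r e e' eps epst s a k : R)
  (E : V -> 'M[R]_6) (l m A At : V -> R) (X : V -> V).
Hypothesis CS : coordinate_system U g h phi p r e e' eps epst s a k E l m A At X.

(** The eigenvalues of [canonical_a] are l - s and m - s, those of h - 2 phi g are l and m, and phi
    = 3/2 (l + m) + k. Comparing coefficients of g in h gives 3 c = 2 k + 6 s + s, with 6 s from f3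
    + f6 and s from the shift; what is then missing in phi is k + 3 s - c. *)
Lemma pullback_canonical (th om : R -> R) u
  (D := CanonicalData e e' eps epst a ((2 * k + 7 * s) / 3) th om) : ball p r u ->
  fA D (X u) = A u -> fAt D (X u) = At u ->
  [/\ phi u = canonical_phi D (X u) + (k + 3 * s - (2 * k + 7 * s) / 3),
      g u = pullback X (canonical_g D) u & h u = pullback X (canonical_h D) u].
Proof.
move=> ur EA EAt; have [_ _ _ /(_ u ur) [gE aE [A0 At0 lm] [q3 q6 qphi] JE] _] := CS.
have F3 : f3 D (X u) = l u - s by rewrite /f3.
have F6 : f6 D (X u) = m u - s by rewrite /f6 /= q6 subrK.
have Fd : f6 D (X u) - f3 D (X u) = m u - l u by rewrite F3 F6; ring.
have d0 : f6 D (X u) - f3 D (X u) != 0 by rewrite Fd subr_eq0.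
have K : block33 (coordinate_entry (eps * crd 1 (X u)) (A u)) (coordinate_entry (epst * crd 4 (X u)) (At u))
  = coordinate_mx D (X u) by rewrite /coordinate_mx EA EAt.
have nA : fA D (X u) != 0 by rewrite EA.
have nAt : fAt D (X u) != 0 by rewrite EAt.
have pg : pullback X (canonical_g D) u = g u.
  rewrite /pullback JE K trmx_mul trmxK !mulmxA.
  rewrite -[(E u)^T *m _ *m _ *m _]mulmxA -[(E u)^T *m _ *m _]mulmxA [coordinate_mx _ _ *m _]mulmxA.
  by rewrite coordinate_canonical_g // Fd /= gE.
have pa : pullback X (canonical_a D) u = h u - (2 * phi u + s) *: g u.
  rewrite /pullback JE K trmx_mul trmxK !mulmxA.
  rewrite -[(E u)^T *m _ *m _ *m _]mulmxA -[(E u)^T *m _ *m _]mulmxA [coordinate_mx _ _ *m _]mulmxA.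
  rewrite coordinate_canonical_a // Fd /= F3 F6 -jordan_shift mulmxBr mul_mx_scalar.
  by rewrite mulmxBr mulmxBl -aE -scalemxAr -scalemxAl -gE scalerDl opprD addrA.
split=> //; first by rewrite qphi /canonical_phi F3 F6 /=; field.
rewrite /pullback /canonical_h mulmxDr mulmxDl -scalemxAr -scalemxAl -/(pullback X (canonical_a D) u) -/(pullback X (canonical_g D) u) pa pg F3 F6 /=.
by rewrite -addrA -scaleNr -scalerDl [X in _ + X *: _](_ : _ = 0) ?scale0r ?addr0 // qphi; field.
Qed.

Hypothesis ug : forall u, ball p r u -> g u \in unitmx.

(* g = J C J^T is invertible; at a single point theta and omega may be taken
   constant. *)
Lemma coordinates_jacobian_unit u : ball p r u -> 'J X u \in unitmx.
Proof.
move=> ur; have [_ G _] := @pullback_canonical (fun=> A u - eps * crd 2 (X u))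
  (fun=> At u - epst * crd 5 (X u)) u ur (subrKC _ _) (subrKC _ _).
by have := ug ur; rewrite G /pullback !unitmx_mul => /andP[/andP[]].
Qed.

Theorem canonical_coordinates_exist : canonical_coordinates_at U g h phi p.
Proof.
have [[r0 BU e1 e1'] [eps01 epst01 a0] [sX sA sAt] P1 P2] := CS.
pose B : set V := ball p r; have oB : open B by exact: ball_open.
have Bp : B p by exact: ballxx.
have [W [rho [Y [rho0 Wp WB [[oW oW'] XY YX sXW sYW'] chain]]]] :=
  inverse_coordinates oB Bp sX coordinates_jacobian_unit.
pose W' : set V := ball (X p) rho.
have dX u b : B u -> differentiable (fun y => X y 0 b) u by exact: smooth_differentiable (sX b).
(* A function whose differential is proportional to that of the [i]-th coordinate equals its
   restriction to the axis line through the image of [p]; it is applied to A - eps x2 and At - epst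
   x5. *)
have key (H : V -> R) (i : 'I_6) : smooth_on B H ->
    (forall u, B u -> exists c, forall k, partial k H u = c * partial k (fun y => X y 0 i) u) ->
    (forall t, `|t - X p 0 i| < rho -> smooth1_at t (fun s => H (Y (axis_line (X p) i s)))) /\
    (forall u, W u -> H (Y (axis_line (X p) i (X u 0 i))) = H u).
  move=> sH cH; have [sF dF] := chain H (smooth_on_sub WB sH).
  split=> [t tr|u Wu]; first exact: (smooth1_axis_line sF tr).
  have [W'u YXu] := XY u Wu; rewrite -[in RHS]YXu; apply/esym.
  apply: (depends_on_coordinate sF) W'u => z j W'z ji; rewrite dF //.
  have [WY _] := YX z W'z; have BY := WB _ WY; have [c Hc] := cH _ BY.
  (* The [j]-th partial in the new coordinates is c times an off-diagonal entry of the inverse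
     Jacobian times the Jacobian. *)
  transitivity (c * (invmx ('J X (Y z)) *m 'J X (Y z)) j i).
    rewrite [(_ *m _) j i]mxE mulr_sumr; apply: eq_bigr => b _.
    by rewrite Hc jacobianE 1?mulrCA // => b'; exact: dX.
  by rewrite mulVmx ?coordinates_jacobian_unit // mxE (negbTE ji) mulr0.
have sHA : smooth_on B (fun y => A y - eps * crd 2 (X y)).
  by apply: smoothB => //; apply: smoothM => //; [exact: smooth_cst|exact: (sX (ix 2))].
have sHAt : smooth_on B (fun y => At y - epst * crd 5 (X y)).
  by apply: smoothB => //; apply: smoothM => //; [exact: smooth_cst|exact: (sX (ix 5))].
have [th1 th2] := key _ (ix 3) sHA (fun u Bu => let: And4 _ _ H _ := P2 u Bu in H).
have [om1 om2] := key _ (ix 6) sHAt (fun u Bu => let: And4 _ _ _ H := P2 u Bu in H).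
pose th (t : R) := A (Y (axis_line (X p) (ix 3) t)) - eps * crd 2 (X (Y (axis_line (X p) (ix 3) t))).
pose om (t : R) := At (Y (axis_line (X p) (ix 6) t)) - epst * crd 5 (X (Y (axis_line (X p) (ix 6) t))).
pose D := CanonicalData e e' eps epst a ((2 * k + 7 * s) / 3) th om.
have near_crd z i : W' z -> `|z 0 i - X p 0 i| < rho.
  move=> /ballP; apply: le_lt_trans; by have := coord_norm (z - X p) i; rewrite !mxE.
exists W, W', X, Y, D, (k + 3 * s - (2 * k + 7 * s) / 3); split.
- by split=> // u /WB /BU.
- by split.
- split=> //; first by move=> z W'z; split; [apply: th1|apply: om1]; exact: near_crd.
  move=> z W'z; have [WY XYz] := YX z W'z; have [t1 t2 _ _] := P2 _ (WB _ WY).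
  have := th2 _ WY; have := om2 _ WY; rewrite XYz in t1 t2 *; move=> Eo Et.
  split=> [z0|z0]; [rewrite [X in X != 0]Et t1 //|rewrite [X in X != 0]Eo t2 //];
    by rewrite invr_eq0 pnatr_eq0.
move=> u Wu; apply: (@pullback_canonical th om u (WB _ Wu)).
  by rewrite /fA /= /th (th2 u Wu) addrC subrK.
by rewrite /fAt /= /om (om2 u Wu) addrC subrK.
Qed.

End Pullback.
End CanonicalCoordinates.

(** * Density of the regular points *)

Section RegularPoints.
Context {R : realType}.
Notation V := 'rV[R]_6.
Implicit Types (U W : set V) (g h : V -> 'M[R]_6) (phi l m f : V -> R) (x y p q : V).

Lemma constant_or_submersive_sub W W' f : W' `<=` W ->
  constant_or_submersive W f -> constant_or_submersive W' f.
Proof.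
by move=> WW [H|H]; [left => x y /WW Wx /WW Wy; exact: H|right => x /WW; exact: H].
Qed.

(** Either all partials vanish on the ball and [f] is constant there, or some partial is nonzero at
    a point [q] and remains so near [q]. *)
Lemma constant_or_submersive_nearby f p (r : R) : 0 < r -> smooth_on (ball p r) f ->
  exists2 q, ball p r q & exists2 s : R, 0 < s &
    ball q s `<=` ball p r /\ constant_or_submersive (ball q s) f.
Proof.
move=> r0 sf; have oB : open (ball p r : set V) by exact: ball_open.
have [[q [k [bq nk]]]|nex] := pselect (exists q k, ball p r q /\ partial k f q != 0); last first.
  exists p; [exact: ballxx|exists r => //; split=> //; left => x y bx by_].
  have df z : ball p r z -> forall k, partial k f z = 0.
    by move=> bz k; apply/eqP/negPn/negP => H; apply: nex; exists z, k.
  by rewrite (constant_on_ball sf df bx) (constant_on_ball sf df by_).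
exists q => //.
have sk : smooth_on (ball p r) (fun y => partial k f y ^+ 2) by apply: smoothX => //; exact: smooth_partial.
have n1 : \forall y \near q, 0 < partial k f y ^+ 2.
  by apply: (near_pos oB sk bq); rewrite lt_neqAle eq_sym sqrf_eq0 nk sqr_ge0.
have n2 : \forall y \near q, ball p r y by apply: (open_near oB bq).
have [s s0 Bs] := near_ball (filterI n1 n2).
exists s => //; split=> [y /Bs []//|]; right => x /Bs [+ _]; exists k.
by apply: contraTneq a => ->; rewrite expr0n /= ltxx.
Qed.

(** Used to reorder the roots: [char33_smooth_roots] lists the larger one first, while [char33] may
    present them in either order. *)
Lemma jordan_swap (l m : R) : exists2 S : 'M[R]_6, S \in unitmx & jordan l m *m S = S *m jordan m l.
Proof.
pose S : 'M[R]_6 := \matrix_(i, j) ((i + 3) %% 6 == j)%N%:R.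
have SS : S *m S = 1%:M.
  by apply/matrixP; apply: ord6_ind; apply: ord6_ind; rewrite !mxE sum6 !mxE /=; ring.
exists S; first by have [] := mulmx1_unit SS.
by apply/matrixP; apply: ord6_ind; apply: ord6_ind; rewrite !mxE !sum6 !mxE /= /jordan_entry /=; ring.
Qed.

Lemma char33_sym (G H : 'M[R]_6) (l m : R) : char33 G H l m -> char33 G H m l.
Proof.
move=> [lm [P uP]]; rewrite block_jordan => E; split; first by rewrite eq_sym.
have [S uS ES] := jordan_swap l m.
exists (P *m S); first by rewrite unitmx_mul uP.
by rewrite block_jordan mulmxA E -!mulmxA ES.
Qed.

Lemma char33_traces (G H : 'M[R]_6) (l m : R) : char33 G H l m ->
  let L := invmx G *m H in \tr L = 3 * (l + m) /\ \tr (L *m L) = 3 * (l ^+ 2 + m ^+ 2).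
Proof.
move=> [_ [P uP]]; rewrite block_jordan => E L.
have LE : L = P *m jordan l m *m invmx P by rewrite -E mulmxK.
rewrite LE; split.
  rewrite -mulmxA mxtrace_mulC -mulmxA mulVmx // mulmx1 /mxtrace sum6 !mxE /= /jordan_entry /=; ring.
rewrite -!mulmxA mulKmx // mxtrace_mulC -!mulmxA mulVmx // mulmx1.
by rewrite /mxtrace sum6 !mxE !sum6 !mxE /= /jordan_entry /=; ring.
Qed.

(** The traces of L and L^2 give l + m and (l - m)^2 as smooth functions. The latter is positive
    because the roots are distinct, so its square root is smooth as well. *)
Lemma char33_smooth_roots U g h : open U -> metric U g -> symmetric_tensor U h -> char33_on U g h ->
  exists l m, [/\ smooth_on U l, smooth_on U m & forall x, U x -> char33 (g x) (h x) (l x) (m x)].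
Proof.
move=> oU [[sg _] sigg] [sh _] ch.
have ug y : U y -> g y \in unitmx by move=> /sigg; exact: metric_unit.
pose L y := invmx (g y) *m h y.
have sL : smooth_tensor_on U L by apply: smooth_mulmx => //; exact: smooth_invmx.
have sLL : smooth_tensor_on U (fun y => L y *m L y) by exact: smooth_mulmx.
pose a y := 3^-1 * \tr (L y); pose b y := 2 / 3 * \tr (L y *m L y) - a y ^+ 2.
have sa : smooth_on U a by apply: smoothM => //; [exact: smooth_cst|exact: smooth_sum].
have sb : smooth_on U b.
  apply: smoothB => //; last exact: smoothX.
  by apply: smoothM => //; [exact: smooth_cst|exact: smooth_sum].
have abE y (l m : R) : char33 (g y) (h y) l m -> a y = l + m /\ b y = (l - m) ^+ 2.
  by move=> /char33_traces [t1 t2]; rewrite /b /a t1 t2; split; field.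
have b0 y : U y -> 0 < b y.
  move=> /ch [l [m c]]; have [_ ->] := abE y l m c.
  by case: c => lm _; rewrite lt_neqAle sqr_ge0 eq_sym sqrf_eq0 subr_eq0 lm.
have ss : smooth_on U (fun y => Num.sqrt (b y)) by exact: smooth_sqrt.
exists (fun y => 2^-1 * (a y + Num.sqrt (b y))), (fun y => 2^-1 * (a y - Num.sqrt (b y))); split.
- by apply: smoothM => //; [exact: smooth_cst|exact: smoothD].
- by apply: smoothM => //; [exact: smooth_cst|exact: smoothB].
move=> y /ch [l [m c]]; have [-> ->] := abE y l m c; rewrite sqrtr_sqr.
have half (u v : R) : 2^-1 * (u + v + (u - v)) = u /\ 2^-1 * (u + v - (u - v)) = v.
  by split; field.
have [ml|lm] := leP m l.
  by rewrite ger0_norm ?subr_ge0 //; have [-> ->] := half l m.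
rewrite ltr0_norm ?subr_lt0 // opprB [l + m]addrC; have [-> ->] := half m l.
exact: char33_sym.
Qed.

Theorem regular_points_dense U g h phi : open U -> metric U g -> symmetric_tensor U h ->
  smooth_on U phi -> char33_on U g h -> U `<=` closure [set p | U p /\ regular_point U g h phi p].
Proof.
move=> oU mg sh sphi ch p Up B nB.
have [l [m [sl sm clm]]] := char33_smooth_roots oU mg sh ch.
have nU : \forall y \near p, U y by apply: (open_near oU Up).
have [r r0 BU] := near_ball (filterI nB nU).
have s2 : smooth_on U (fun y => 2 * phi y) by apply: smoothM => //; exact: smooth_cst.
have sub (f : V -> R) q s : (ball q s : set V) `<=` U -> smooth_on U f -> smooth_on (ball q s) f.
  by move=> H; exact: smooth_on_sub.
have BrU : ball p r `<=` U by move=> y /BU [].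
(* One shrinking for each eigenvalue; the alternative reached for the first survives on the smaller
   ball of the second. *)
have [q bq [s s0 [Bs c1]]] := constant_or_submersive_nearby r0 (sub _ _ _ BrU (smoothB oU sl s2)).
have BsU : ball q s `<=` U by move=> y /Bs /BrU.
have [q' bq' [s' s'0 [Bs' c2]]] := constant_or_submersive_nearby s0 (sub _ _ _ BsU (smoothB oU sm s2)).
have Bs'U : ball q' s' `<=` U by move=> y /Bs' /BsU.
exists q'; split; last by have [] := BU q' (Bs q' bq').
split; first exact: BsU.
exists (ball q' s'), l, m; split=> //.
- by split; [exact: ball_open|exact: ballxx].
- by split; exact: sub.
- by move=> x /Bs'U; exact: clm.
by split=> //; exact: constant_or_submersive_sub c1.
Qed.

End RegularPoints.

Theorem theorem1 (R : realType) (U : set 'rV[R]_6)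
  (g h : 'rV[R]_6 -> 'M[R]_6) (phi : 'rV[R]_6 -> R)
  (openU : open U)
  (metric_g : metric U g)
  (sym_h : symmetric_tensor U h)
  (smooth_phi : smooth_on U phi)
  (char_h : char33_on U g h)
  (eisenhart_h : eisenhart U g h phi) :
  U `<=` closure [set p | U p /\ regular_point U g h phi p] /\
  (forall p, U p -> regular_point U g h phi p ->
     canonical_coordinates_at U g h phi p).
Proof.
split=> [|p Up rp]; first exact: regular_points_dense.
have [r [e [e' [eps [epst [s [a [k [E [l [m [A [At [X CS]]]]]]]]]]]]]] :=
  coordinate_system_exists openU metric_g sym_h smooth_phi eisenhart_h Up rp.
apply: (canonical_coordinates_exist CS) => u ur; have [[_ BU _ _] _ _ _ _] := CS.
exact/metric_unit/metric_g.2/BU.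
Qed.
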